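(* Assume the weak unobstructedness assumption stated in the context. Assume moreover that strictly negative Maslov index does not contribute to the structure maps $m_k$ (i.e. $m_{k,\beta}=0$ whenever $\mu(\beta)<0$), and that the potential function $W\equiv 0$ over $U$. Then for every $u\in U$ and every purely imaginary $\alpha\in H^1(L_u,\mathbb{C})$, the object $\Phi^\tau(\mathcal{L}_u(\alpha))$ is quasi-isomorphic, as an $\mathcal{O}^{\mathrm{hol}}_{TU}$-module, to the skyscraper sheaf $\Lambda^\pi(u,\alpha)[-n]$ supported at $u\in U$.
   Context: **Geometric data.** $(M,\omega)$ is a symplectic manifold of dimension $2n$, $\pi:M\to B$ a Lagrangian torus fibration, $U$ a small contractible open subset of its smooth locus, $M(U)=\pi^{-1}(U)$, $L_p=\pi^{-1}(p)$ for $p\in U$, and $u_0\in U$ a base point. $x_1,\dots,x_n$ are action coordinates on $U$, $y_1^\vee,\dots,y_n^\vee$ angle coordinates on the fibres, $\omega=\sum_i dx_i\wedge dy_i^\vee$ on $M(U)$, and $e_i=dy_i^\vee$ is the resulting flat integral basis of $R^1\pi_*\mathbb{Z}$. **Fukaya's operators (known, taken as given).** Fix an $\omega$-tamed almost complex structure $J$. For $p\in U$ let $\phi_p$ be the time-one flow of $\chi\sum_i (x_i(p)-x_i(u_0))\,\partial/\partial x_i$, $\chi$ a cutoff function equal to $1$ over $U$; it carries $L_{u_0}$ to $L_p$, and $U$ is small enough that $(\phi_p)_*J$ is $\omega$-tamed. Using $(\phi_p)_*J$ for $L_p$, the moduli spaces $\mathcal{M}_{k+1,\beta}$ of stable holomorphic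 disks with $k+1$ boundary marked points and boundary on $L_p$ are identified for all $p$, so the operators $m_{k,\beta}(\alpha_1,\dots,\alpha_k)=(\mathrm{ev}_0)_!(\mathrm{ev}_1^*\alpha_1\wedge\cdots\wedge \mathrm{ev}_k^*\alpha_k)$ on $\Omega^*(L_p,\mathbb{C})$, of degree $2-k-\mu(\beta)$, do not depend on $p$. $G$ is the (trivialized) local system of monoids of disk classes $\beta$ generated by those with non-empty moduli space; $\beta$ has energy $\int_\beta\omega$, Maslov index $\mu(\beta)\in 2\mathbb{Z}$ and boundary $\partial\beta\in H_1(L_p,\mathbb{Z})$. The relative Novikov ring is $\Lambda^\pi=\{\sum_i a_iT^{\beta_i}: a_i\in\mathbb{C},\ \beta_i\in G,\ \#\{i: a_i\ne 0,\ \int_{\beta_i}\omega|_{u_0}\le E\}<\infty\ \forall E\in\mathbb{R}\}$, with $T^\beta$ of degree $\mu(\beta)$. Put $m_k=\sum_{\beta\in G} m_{k,\beta}T^\beta$, extended $\Lambda^\pi$-linearly. It is known (Fukaya–Oh–Ohta–Ono, Fukaya) that the $m_k$ form an $A_\infty$ structure (of degree one on the shifted complex, $\sum m_{r+1+t}(\mathrm{id}^{r}\otimes m_s\otimes\mathrm{id}^t)=0$), with strict unit $\mathbf{1}$, cyclic for the Poincaré pairing, with $\beta=0$ part the de Rham algebra, and satisfying the divisor equation $\sum_{l_0+\cdots+l_k=l} m_{k+l,\beta}(b^{\otimes l_0},\alpha_1,b^{\otimes l_1},\dots,\alpha_k,b^{\otimes l_k})=\frac{1}{l!}\langle b,\partial\beta\rangle^l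 m_{k,\beta}(\alpha_1,\dots,\alpha_k)$ for a degree-one class $b$. The same holds for the canonical (minimal) model on $H^*(L_p,\Lambda^\pi)$, which is used here; its $\beta=0$ part is the exterior algebra $H^*(L_p,\mathbb{C})$. The other sign convention is $m_k(a_1\otimes\cdots\otimes a_k)=(-1)^{\epsilon_k}m_k^\epsilon(a_1\otimes\cdots\otimes a_k)$, $\epsilon_k=\sum_{i=1}^{k-1}(k-i)|a_i|$. **$\mathcal{O}^{\omega,\mathrm{can}}$.** $\mathcal{H}=R\pi_*\Lambda^\pi\otimes C_U^\infty$ has fibre $H^*(L_p,\Lambda^\pi)$, with $m_k$ acting $C^\infty_U$-linearly and Gauss–Manin connection $\nabla$ given by $\nabla e_i=0$, $\nabla(T^\beta)=-\sum_i\langle\partial\beta,e_i\rangle T^\beta dx_i$ and the Leibniz rule. On $\mathcal{H}\otimes_{C^\infty_U}\Omega_U^*$ put $\nabla(f\otimes\alpha)=(\nabla f)\wedge\alpha+(-1)^{|f|}f\otimes d\alpha$ and $m_k^\epsilon(f_1\otimes\alpha_1,\dots,f_k\otimes\alpha_k)=(-1)^{\eta_k}m_k^\epsilon(f_1,\dots,f_k)\otimes(\alpha_1\wedge\cdots\wedge\alpha_k)$, $\eta_k=\sum_{i=1}^{k-1}|\alpha_i|(|f_{i+1}|+\cdots+|f_k|)$. With $\omega=-\sum_i e_i\otimes dx_i$, $\mathcal{O}^{\omega,\mathrm{can}}$ is the curved $A_\infty$ algebra over $R=\Omega_U^*(\Lambda^\pi)$ on this complex with $\hat m_0^\epsilon=m_0^\epsilon-\omega$,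 $\hat m_1^\epsilon=m_1^\epsilon+\nabla$, $\hat m_k^\epsilon=m_k^\epsilon$ $(k\ge2)$. **Weak unobstructedness assumption.** For every $p\in U$ the $m_0$ term of $H^*(L_p,\Lambda^\pi)$ is a scalar multiple of $\mathbf{1}$. Consequently for $b\in H^1(L_p,\Lambda^\pi)$, $\sum_{k\ge 0}m_k(b^{\otimes k})=W(p,b)\mathbf{1}$ for a scalar $W(p,b)$ (the potential function). **$\mathcal{L}_u(\alpha)$.** For $u\in U$ and purely imaginary $\alpha\in H^1(L_u,\mathbb{C})$, $\mathcal{L}_u(\alpha)$ is the rank one twisted complex over $\mathcal{O}^{\omega,\mathrm{can}}$ defined by the weak Maurer–Cartan element $\theta$ with $\nabla\theta=\omega$, $\theta|_u=\alpha$, explicitly $\theta=\sum_i(x_i-x_i(u))e_i+\alpha$ (weak Maurer–Cartan: $\sum_k(-1)^{k(k-1)/2}\hat m_k^\epsilon(\theta^{\otimes k})$ is a scalar multiple of $\mathbf{1}$). **$\mathcal{O}^{\mathrm{hol}}_{TU}$.** Let $y_i$ be the coordinates dual to the $e_i$; $TU$ with coordinates $(x,y)$ is identified with pairs $(p,b)$, $b\in H^1(L_p,\mathbb{C})$ purely imaginary, by $b=\sum_i-\sqrt{-1}\,y_ie_i$, so $W$ becomes a $\Lambda^\pi$-valued function on $TU$ and $(u,\alpha)$ a point of $TU$. $C^\infty_{TU}(\Lambda^\pi)$ is the space of series $\sum_j f_jT^{\beta_j}$, $f_j\in C^\infty_{TU}$, with finitely many non-zero terms below any energy bound. $\mathcal{O}^{\mathrm{hol}}_{TU}$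 is the differential graded algebra $C^\infty_{TU}(\Lambda^\pi)\otimes\Omega^*_U$ with $\bar\partial=\sum_i(\partial_{x_i}+\sqrt{-1}\,\partial_{y_i})dx_i$ ($\partial_{x_i}T^\beta=-\langle\partial\beta,e_i\rangle T^\beta$, $\partial_{y_i}T^\beta=0$), and curvature $-W$ (zero under the present hypothesis); it is a sheaf over $U$. **$\Phi^\tau(\mathcal{L}_u(\alpha))$.** Let $\tau=\sum_i-\sqrt{-1}\,y_i\otimes e_i\in\mathcal{O}^{\mathrm{hol}}_{TU}\otimes_R\mathcal{O}^{\omega,\mathrm{can}}$. As a sheaf $\Phi^\tau(\mathcal{L}_u(\alpha))=\mathcal{O}^{\mathrm{hol}}_{TU}\otimes_R\mathcal{O}^{\omega,\mathrm{can}}\cong\prod_{I\subset\{1,\dots,n\}}\mathcal{O}^{\mathrm{hol}}_{TU}\otimes e_I$ with $e_I=e_{i_1}\wedge\cdots\wedge e_{i_j}$, with $\mathcal{O}^{\mathrm{hol}}_{TU}$ acting on the first factor and differential $\bar\partial+Q$, $Q(f\otimes e_I)=\sum_{k,l\ge0}m_{k+l+1}(\tau^{\otimes l},f\otimes e_I,\theta^{\otimes k})$, where $m_k$ is extended $\mathcal{O}^{\mathrm{hol}}_{TU}$-multilinearly with Koszul signs. **$\Lambda^\pi(u,\alpha)$.** The skyscraper sheaf over $U$ with stalk $\Lambda^\pi$ at $u$, on which $f\in\mathcal{O}^{\mathrm{hol}}_{TU}$ acts by multiplication by its value $f(u,\alpha)$. *)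

(* Defs.v *)
From HB Require Import structures.
From mathcomp Require Import all_boot all_order all_algebra.
From mathcomp Require Import all_classical all_reals all_analysis.
From mathcomp.real_closed Require Import complex.
From Stdlib Require Import Relations.

Set Implicit Arguments.
Unset Strict Implicit.
Unset Printing Implicit Defensive.

Import Order.TTheory GRing.Theory Num.Theory.
Import numFieldNormedType.Exports.

Local Open Scope classical_set_scope.
Local Open Scope ring_scope.
Local Open Scope complex_scope.

Definition contractible (R : realType) (X : normedModType R) (A : set X) : Prop :=
  exists (c : X) (h : R * X -> X),
    [/\ A c, {within `[0%R, 1%R]%classic `*` A, continuous h},
        forall x, A x -> h (0, x) = x /\ h (1, x) = c &
        forall t x, `[0%R, 1%R]%classic t -> A x -> A (h (t, x))].

(** * Sheaves of differential graded algebras and modules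

   All sections live in one ambient group [car]; [sec V d] is the subgroup of
   sections of degree [d] over the open set [V].  (Any sheaf of complexes is of
   this form: take for [car] the product of all its groups of sections.)
   The raw structures carry no axioms; these are the predicates [is_...].
   Opens are the open subsets of the fixed base [U].  *)

Section Sheaves.
Variables (X : topologicalType) (U : set X).

Record raw_complex := RawComplex {
  car : zmodType;
  sec : set X -> int -> set car;
  res : set X -> car -> car; (* [res W]: restriction to [W] *)
  dif : set X -> car -> car  (* [dif V]: differential of sections over [V] *)
}.

Record raw_dgalg := RawDGAlg {
  alg_cpx :> raw_complex;
  alg_one : set X -> car alg_cpx;
  alg_mul : car alg_cpx -> car alg_cpx -> car alg_cpx
}.

Record raw_dgmod (A : raw_dgalg) := RawDGMod {
  mod_cpx :> raw_complex;
  mod_act : car A -> car mod_cpx -> car mod_cpx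
}.

Definition opn (V : set X) : Prop := open V /\ V `<=` U.

Definition sgz_act (Z : zmodType) (a : int) (x : Z) : Z :=
  if odd `|a|%N then - x else x.

Definition is_presheaf_of_complexes (M : raw_complex) : Prop :=
  forall (V : set X) (d : int), opn V ->
  [/\ @sec M V d 0
        /\ (forall x y, @sec M V d x -> @sec M V d y -> @sec M V d (x - y)),
      (forall W x, opn W -> W `<=` V -> @sec M V d x -> @sec M W d (@res M W x))
        /\ (forall W x y, opn W -> W `<=` V -> @sec M V d x -> @sec M V d y ->
              @res M W (x - y) = @res M W x - @res M W y),
      (forall x, @sec M V d x -> @res M V x = x)
        /\ (forall W W' x, opn W -> opn W' -> W' `<=` W -> W `<=` V ->
              @sec M V d x -> @res M W' (@res M W x) = @res M W' x),
      (forall x, @sec M V d x -> @sec M V (d + 1) (@dif M V x))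
        /\ (forall x y, @sec M V d x -> @sec M V d y ->
              @dif M V (x - y) = @dif M V x - @dif M V y) &
      (forall x, @sec M V d x -> @dif M V (@dif M V x) = 0)
        /\ (forall W x, opn W -> W `<=` V -> @sec M V d x ->
              @res M W (@dif M V x) = @dif M W (@res M W x))].

Definition is_sheaf_of_complexes (M : raw_complex) : Prop :=
  is_presheaf_of_complexes M /\
  forall (d : int) (C : set (set X)) (s : set X -> car M),
    (forall W, C W -> opn W) ->
    (forall W, C W -> @sec M W d (s W)) ->
    (forall W W', C W -> C W' ->
       @res M (W `&` W') (s W) = @res M (W `&` W') (s W')) ->
    exists! x, @sec M (\bigcup_(W in C) W) d x
               /\ forall W, C W -> @res M W x = s W.

Definition is_dgalg (A : raw_dgalg) : Prop :=
  is_sheaf_of_complexes A /\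
  forall (V : set X), opn V ->
  [/\ @sec A V 0 (@alg_one A V)
        /\ (forall W, opn W -> W `<=` V -> @res A W (@alg_one A V) = @alg_one A W),
      forall a x, @sec A V a x -> alg_mul (@alg_one A V) x = x /\ alg_mul x (@alg_one A V) = x,
      forall a b x y, @sec A V a x -> @sec A V b y ->
        [/\ @sec A V (a + b) (alg_mul x y),
            forall W, opn W -> W `<=` V ->
              @res A W (alg_mul x y) = alg_mul (@res A W x) (@res A W y) &
            @dif A V (alg_mul x y)
              = alg_mul (@dif A V x) y + sgz_act a (alg_mul x (@dif A V y))],
      forall a b x x' y, @sec A V a x -> @sec A V a x' -> @sec A V b y ->
        alg_mul (x + x') y = alg_mul x y + alg_mul x' y
        /\ alg_mul y (x + x') = alg_mul y x + alg_mul y x' &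
      forall a b c x y z, @sec A V a x -> @sec A V b y -> @sec A V c z ->
        alg_mul x (alg_mul y z) = alg_mul (alg_mul x y) z].

Definition is_dgmod (A : raw_dgalg) (M : raw_dgmod A) : Prop :=
  is_sheaf_of_complexes M /\
  forall (V : set X), opn V ->
  [/\ forall d m, @sec M V d m -> mod_act (@alg_one A V) m = m,
      forall a d x m, @sec A V a x -> @sec M V d m ->
        [/\ @sec M V (a + d) (mod_act x m),
            forall W, opn W -> W `<=` V ->
              @res M W (mod_act x m) = mod_act (@res A W x) (@res M W m) &
            @dif M V (mod_act x m)
              = mod_act (@dif A V x) m + sgz_act a (mod_act x (@dif M V m))],
      forall a d x x' m, @sec A V a x -> @sec A V a x' -> @sec M V d m ->
        mod_act (x + x') m = mod_act x m + mod_act x' m,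
      forall a d x m m', @sec A V a x -> @sec M V d m -> @sec M V d m' ->
        mod_act x (m + m') = mod_act x m + mod_act x m' &
      forall a b d x y m, @sec A V a x -> @sec A V b y -> @sec M V d m ->
        mod_act x (mod_act y m) = mod_act (alg_mul x y) m].

Definition is_dgmod_hom (A : raw_dgalg) (M N : raw_dgmod A)
    (f : set X -> car M -> car N) : Prop :=
  forall (V : set X) (d : int), opn V ->
  [/\ forall x, @sec M V d x -> @sec N V d (f V x),
      forall x y, @sec M V d x -> @sec M V d y -> f V (x - y) = f V x - f V y,
      forall W x, opn W -> W `<=` V -> @sec M V d x ->
        @res N W (f V x) = f W (@res M W x),
      forall x, @sec M V d x -> f V (@dif M V x) = @dif N V (f V x) &
      forall a x m, @sec A V a x -> @sec M V d m -> f V (mod_act x m) = mod_act x (f V m)].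

(* Bijectivity, at every point [p] and in every degree [d], of the map induced
   on stalks of cohomology sheaves, written out in terms of germs. *)
Definition is_quasi_iso (M N : raw_complex) (f : set X -> car M -> car N) : Prop :=
  forall (p : X) (d : int) (V : set X), opn V -> V p ->
  (forall x y, @sec M V d x -> @dif M V x = 0 ->
     @sec N V (d - 1) y -> f V x = @dif N V y ->
     exists W z, [/\ opn W, W p, W `<=` V, @sec M W (d - 1) z &
                     @res M W x = @dif M W z])
  /\
  (forall y, @sec N V d y -> @dif N V y = 0 ->
     exists W x z, [/\ opn W, W p & W `<=` V] /\
       [/\ @sec M W d x, @dif M W x = 0, @sec N W (d - 1) z &
           @res N W y = f W x + @dif N W z]).

Definition qis_step (A : raw_dgalg) (M N : raw_dgmod A) : Prop :=
  [/\ is_dgmod M, is_dgmod N &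
      exists f : set X -> car M -> car N, is_dgmod_hom f /\ is_quasi_iso f].

(* Connected by a zigzag of quasi-isomorphisms of sheaves of dg modules. *)
Definition quasi_isomorphic (A : raw_dgalg) (M N : raw_dgmod A) : Prop :=
  [/\ is_dgalg A, is_dgmod M, is_dgmod N &
      clos_refl_sym_trans _ (@qis_step A) M N].

End Sheaves.

(** * Exterior algebra of the torus *)

(* Cohomology of a fibre with complex coefficients; [x I] is the coefficient
   of [e_I], the wedge of the [e_i], [i] in [I], in increasing order. *)
Notation ext R n := {ffun {set 'I_n} -> R[i]^o}.

Section Exterior.
Variables (R : realType) (n : nat).
Local Notation C := R[i].

Local Notation ext := (ext R n).

(* dx_J /\ dx_K = wsgn J K dx_(J u K), and likewise for the e_I. *)
Definition wsgn (J K : {set 'I_n}) : C :=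
  if [disjoint J & K]
  then (-1) ^+ #|[set jk in finset.setX J K | (jk.2 < jk.1)%N]| else 0.

Definition ebase (I : {set 'I_n}) : ext := [ffun J => (J == I)%:R].

Definition wedge (x y : ext) : ext :=
  [ffun K : {set 'I_n} =>
     \sum_(I : {set 'I_n} | I \subset K) wsgn I (K :\: I) * x I * y (K :\: I)].

(* (-1)^|x| x *)
Definition gsgn (x : ext) : ext := [ffun I : {set 'I_n} => (-1) ^+ #|I| * x I].

(* (-1)^|x| times the integral of x /\ y, the Poincare pairing; the sign makes
   it skew for the shifted grading. *)
Definition pairing (x y : ext) : C := wedge (gsgn x) y [set: 'I_n]%SET.

(* The degree one class with coordinates b in the basis (e_i). *)
Definition H1 (b : 'rV[C]_n) : ext := \sum_i b 0 i *: ebase [set i]%SET.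

(* b^{l_0}, a_1, b^{l_1}, ..., a_k, b^{l_k} *)
Fixpoint weave (b : ext) (ls : seq nat) (s : seq ext) : seq ext :=
  if ls is l :: ls' then
    nseq l b ++ (if s is a :: s' then a :: weave b ls' s' else [::])
  else s.

Definition csum (a : nat -> C) : C :=
  limn (series (fun N => complex.Re (a N)))
  +i* limn (series (fun N => complex.Im (a N))).

End Exterior.

(** * Disk classes and Fukaya's operators

   The fibration over [U] is given in action coordinates: [U] is a set in
   [R^n], and (x, y) are the coordinates of the tangent bundle [U x R^n].  *)

Section DiskClasses.
Variables (R : realType) (n : nat) (U : set 'rV[R]_n) (u0 : 'rV[R]_n).

Inductive monoid_gen (H : zmodType) (S : set H) : set H :=
| monoid_gen0 : monoid_gen S 0
| monoid_genD b c : S b -> monoid_gen S c -> monoid_gen S (b + c).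

Record disk_classes := DiskClasses {
  dclass : zmodType;                      (* the local system of relative classes *)
  moduli_nonempty : set dclass;           (* classes of stable holomorphic disks *)
  energy0 : {additive dclass -> R};       (* symplectic area over [u0] *)
  maslov : {additive dclass -> int};
  maslov_even : forall b, exists c, maslov b = c *+ 2;
  boundary : {additive dclass -> 'rV[int]_n}; (* entries: <boundary of b, e_i> *)
  (* Symplectic area over [p]; the formula is dual to the connection on T^b. *)
  energy (p : 'rV[R]_n) (b : dclass) : R :=
    energy0 b + \sum_i (boundary b 0 i)%:~R * (p 0 i - u0 0 i);
  (* A non-constant disk has positive area: the almost complex structures used
     over all of [U] are tamed. *)
  energy_gt0 : forall p b, U p -> moduli_nonempty b -> b != 0 -> 0 < energy p b;
  gromov_compactness :
    forall E : R, finite_set [set b | moduli_nonempty b /\ energy0 b <= E]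
}.

End DiskClasses.

Arguments moduli_nonempty {R n U u0} d.
Arguments energy0 {R n U u0 d}.
Arguments maslov {R n U u0 d}.
Arguments boundary {R n U u0 d}.

Section FukayaAlgebra.
Variables (R : realType) (n : nat) (U : set 'rV[R]_n) (u0 : 'rV[R]_n).
Local Notation disk_classes := (disk_classes U u0).

Definition disk_monoid (D : disk_classes) : set (dclass D) :=
  monoid_gen (moduli_nonempty D).

(* <b, boundary of beta> *)
Definition bpair (D : disk_classes) (b : 'rV[R[i]]_n) (beta : dclass D) : R[i] :=
  \sum_i b 0 i * (boundary beta 0 i)%:~R.

(* Pairs (beta - c, c) of elements of the monoid are indexed by c. *)
Definition splits (D : disk_classes) (beta : dclass D) : set (dclass D) :=
  [set c | disk_monoid c /\ disk_monoid (beta - c)].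

(* The canonical model.  [mk beta [:: a_1; ...; a_k]] is
   m_{k,beta}(a_1, ..., a_k); the operators do not depend on the fibre. *)
Record fukaya_algebra := FukayaAlgebra {
  fdisk :> disk_classes;
  mk : dclass fdisk -> seq (ext R n) -> ext R n;
  mk_linear : forall beta s1 s2 (a : R[i]) x y,
    mk beta (s1 ++ (a *: x + y) :: s2)
    = a *: mk beta (s1 ++ x :: s2) + mk beta (s1 ++ y :: s2);
  mk_supp : forall beta s, ~ disk_monoid beta -> mk beta s = 0;
  mk_degree : forall beta (Is : seq {set 'I_n}) J,
    mk beta (map (@ebase R n) Is) J != 0 ->
    (#|J|%:Z = \sum_(I <- Is) #|I|%:Z + 2 - (size Is)%:Z - maslov beta)%R;
  (* Koszul signs for the shifted degree: an operator of degree one moved past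
     [a] gives (-1)^(|a| - 1). *)
  mk_ainfty : forall beta (s : seq (ext R n)),
    \sum_(i < (size s).+1) \sum_(j < (size s - i).+1)
      \sum_(c \in splits beta)
        mk (beta - c)
           (map (fun a => - gsgn a) (take i s)
            ++ mk c (take j (drop i s)) :: drop (i + j) s) = 0;
  mk_unit : forall beta s1 s2,
    (beta != 0) || (size s1 + size s2 != 1)%N ->
    mk beta (s1 ++ ebase R finset.set0 :: s2) = 0;
  mk_cyclic : forall beta (s : seq {set 'I_n}) (I K : {set 'I_n}),
    pairing (mk beta (map (@ebase R n) (rcons s K))) (ebase R I)
    = (-1) ^+ (#|I|.+1 * \sum_(J <- rcons s K) #|J|.+1)
      * pairing (mk beta (map (@ebase R n) (I :: s))) (ebase R K);
  (* The beta = 0 part is the exterior algebra: m_k = (-1)^(eps_k) m_k^eps with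
     eps_2 = |a_1|, and m_2^eps is the wedge product. *)
  mk_classical2 : forall x y, mk 0 [:: x; y] = wedge (gsgn x) y;
  mk_classical : forall s, size s != 2 -> mk 0 s = 0;
  mk_divisor : forall beta (b : 'rV[R[i]]_n) (l : nat) (s : seq (ext R n)),
    \sum_(ls : (size s).+1.-tuple 'I_l.+1 | \sum_(j <- ls) (j : nat) == l)
       mk beta (weave (H1 b) (map (@nat_of_ord l.+1) ls) s)
    = ((l`!)%:R^-1 * bpair b beta ^+ l) *: mk beta s;
  (* The series with insertions of degree one classes converge absolutely,
     uniformly on bounded sets. *)
  mk_convergent : forall beta (I J : {set 'I_n}) (r : R), exists B : R,
    forall s t : 'rV[R[i]]_n,
    (forall i, `|s 0 i| <= r%:C) -> (forall i, `|t 0 i| <= r%:C) ->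
    forall N : nat,
    \sum_(k < N) \sum_(l < N)
      `|mk beta (nseq l (H1 s) ++ ebase R I :: nseq k (H1 t)) J| <= B%:C
}.

End FukayaAlgebra.

(** * Smooth functions on U x R^n *)

Notation TB R n := ('rV[R]_n * 'rV[R]_n)%type.

Section Smooth.
Variables (R : realType) (n : nat).
Local Notation TB := (TB R n).

(* [inl i] is the direction of x_i, [inr i] that of y_i. *)
Definition dirv (a : 'I_n + 'I_n) : TB :=
  match a with inl i => (delta_mx 0 i, 0) | inr i => (0, delta_mx 0 i) end.

Definition rpartial (a : 'I_n + 'I_n) (g : TB -> R)
    : TB -> R :=
  fun p => 'D_(dirv a) g p.

(* All iterated partial derivatives exist and are continuous on W. *)
Definition rsmooth (W : set TB)
    (g : TB -> R) : Prop :=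
  forall (s : seq ('I_n + 'I_n)) p, W p ->
    {for p, continuous (foldr rpartial g s)} /\
    forall a, derivable (foldr rpartial g s) p (dirv a).

Definition csmooth (W : set TB) (f : TB -> R[i]) : Prop :=
  rsmooth W (fun p => complex.Re (f p)) /\ rsmooth W (fun p => complex.Im (f p)).

Definition cpartial (a : 'I_n + 'I_n) (f : TB -> R[i]) : TB -> R[i] :=
  fun p => rpartial a (fun q => complex.Re (f q)) p
           +i* rpartial a (fun q => complex.Im (f q)) p.

End Smooth.

(** * The sheaves of the theorem

   A section over [V] is a family of functions on [V x R^n], extended by zero
   to [R^n x R^n]; [zext V] is this extension. *)

Section MainObjects.
Variables (R : realType) (n : nat) (U : set 'rV[R]_n) (u0 : 'rV[R]_n).
Variable (F : fukaya_algebra U u0).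
Local Notation C := R[i].
Local Notation H := (dclass F).
Local Notation TB := (TB R n).

Definition zext (Z : zmodType) (V : set 'rV[R]_n) (f : TB -> Z) : TB -> Z :=
  fun p => if `[< V p.1 >] then f p else 0.

(* Finitely many non-zero terms below any energy bound. *)
Definition novikov_supp (P : set H) : Prop :=
  P `<=` disk_monoid (D := F) /\
  forall E : R, finite_set [set b | P b /\ energy u0 b <= E].

(* The coefficient of T^beta dx_J in dbar of sum f_(beta, K) T^beta dx_K. *)
Definition dbar (f : TB -> H -> {set 'I_n} -> C) : TB -> H -> {set 'I_n} -> C :=
  fun p beta J =>
    \sum_(i in J)
      wsgn R [set i]%SET (J :\ i) *
      (cpartial (inl i) (fun q => f q beta (J :\ i)) p
       + 'i * cpartial (inr i) (fun q => f q beta (J :\ i)) p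
       - (boundary beta 0 i)%:~R * f p beta (J :\ i)).

Definition Ohol_sec (V : set 'rV[R]_n) (d : int)
    (f : TB -> H -> {set 'I_n} -> C) : Prop :=
  [/\ zext V f = f,
      forall beta J, csmooth (V `*` setT) (fun p => f p beta J),
      forall p beta J, f p beta J != 0 -> #|J|%:Z + maslov beta = d &
      novikov_supp [set beta | exists p J, f p beta J != 0]].

Definition Ohol_mul (f g : TB -> H -> {set 'I_n} -> C)
    : TB -> H -> {set 'I_n} -> C :=
  fun p beta L =>
    \sum_(c \in splits beta) \sum_(J : {set 'I_n} | J \subset L)
      wsgn R J (L :\: J) * f p c J * g p (beta - c) (L :\: J).

Definition Ohol_one (V : set 'rV[R]_n) : TB -> H -> {set 'I_n} -> C :=
  zext V (fun _ beta J => ((beta == 0) && (J == finset.set0))%:R).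

Definition Ohol : raw_dgalg 'rV[R]_n :=
  @RawDGAlg _
    (@RawComplex _ (TB -> H -> {set 'I_n} -> C) Ohol_sec
       (fun W f => zext W f) (fun V f => zext V (dbar f)))
    Ohol_one Ohol_mul.

Definition tau (p : TB) : 'rV[C]_n := \row_i (- 'i * (p.2 0 i)%:C).

Definition theta (u : 'rV[R]_n) (alpha : 'rV[C]_n) (p : TB) : 'rV[C]_n :=
  \row_i ((p.1 0 i - u 0 i)%:C + alpha 0 i).

(* W(p, b) as a Lambda-valued function on TU: b corresponds to tau, and
   the coefficient of T^beta is that of the unit in sum_k m_{k,beta}(b,...,b). *)
Definition potential (p : TB) (beta : H) : C :=
  csum (fun k => mk beta (nseq k (H1 (tau p))) finset.set0).

(* m_0 is a multiple of the unit; m_0 is the same for all fibres. *)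
Definition weakly_unobstructed : Prop :=
  exists c : H -> C, forall beta, mk beta [::] = c beta *: ebase R finset.set0.

(* The coefficient of T^beta e_K in
   sum_{k,l} m_{k+l+1}(tau^l, e_I, theta^k) at the point p. *)
Definition Qcoef (th : TB -> 'rV[C]_n) (p : TB) (beta : H) (I K : {set 'I_n}) : C :=
  csum (fun N => \sum_(l < N.+1)
    mk beta (nseq l (H1 (tau p)) ++ ebase R I :: nseq (N - l) (H1 (th p))) K).

(* [f p beta L I] is the coefficient of T^beta dx_L (x) e_I.  Moving m, of odd
   shifted degree, past dx_L gives the sign; tau and theta are even for the
   shifted degree. *)
Definition Qop (th : TB -> 'rV[C]_n) (f : TB -> H -> {set 'I_n} -> {set 'I_n} -> C)
    : TB -> H -> {set 'I_n} -> {set 'I_n} -> C :=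
  fun p beta L K =>
    \sum_(c \in splits beta) \sum_(I : {set 'I_n})
      (-1) ^+ #|L| * f p (beta - c) L I * Qcoef th p c I K.

Definition Phi_sec (V : set 'rV[R]_n) (d : int)
    (f : TB -> H -> {set 'I_n} -> {set 'I_n} -> C) : Prop :=
  [/\ zext V f = f,
      forall beta J I, csmooth (V `*` setT) (fun p => f p beta J I),
      forall p beta J I, f p beta J I != 0 ->
        #|J|%:Z + #|I|%:Z + maslov beta = d &
      novikov_supp [set beta | exists p J I, f p beta J I != 0]].

Definition Phi_dif (th : TB -> 'rV[C]_n)
    (f : TB -> H -> {set 'I_n} -> {set 'I_n} -> C)
    : TB -> H -> {set 'I_n} -> {set 'I_n} -> C :=
  fun p beta J I => dbar (fun q b K => f q b K I) p beta J + Qop th f p beta J I.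

Definition Phi_act (g : TB -> H -> {set 'I_n} -> C)
    (f : TB -> H -> {set 'I_n} -> {set 'I_n} -> C)
    : TB -> H -> {set 'I_n} -> {set 'I_n} -> C :=
  fun p beta L I => Ohol_mul g (fun q b K => f q b K I) p beta L.

(* The image under Phi^tau of the rank one twisted complex with
   Maurer-Cartan element [th]. *)
Definition Phi_tau (th : TB -> 'rV[C]_n) : raw_dgmod Ohol :=
  @RawDGMod _ Ohol
    (@RawComplex _ (TB -> H -> {set 'I_n} -> {set 'I_n} -> C) Phi_sec
       (fun W f => zext W f) (fun V f => zext V (Phi_dif th f)))
    Phi_act.

Definition Phi_tau_L (u : 'rV[R]_n) (alpha : 'rV[C]_n) : raw_dgmod Ohol :=
  Phi_tau (theta u alpha).

(* The point (u, alpha) of TU: alpha_i = - sqrt(-1) y_i. *)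
Definition TBpoint (u : 'rV[R]_n) (alpha : 'rV[C]_n) : TB :=
  (u, \row_i - complex.Im (alpha 0 i)).

(* The stalk is placed in cohomological degree n. *)
Definition sky_sec (u : 'rV[R]_n) (V : set 'rV[R]_n) (d : int) (a : H -> C) : Prop :=
  [/\ ~ V u -> a = 0,
      forall beta, a beta != 0 -> maslov beta = d - n%:Z &
      novikov_supp [set beta | a beta != 0]].

Definition skyscraper (u : 'rV[R]_n) (alpha : 'rV[C]_n) : raw_dgmod Ohol :=
  @RawDGMod _ Ohol
    (@RawComplex _ (H -> C) (sky_sec u)
       (fun W a => if `[< W u >] then a else 0) (fun _ _ => 0))
    (fun (g : TB -> H -> {set 'I_n} -> C) (a : H -> C) (beta : H) =>
       \sum_(c \in splits beta)
         g (TBpoint u alpha) c finset.set0 * a (beta - c)).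

Definition purely_imaginary (alpha : 'rV[C]_n) : Prop :=
  forall i, complex.Re (alpha 0 i) = 0.

End MainObjects.

Arguments potential {R n U u0} F p beta.

(* Main.v *)
(** The morphism to the skyscraper sheaf evaluates at the point (u, alpha) the
    coefficient of e_1 /\ ... /\ e_n.  It is a chain map because theta = tau at
    this point, where the divisor equation turns Q into m_1 of the algebra
    deformed by tau, whose top coefficient vanishes by cyclicity and unitality.

    The part of the differential that preserves the exponent of T is, after
    multiplication by the exponential of a linear form, dbar + z /\ with
    z_i = theta_i - tau_i, and z_1, ..., z_n are holomorphic coordinates centred
    at (u, alpha).  Where some z_i does not vanish, contraction with e_i divided
    by z_i is a contracting homotopy.  On a ball around u the sum of the
    contraction of dx_i with conj(z_i) and of the contraction of e_i with d/dz_i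
    has the Euler vector field as anticommutator with dbar + z /\, so that
    integrating along the rays from (u, alpha), with a weight depending on the
    degree, contracts the complex onto the value at the point.  The remaining
    part of the differential increases the exponent of T; as the monoid of disk
    classes is locally finite, successive approximation ends after finitely many
    steps in each exponent. *)
Require Import Defs.
From mathcomp Require Import all_boot all_order all_algebra.
From mathcomp Require Import all_classical all_reals all_analysis.
From mathcomp.real_closed Require Import complex.
From mathcomp Require Import cyclic separable cyclotomic.
From mathcomp Require Import ring zify.
Import Order.TTheory GRing.Theory Num.Theory.
Import numFieldNormedType.Exports.
Set Implicit Arguments.
Unset Strict Implicit.
Unset Printing Implicit Defensive.
Local Open Scope classical_set_scope.
Local Open Scope ring_scope.
Local Open Scope complex_scope.

(** For the differential to square to zero, [tau] and [theta] must be genuine Maurer-Cartan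
    elements. The value of W at the zero class gives m_0 = 0, and the divisor equation then gives
    m_k(b, ..., b) = 0 for all degree one classes b. The same equation makes the coefficients of Q
    closed for dbar: d/dx_i + sqrt(-1) d/dy_i moves [tau] and [theta] simultaneously by e_i, which
    multiplies the T^beta term by the pairing of e_i with the boundary of beta, exactly what the
    connection subtracts.

    These coefficients are infinite series, which have to be differentiated and multiplied. Their
    term of total degree N is homogeneous, so a bound on a polydisc of radius 8r gives decay like
    8^-N at radius r; two factors 2^-N absorb the number of terms in the estimates and one is left
    for convergence.

    The weight of the component dx_L e_K is |L| + n - |K|, the eigenvalue of the algebraic part of
    the Laplacian. Only in weight 0, that is L empty and K full, does the ray integral leave a
    boundary value at the centre. *)

Lemma is_derive_line (R : numFieldType) (V W : normedModType R) (f : V -> W) (p v : V) s d :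
  is_derive (s *: v + p) v f d <-> is_derive s 1 (fun t : R => f (t *: v + p)) d.
Proof.
have E : (fun h : R => h^-1 *: ((fun t : R => f (t *: v + p)) (h *: (1 : R) + s)
                                 - f (s *: v + p)))
       = (fun h : R => h^-1 *: (f (h *: v + (s *: v + p)) - f (s *: v + p))).
  by apply/funext => h; rewrite scalerDl -addrA [h *: 1]mulr1.
split=> -[fd fE]; (apply: DeriveDef;
  [by move: fd; rewrite /derivable /= E | by move: fE; rewrite /derive /= E]).
Qed.

Lemma is_derive_comp1 (R : realType) (V : normedModType R) (f : V -> R) (g : R -> R)
    (p v : V) a b :
  is_derive (f p) 1 g a -> is_derive p v f b -> is_derive p v (g \o f) (a * b).
Proof.
move=> gd fd; have fd0 : is_derive (0 : R) 1 (fun t : R => f (t *: v + p)) b.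
  by apply/is_derive_line; rewrite scale0r add0r.
suff : is_derive (0 *: v + p) v (g \o f) (a * b) by rewrite scale0r add0r.
apply/is_derive_line; apply: (@is_derive1_comp R g) => //.
by rewrite scale0r add0r.
Qed.

(** * Real functions of finite differentiability class *)

Section RealCalculus.
Variables (R : realType) (n : nat).
Local Notation TB := (TB R n).

(** Recursion on the order of differentiability lets the Leibniz and chain rules be proved by
    induction on [k]; the lists of directions in [rsmooth] are less convenient, since the derivative
    of a product is a sum of products. *)
Fixpoint rsm (k : nat) (W : set TB) (g : TB -> R) : Prop :=
  if k is k'.+1 then
    (forall p, W p ->
       {for p, continuous g} /\ forall a, derivable g p (dirv R a))
    /\ forall a, rsm k' W (rpartial a g)
  else forall p, W p -> {for p, continuous g}.

Lemma rsmoothP (W : set TB) g : rsmooth W g <-> forall k, rsm k W g.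
Proof.
split=> [gs k|].
  elim: k g gs => [|k IHk] g gs /=; first by move=> p Wp; have [] := gs [::] p Wp.
  split=> [p Wp|a]; first exact: (gs [::] p Wp).
  by apply: IHk => s p Wp; have := gs (rcons s a) p Wp; rewrite foldr_rcons.
(* [foldr] applies the last direction of the list first, so the list is peeled from its right end to
   differentiate [g] itself. *)
move=> gs s; elim/last_ind: s g gs => [|s a IHs] g gs p Wp.
  exact: ((gs 1%N).1 p Wp).
by rewrite foldr_rcons; apply: IHs Wp => k; exact: (gs k.+1).2.
Qed.

Lemma rsmW k (W : set TB) g : rsm k.+1 W g -> rsm k W g.
Proof.
elim: k g => [|k IHk] g [g0 g1] /=; first by move=> p /g0 [].
by split=> // a; apply: IHk; exact: g1.
Qed.

Lemma rpartial_near a (f g : TB -> R) p :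
  (\forall q \near p, f q = g q) -> rpartial a f p = rpartial a g p.
Proof. by move=> fg; apply: near_eq_derive. Qed.

Lemma open_eq_near (T : Type) (W : set TB) (f g : TB -> T) p : open W -> {in W, f =1 g} -> W p ->
  \forall q \near p, f q = g q.
Proof.
move=> oW fg Wp; near=> q; apply: fg; rewrite inE; near: q.
exact: open_nbhs_nbhs.
Unshelve. all: by end_near. Qed.

Lemma eq_rsm k (W : set TB) f g : open W -> {in W, f =1 g} -> rsm k W f -> rsm k W g.
Proof.
move=> oW; elim: k f g => [|k IHk] f g fg /=.
  move=> fc p Wp; have fg' := open_eq_near oW fg Wp.
  rewrite /prop_for /continuous_at -fg ?inE//.
  by apply: cvg_trans (fc p Wp); apply: near_eq_cvg.
move=> [f0 f1]; split=> [p Wp|a].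
  have fg' := open_eq_near oW fg Wp; have [fc fd] := f0 p Wp; split.
    rewrite /prop_for /continuous_at -fg ?inE//.
    by apply: cvg_trans fc; apply: near_eq_cvg.
  by move=> a; apply: near_eq_derivable (fd a).
apply: IHk (f1 a) => p; rewrite inE => Wp.
by apply: rpartial_near; exact: open_eq_near fg Wp.
Qed.

Lemma rsm_cst k (W : set TB) c : rsm k W (cst c).
Proof.
elim: k c => [|k IHk] c /=; first by move=> p _; exact: cst_continuous.
split=> [p _|a].
  by split=> [|a]; [exact: cst_continuous|exact: derivable_cst].
rewrite (_ : rpartial _ _ = cst 0); first exact: IHk.
by apply/funext => p; exact: derive_cst.
Qed.

Lemma rsmD k (W : set TB) f g : open W -> rsm k W f -> rsm k W g -> rsm k W (f \+ g).
Proof.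
move=> oW; elim: k f g => [|k IHk] f g /=.
  by move=> fc gc p Wp; apply: continuousD; [exact: fc|exact: gc].
move=> [f0 f1] [g0 g1]; split=> [p Wp|a].
  have [fc fd] := f0 p Wp; have [gc gd] := g0 p Wp.
  by split=> [|a]; [exact: continuousD|exact: derivableD].
apply: eq_rsm (IHk _ _ (f1 a) (g1 a)) => // p; rewrite inE => Wp.
by rewrite /rpartial deriveD//; [exact: (f0 p Wp).2|exact: (g0 p Wp).2].
Qed.

Lemma rsmM k (W : set TB) f g : open W -> rsm k W f -> rsm k W g ->
  rsm k W (fun p => f p * g p).
Proof.
move=> oW; elim: k f g => [|k IHk] f g /=.
  by move=> fc gc p Wp; apply: continuousM; [exact: fc|exact: gc].
move=> fk gk; have [f0 f1] := fk; have [g0 g1] := gk; split=> [p Wp|a].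
  have [fc fd] := f0 p Wp; have [gc gd] := g0 p Wp.
  by split=> [|a]; [exact: continuousM|exact: derivableM].
have := rsmD oW (IHk _ _ (rsmW fk) (g1 a)) (IHk _ _ (rsmW gk) (f1 a)).
apply: eq_rsm => // p; rewrite inE => Wp.
by rewrite /rpartial deriveM//; [exact: (f0 p Wp).2|exact: (g0 p Wp).2].
Qed.

Lemma rsmN k (W : set TB) f : open W -> rsm k W f -> rsm k W (fun p => - f p).
Proof.
move=> oW fk; apply: eq_rsm (rsmM oW (@rsm_cst k W (-1)) fk) => // p _.
by rewrite /= mulN1r.
Qed.

Lemma rsmV k (W : set TB) f : open W -> (forall p, W p -> f p != 0) ->
  rsm k W f -> rsm k W (fun p => (f p)^-1).
Proof.
move=> oW fn0; elim: k => [|k IHk] /=.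
  by move=> fc p Wp; apply: continuousV; [exact: fn0|exact: fc].
move=> fk; have [f0 f1] := fk; split=> [p Wp|a].
  have [fc fd] := f0 p Wp.
  by split=> [|a]; [apply: continuousV => //; exact: fn0|
                    apply: derivableV => //; exact: fn0].
have Vk := IHk (rsmW fk).
have := rsmM oW (rsmN oW (rsmM oW Vk Vk)) (f1 a).
apply: eq_rsm => // p; rewrite inE => Wp.
rewrite /rpartial deriveV ?fn0//; last exact: (f0 p Wp).2.
by rewrite -exprVn expr2.
Qed.

Lemma rsm_expR k (W : set TB) f : open W -> rsm k W f -> rsm k W (expR \o f).
Proof.
move=> oW; elim: k => [|k IHk] /=.
  by move=> fc p Wp; apply: continuous_comp; [exact: fc|exact: continuous_expR].
move=> fk; have [f0 f1] := fk.
have eD p a : W p -> is_derive p (dirv R a) (expR \o f) (expR (f p) * rpartial a f p).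
  move=> Wp; have fd := derivableP ((f0 p Wp).2 a).
  by apply: is_derive_comp1; exact: is_derive_expR.
split=> [p Wp|a].
  have [fc fd] := f0 p Wp; split=> [|a].
    by apply: continuous_comp => //; exact: continuous_expR.
  by have [] := eD p a Wp.
apply: eq_rsm (rsmM oW (IHk (rsmW fk)) (f1 a)) => // p; rewrite inE => Wp.
by have [_ <-] := eD p a Wp.
Qed.

End RealCalculus.

(** * Mean value theorem along lines and symmetry of second derivatives *)

Section MeanValue.
Variables (R : realType) (V : normedModType R).
Implicit Types (f D : V -> R) (p v w e x : V).

(** The parameter [h] may have either sign, so the intermediate point is located only by
    [|c| <= |h|]; the two signs are the two orientations of the segment in [MVT_segment]. *)
Lemma MVT_line f D x e (h : R) :
  (forall t : R, `|t| <= `|h| -> is_derive (t *: e + x) e f (D (t *: e + x))) ->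
  exists2 c, `|c| <= `|h| & f (h *: e + x) - f x = h * D (c *: e + x).
Proof.
move=> fD.
have phi (t : R) : `|t| <= `|h| -> is_derive t 1 (fun t : R => f (t *: e + x)) (D (t *: e + x)).
  by move=> th; apply/is_derive_line/fD.
have cont a b : (forall t : R, t \in `[a, b] -> `|t| <= `|h|) ->
    {within `[a, b], continuous (fun t : R => f (t *: e + x))}.
  move=> ab; apply: derivable_within_continuous => t tab.
  by have [] := phi t (ab t tab).
have [h0|h0] := leP 0 h.
  have lh (t : R) : t \in `[0, h] -> `|t| <= `|h|.
    by rewrite in_itv/= => /andP[t0 th]; rewrite !ger0_norm.
  have dh (t : R) : t \in `]0, h[ -> is_derive t 1 (fun t : R => f (t *: e + x)) (D (t *: e + x)).
    by move=> /subset_itv_oo_cc /lh /phi.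
  have [c ch E] := MVT_segment h0 dh (cont _ _ lh).
  exists c; first exact: lh.
  by move: E; rewrite scale0r add0r subr0 mulrC.
have lh (t : R) : t \in `[h, 0] -> `|t| <= `|h|.
  rewrite in_itv/= => /andP[ht t0]; rewrite (ltr0_norm h0) ler0_norm//.
  by rewrite lerN2.
have dh (t : R) : t \in `]h, 0[ -> is_derive t 1 (fun t : R => f (t *: e + x)) (D (t *: e + x)).
  by move=> /subset_itv_oo_cc /lh /phi.
have [c ch E] := MVT_segment (ltW h0) dh (cont _ _ lh).
exists c; first exact: lh.
move: E; rewrite scale0r add0r sub0r => E.
by rewrite -opprB E mulrN opprK mulrC.
Qed.

(** The increment along [h *: (v + e)] is split into a step along [v] and one along [e]. The first
    quotient converges by differentiability at [p]; the second is a value of [D] at a nearby point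
    by the mean value theorem, and tends to [D p] by continuity. *)
Lemma is_derive_addv f D p v e d :
  is_derive p v f d -> (\forall q \near p, is_derive q e f (D q)) ->
  {for p, continuous D} -> is_derive p (v + e) f (d + D p).
Proof.
move=> [fd <-{d}] De Dc.
have lim2 : h^-1 *: (f (h *: e + (h *: v + p)) - f (h *: v + p)) @[h --> 0^'] --> D p.
  apply/cvgrPdist_lt => eps eps0.
  have /nbhs_normP[r /= r0 rP] : \forall q \near p,
      is_derive q e f (D q) /\ `|D p - D q| < eps.
    by near=> q; split; near: q => //; move/cvgrPdist_lt: Dc; exact.
  near=> h; have h0 : h != 0 by near: h; exact: nbhs_dnbhs_neq.
  have hr : `|h| * (`|e| + `|v|) < r.
    have ev : 0 < `|e| + `|v| + 1 by rewrite ltr_wpDl// addr_ge0.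
    apply: (@le_lt_trans _ _ (`|h| * (`|e| + `|v| + 1))).
      by rewrite ler_wpM2l// lerDl.
    rewrite -ltr_pdivlMr//; near: h.
    by apply: dnbhs0_lt; rewrite divr_gt0// ltr_wpDl// addr_ge0.
  have inb (t : R) : `|t| <= `|h| -> `|p - (t *: e + (h *: v + p))| < r.
    move=> th; rewrite addrA opprD addrCA subrr addr0 normrN.
    apply: le_lt_trans hr; rewrite mulrDr.
    apply: le_trans (ler_normD _ _) _; rewrite !normrZ.
    by rewrite lerD// ler_wpM2r.
  have [|c ch ->] := @MVT_line f D (h *: v + p) e h.
    by move=> t /inb /rP[].
  by rewrite /GRing.scale/= mulrA mulVf// mul1r; have [] := rP _ (inb c ch).
have E : (fun h : R => h^-1 *: (f (h *: (v + e) + p) - f p)) =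
    (fun h => h^-1 *: (f (h *: v + p) - f p)
       + h^-1 *: (f (h *: e + (h *: v + p)) - f (h *: v + p))).
  apply/funext => h; rewrite -scalerDr [X in _ = _ *: X]addrC addrA subrK.
  by rewrite addrA -scalerDr [e + v]addrC.
have lim : h^-1 *: (f (h *: (v + e) + p) - f p) @[h --> 0^'] --> 'D_v f p + D p.
  by rewrite E; apply: cvgD.
apply: DeriveDef; first by apply/cvg_ex; eexists; exact: lim.
exact/cvg_lim.
Unshelve. all: by end_near. Qed.

Lemma is_derive_translate f p v a d :
  is_derive (a + p) v f d -> is_derive p v (fun x => f (a + x)) d.
Proof.
have E : (fun h : R => h^-1 *: ((fun x => f (a + x)) (h *: v + p) - f (a + p)))
       = (fun h : R => h^-1 *: (f (h *: v + (a + p)) - f (a + p))).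
  by apply/funext => h; rewrite addrCA.
move=> [fd fE]; apply: DeriveDef;
  [by move: fd; rewrite /derivable /= -E | by move: fE; rewrite /derive /= -E].
Qed.

(** The second difference of [f] over a small parallelogram with sides along [v] and [w] is computed
    by two mean values in either order. This gives equal values of [Dwv] and [Dvw] at two points
    near [p], contradicting a positive gap [eps] between their values at [p]. *)
Lemma schwarz f Dv Dw Dwv Dvw p v w :
  (\forall q \near p, [/\ is_derive q v f (Dv q), is_derive q w f (Dw q),
     is_derive q w Dv (Dwv q) & is_derive q v Dw (Dvw q)]) ->
  {for p, continuous Dwv} -> {for p, continuous Dvw} -> Dwv p = Dvw p.
Proof.
move=> H c1 c2; apply/eqP; rewrite -subr_eq0 -normr_eq0 -[_ == 0]negbK.
apply/negP; rewrite -normr_gt0 normr_id => /= n0.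
set eps := `|_| in n0.
have e2 : 0 < eps / 2 by rewrite divr_gt0.
have /nbhs_normP[r /= r0 rP] : \forall q \near p,
    [/\ is_derive q v f (Dv q), is_derive q w f (Dw q),
     is_derive q w Dv (Dwv q) & is_derive q v Dw (Dvw q)]
    /\ (`|Dwv p - Dwv q| < eps / 2 /\ `|Dvw p - Dvw q| < eps / 2).
  near=> q; split; first by near: q.
  split; near: q; first by move/cvgrPdist_lt: c1; exact.
  by move/cvgrPdist_lt: c2; exact.
(* Half of the radius divided by the lengths of the sides keeps the parallelogram inside the ball of
   radius [r]; the added 1 keeps the denominator positive. *)
pose h := r / (2 * (`|v| + `|w| + 1)).
have vw0 : 0 < `|v| + `|w| + 1 by rewrite ltr_wpDl// addr_ge0.
have h0 : 0 < h by rewrite divr_gt0// mulr_gt0.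
have inb (s t : R) : `|s| <= `|h| -> `|t| <= `|h| -> `|p - (s *: v + (t *: w + p))| < r.
  move=> sh th; rewrite addrA opprD addrCA subrr addr0 normrN.
  apply: le_lt_trans (ler_normD _ _) _; rewrite !normrZ.
  apply: (@le_lt_trans _ _ (h * (`|v| + `|w| + 1))).
    rewrite (gtr0_norm h0) in sh th; rewrite mulrDr mulr1 mulrDr.
    apply: ler_wpDr; first exact: ltW.
    by rewrite lerD// ler_wpM2r.
  rewrite /h invfM mulrA -mulrA mulVf ?gt_eqF// mulr1.
  by rewrite ltr_pdivrMr// mulrDr mulr1 ltrDl.
have hh : `|h| <= `|h| by [].
have z0 : `|0 : R| <= `|h| by rewrite normr0.
have inb1 (s : R) : `|s| <= `|h| -> `|p - (s *: v + p)| < r.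
  by move=> sh; have := inb s 0 sh z0; rewrite scale0r add0r.
have inb2 (s : R) : `|s| <= `|h| -> `|p - (s *: w + p)| < r.
  by move=> sh; have := inb 0 s z0 sh; rewrite scale0r add0r.
have [|c ch E1] := @MVT_line (fun x => f (h *: w + x) - f x)
    (fun x => Dv (h *: w + x) - Dv x) p v h.
  move=> t th; apply: is_deriveB.
    apply: is_derive_translate; rewrite addrCA.
    by have [[]] := rP _ (inb t h th hh).
  by have [[]] := rP _ (inb1 t th).
have [|c' ch' E2] := @MVT_line Dv Dwv (c *: v + p) w h.
  by move=> t th; rewrite addrCA; have [[]] := rP _ (inb c t ch th).
have [|b bh E3] := @MVT_line (fun x => f (h *: v + x) - f x)
    (fun x => Dw (h *: v + x) - Dw x) p w h.
  move=> t th; apply: is_deriveB.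
    apply: is_derive_translate.
    by have [[]] := rP _ (inb h t hh th).
  by have [[]] := rP _ (inb2 t th).
have [|b' bh' E4] := @MVT_line Dw Dvw (b *: w + p) v h.
  by move=> t th; have [[]] := rP _ (inb t b th bh).
have EQ : Dwv (c' *: w + (c *: v + p)) = Dvw (b' *: v + (b *: w + p)).
  have hn0 : h != 0 by rewrite gt_eqF.
  apply: (mulfI hn0); apply: (mulfI hn0).
  rewrite -E2 -E4 -E1 -E3 [h *: v + (h *: w + p)]addrCA.
  by rewrite !opprB !addrA; ring.
have [_ [d1 _]] := rP _ (inb c c' ch ch'); have [_ [_ d2]] := rP _ (inb b' b bh' bh).
move: d1; rewrite addrCA EQ => d1.
suff : eps < eps by rewrite ltxx.
rewrite {2}(splitr eps); apply: le_lt_trans (ltrD d1 d2).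
rewrite /eps [X in _ <= _ + X]distrC; apply: le_trans (ler_normD _ _).
by rewrite addrA subrK.
Unshelve. all: by end_near. Qed.

End MeanValue.

(** * Derivatives in arbitrary directions *)

Section ChainRule.
Variables (R : realType) (n : nat).
Local Notation TB := (TB R n).

Lemma rpartialC (W : set TB) g a b p : open W -> rsm 2 W g -> W p ->
  rpartial a (rpartial b g) p = rpartial b (rpartial a g) p.
Proof.
move=> oW gs Wp; have [g0 g1] := gs.
apply: (@schwarz R _ g (rpartial b g) (rpartial a g) (rpartial a (rpartial b g))
  (rpartial b (rpartial a g)) p (dirv R b) (dirv R a)).
- near=> q; have Wq : W q by near: q; exact: open_nbhs_nbhs.
  split; apply: derivableP; [exact: (g0 q Wq).2|exact: (g0 q Wq).2|..].
    exact: (((g1 b).1 q Wq).2 a).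
  exact: (((g1 a).1 q Wq).2 b).
- exact: ((g1 b).2 a p Wp).
- exact: ((g1 a).2 b p Wp).
Unshelve. all: by end_near. Qed.

Lemma TB_dirv (v : TB) :
  v = \sum_i v.1 0 i *: dirv R (inl i) + \sum_i v.2 0 i *: dirv R (inr i).
Proof.
have sfst (G : 'I_n -> TB) : (\sum_i G i).1 = \sum_i (G i).1.
  by elim/big_ind2: _ => //= ? ? ? ? <- <-.
have ssnd (G : 'I_n -> TB) : (\sum_i G i).2 = \sum_i (G i).2.
  by elim/big_ind2: _ => //= ? ? ? ? <- <-.
have pairE (a b : TB) : a.1 = b.1 -> a.2 = b.2 -> a = b.
  by case: a b => [? ?] [? ?] /= -> ->.
case: v => v w; apply: pairE.
  rewrite /= sfst sfst [X in _ + X]big1 ?addr0.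
    by rewrite [LHS]row_sum_delta.
  by move=> i _ /=; rewrite scaler0.
rewrite /= ssnd ssnd [X in X + _]big1 ?add0r.
  by rewrite [LHS]row_sum_delta.
by move=> i _ /=; rewrite scaler0.
Qed.

Definition ddir (g : TB -> R) (v p : TB) : R :=
  \sum_i v.1 0 i * rpartial (inl i) g p + \sum_i v.2 0 i * rpartial (inr i) g p.

Lemma is_deriveZv (V : normedModType R) (f : V -> R) p v d k : is_derive p v f d ->
  is_derive p (k *: v) f (k * d).
Proof.
move=> fd; suff : is_derive (0 *: (k *: v) + p) (k *: v) f (k * d) by rewrite scale0r add0r.
apply/is_derive_line.
have -> : (fun t : R => f (t *: (k *: v) + p)) = (fun t => f (t *: v + p)) \o ( *%R k).
  by apply/funext => t /=; rewrite scalerA [k * t]mulrC.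
rewrite mulrC; apply: is_derive1_comp.
  by rewrite mulr0; apply/is_derive_line; rewrite scale0r add0r.
have -> : *%R k = k *: (id : R -> R) by [].
by rewrite -[k in is_derive _ _ _ k]mulr1; apply: is_deriveZ.
Qed.

(** Only partial derivatives are given. [is_derive_addv] adds one coordinate direction at a time,
    and each addition consumes the continuity of a partial derivative, which [rsm 1] contains. *)
Lemma is_derive_ddir (W : set TB) g v p : open W -> rsm 1 W g -> W p ->
  is_derive p v g (ddir g v p).
Proof.
move=> oW gs Wp; have [g0 g1] := gs.
have step a (k : R) w d : is_derive p w g d ->
    is_derive p (w + k *: dirv R a) g (d + k * rpartial a g p).
  move=> gd; apply: (@is_derive_addv R _ g (fun q => k * rpartial a g q)) => //.
    near=> q; have Wq : W q by near: q; exact: open_nbhs_nbhs.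
    by apply: is_deriveZv; apply: derivableP; exact: (g0 q Wq).2.
  by apply: continuousM; [exact: cst_continuous|exact: (g1 a p Wp)].
have steps (s : seq 'I_n) (h : 'I_n -> 'I_n + 'I_n) (c : 'I_n -> R) w d : is_derive p w g d ->
    is_derive p (w + \sum_(i <- s) c i *: dirv R (h i)) g
                (d + \sum_(i <- s) c i * rpartial (h i) g p).
  move=> gd; elim/last_ind: s => [|s i IHs]; first by rewrite !big_nil !addr0.
  by rewrite -cats1 !big_cat !big_seq1 !addrA; apply: step.
have := steps (index_enum _) inr (fun i => v.2 0 i) _ _
  (steps (index_enum _) inl (fun i => v.1 0 i) 0 0 (is_derive0 g p)).
by rewrite !add0r -TB_dirv.
Unshelve. all: by end_near. Qed.

End ChainRule.

(** * Integration over the unit interval *)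

Section Integral01.
Variable R : realType.
Implicit Types f g : R -> R.

Definition int01 f : R := (\int[@lebesgue_measure R]_(t in `[0%R, 1%R]) f t)%R.

(** Continuity on the whole line at each point of the interval, endpoints included, so that sums,
    products and compositions need no subspace topology. *)
Definition cont01 f := {in `[0%R, 1%R]%classic, continuous f}.

Let mI : measurable (`[0%R, 1%R]%classic : set R) := measurable_itv _.

Lemma cont01_integrable f : cont01 f ->
  (@lebesgue_measure R).-integrable `[0%R, 1%R] (EFin \o f).
Proof.
move=> fc; apply: continuous_compact_integrable; first exact: segment_compact.
exact: continuous_in_subspaceT.
Qed.

Lemma cont01_cst c : cont01 (fun=> c).
Proof. by move=> t _; exact: cst_continuous. Qed.

Lemma cont01D f g : cont01 f -> cont01 g -> cont01 (fun t => f t + g t).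
Proof. by move=> fc gc t t01; apply: continuousD; [exact: fc|exact: gc]. Qed.

Lemma cont01M f g : cont01 f -> cont01 g -> cont01 (fun t => f t * g t).
Proof. by move=> fc gc t t01; apply: continuousM; [exact: fc|exact: gc]. Qed.

Lemma cont01Z k f : cont01 f -> cont01 (fun t => k * f t).
Proof. exact/cont01M/cont01_cst. Qed.

Lemma cont01X k : cont01 (fun t => t ^+ k).
Proof. by move=> t _; exact: exprn_continuous. Qed.

Lemma cont01_sum (I : Type) (s : seq I) (F : I -> R -> R) :
  (forall i, cont01 (F i)) -> cont01 (fun t => \sum_(i <- s) F i t).
Proof.
move=> Fc; elim: s => [|i s IHs].
  by under eq_fun do rewrite big_nil; exact: cont01_cst.
by under eq_fun do rewrite big_cons; exact: cont01D.
Qed.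

Lemma eq_int01 f g : (forall t : R, 0 <= t <= 1 -> f t = g t) -> int01 f = int01 g.
Proof.
by move=> fg; apply: eq_Rintegral => t; rewrite inE/= in_itv/=; exact: fg.
Qed.

Lemma int01D f g : cont01 f -> cont01 g -> int01 (fun t => f t + g t) = int01 f + int01 g.
Proof. by move=> fc gc; apply: RintegralD => //; exact: cont01_integrable. Qed.

Lemma int01Z k f : cont01 f -> int01 (fun t => k * f t) = k * int01 f.
Proof. by move=> fc; apply: RintegralZl => //; exact: cont01_integrable. Qed.

Lemma int01_cst k : int01 (fun=> k) = k.
Proof.
by rewrite /int01 Rintegral_cst//= lebesgue_measure_itv/= lte01 oppr0 adde0 mulr1.
Qed.

Lemma int01_sum (I : Type) (s : seq I) (F : I -> R -> R) : (forall i, cont01 (F i)) ->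
  int01 (fun t => \sum_(i <- s) F i t) = \sum_(i <- s) int01 (F i).
Proof.
move=> Fc; elim: s => [|i s IHs].
  by rewrite big_nil; under [X in int01 X]eq_fun do rewrite big_nil; rewrite int01_cst.
rewrite big_cons -IHs -int01D//; last exact: cont01_sum.
by congr int01; apply/funext => t; rewrite big_cons.
Qed.

Lemma int01_le f (e : R) : cont01 f -> (forall t : R, 0 <= t <= 1 -> `|f t| <= e) -> `|int01 f| <= e.
Proof.
move=> fc fe; have fi := cont01_integrable fc.
have h := @le_normr_Rintegral _ _ _ (@lebesgue_measure R) _ f (measurable_itv _) fi.
rewrite /int01; refine (le_trans h _).
have cn : cont01 (fun t => `|f t|).
  by move=> t t01; apply: continuous_comp; [exact: fc|exact: norm_continuous].
have ci := cont01_integrable cn; have ce := cont01_integrable (@cont01_cst e).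
rewrite -[e]int01_cst /int01.
by apply: le_Rintegral => // t; rewrite /= in_itv/=; exact: fe.
Qed.

Lemma int01_FTC f (F : R -> R) : cont01 f -> (forall t : R, 0 <= t <= 1 -> is_derive t 1 F (f t)) ->
  int01 f = F 1 - F 0.
Proof.
move=> fc Ff.
have Fd (t : R) : 0 <= t <= 1 -> derivable F t 1 by move=> /Ff[].
have Fc (t : R) : 0 <= t <= 1 -> {for t, continuous F}.
  by move=> /Fd /derivable1_diffP /differentiable_continuous.
rewrite /int01 /Rintegral (@continuous_FTC2 _ f F)//.
- by apply: continuous_in_subspaceT.
- split=> [t /subset_itv_oo_cc|//|].
  + by rewrite in_itv/=; exact: Fd.
  + by apply: cvg_at_right_filter; apply: Fc; rewrite lexx ler01.
  + by apply: cvg_at_left_filter; apply: Fc; rewrite lexx ler01.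
- move=> t /subset_itv_oo_cc; rewrite in_itv/= derive1E => /Ff[_]; exact.
Qed.

End Integral01.

(** * Radial integrals on star-shaped sets *)

Section Radial.
Variables (R : realType) (n : nat).
Local Notation TB := (TB R n).
Variables (c : TB) (W : set TB).
Hypothesis oW : open W.
Hypothesis starW : forall q (t : R), W q -> 0 <= t <= 1 -> W (c + t *: (q - c)).
Implicit Types (g : TB -> R) (q : TB).

Definition rad k g (q : TB) : R := int01 (fun t => t ^+ k * g (c + t *: (q - c))).

Let ray (q : TB) (t : R) : TB := c + t *: (q - c).

Lemma ray_continuous : continuous (fun z : TB * R => ray z.1 z.2).
Proof.
move=> z; apply: cvgD; first exact: cvg_cst.
apply: cvgZ; first exact: cvg_snd.
by apply: cvgB; [exact: cvg_fst|exact: cvg_cst].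
Qed.

Let ray_cont1 q : continuous (ray q).
Proof.
move=> t; apply: cvgD; first exact: cvg_cst.
by apply: cvgZr_tmp; exact: cvg_id.
Qed.

Lemma is_derive_ray g p v t d :
  is_derive (ray p t) v g d -> is_derive p v (fun x => g (ray x t)) (t * d).
Proof.
move=> gd; have [] := is_deriveZv t gd.
have E : (fun h : R => h^-1 *: (g (ray (h *: v + p) t) - g (ray p t)))
       = (fun h : R => h^-1 *: (g (h *: (t *: v) + ray p t) - g (ray p t))).
  apply/funext => h; rewrite /ray [in RHS]addrCA.
  have -> : h *: v + p - c = h *: v + (p - c) by rewrite addrA.
  by rewrite [t *: (_ + _)]scalerDr !scalerA [t * h]mulrC.
by rewrite /derivable /derive -E => fd fE; apply: DeriveDef.
Qed.

Lemma cont01_ray g q : rsm 0 W g -> W q -> cont01 (fun t => g (ray q t)).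
Proof.
move=> gc Wq t; rewrite inE/= in_itv/= => t01.
by apply: continuous_comp; [exact: ray_cont1|apply: gc; exact: starW].
Qed.

Lemma cont01_rad k g q : rsm 0 W g -> W q -> cont01 (fun t => t ^+ k * g (ray q t)).
Proof. by move=> gc Wq; apply: cont01M; [exact: cont01X|exact: cont01_ray]. Qed.

(** A tube argument: joint continuity near [(q, t)] for each [t], together with compactness of the
    unit interval, gives one neighbourhood of [q] that serves all [t]. *)
Lemma ray_uniform g q (e : R) : rsm 0 W g -> W q -> 0 < e ->
  \forall q' \near q, forall t : R, 0 <= t <= 1 -> `|g (ray q t) - g (ray q' t)| < e.
Proof.
move=> gc Wq e0.
have := (@segment_compact R 0 1); rewrite compact_near_coveringP => /(_ TB (nbhs q)
   (fun q' t => `|g (ray q t) - g (ray q' t)| < e)) H.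
have {}H : \forall q' \near q, `[0, 1] `<=` (fun t => `|g (ray q t) - g (ray q' t)| < e).
  apply: H => t; rewrite /= in_itv/= => t01.
  have Wr : W (ray q t) by exact: starW.
  have e2 : 0 < e / 2 by rewrite divr_gt0.
  have c2 : \forall z \near (q, t), `|g (ray q t) - g (ray z.1 z.2)| < e / 2.
    have : {for (q, t), continuous (fun z : TB * R => g (ray z.1 z.2))}.
      by apply: continuous_comp; [exact: ray_continuous|exact: gc].
    by move/cvgrPdist_lt; exact.
  have c1 : \forall z \near (q, t), `|g (ray q t) - g (ray q z.2)| < e / 2.
    have : {for (q, t), continuous (fun z : TB * R => g (ray q z.2))}.
      apply: (@continuous_comp _ _ _ (fun z : TB * R => z.2) (fun t => g (ray q t))).
        exact: cvg_snd.
      by apply: (cont01_ray gc Wq); rewrite inE/= in_itv.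
    by move/cvgrPdist_lt; exact.
  have [[A B] /= [nA nB] AB] : \forall z \near (q, t),
      `|g (ray q z.2) - g (ray z.1 z.2)| < e.
    near=> z; rewrite (splitr e).
    have h1 : `|g (ray q t) - g (ray z.1 z.2)| < e / 2 by near: z.
    have h2 : `|g (ray q t) - g (ray q z.2)| < e / 2 by near: z.
    rewrite distrC in h2; apply: le_lt_trans (ltrD h2 h1).
    by apply: le_trans (ler_normD _ _); rewrite addrA subrK.
  by exists (B, A) => //= -[t' q'] [/= Bt Aq]; exact: (AB (q', t')).
by near=> q' => t t01; apply: (near H q') => //; rewrite /= in_itv.
Unshelve. all: by end_near. Qed.

Lemma rad_continuous k g q : rsm 0 W g -> W q -> {for q, continuous (rad k g)}.
Proof.
move=> gc Wq; apply/cvgrPdist_le => e e0.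
have nW : nbhs q W by exact: open_nbhs_nbhs.
near=> q'; have Wq' : W q' by near: q'; exact: nW.
have U : forall t : R, 0 <= t <= 1 -> `|g (ray q t) - g (ray q' t)| < e.
  by near: q'; exact: ray_uniform.
have -> : rad k g q - rad k g q' = int01 (fun t => t ^+ k * (g (ray q t) + (- 1) * g (ray q' t))).
  rewrite -[X in _ + X = _]mulN1r /rad -int01Z -?int01D; last first.
  - exact: cont01_rad.
  - by apply: cont01Z; exact: cont01_rad.
  - exact: cont01_rad.
  by congr int01; apply/funext => t; rewrite -/(ray _ _); ring.
apply: int01_le => [|t t01].
  apply: cont01M; [exact: cont01X|apply: cont01D; [exact: cont01_ray|]].
  by apply: cont01Z; exact: cont01_ray.
rewrite normrM mulN1r; apply: (@le_trans _ _ (1 * `|g (ray q t) - g (ray q' t)|)).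
  by case/andP: t01 => t0 t1; rewrite ler_wpM2r// ger0_norm ?exprn_ge0// exprn_ile1.
by rewrite mul1r ltW// U.
Unshelve. all: by end_near. Qed.

(** Differentiation under the integral sign. The mean value theorem is applied for each [t]
    separately, and [ray_uniform] bounds the error uniformly in [t]. The inner derivative of the ray
    contributes a factor [t], hence the exponent [k.+1]. *)
Lemma rad_is_derive k g q a : rsm 1 W g -> W q ->
  is_derive q (dirv R a) (rad k g) (rad k.+1 (rpartial a g) q).
Proof.
move=> gs Wq; have [g0 g1] := gs.
have gc := rsmW gs; have dgc : rsm 0 W (rpartial a g) := g1 a.
have lim : h^-1 *: (rad k g (h *: dirv R a + q) - rad k g q) @[h --> 0^']
    --> rad k.+1 (rpartial a g) q.
  apply/cvgrPdist_le => e e0.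
  have /nbhs_normP[r /= r0 rP] : \forall q' \near q, W q' /\
      (forall t : R, 0 <= t <= 1 -> `|rpartial a g (ray q t) - rpartial a g (ray q' t)| < e).
    have nW : nbhs q W by exact: open_nbhs_nbhs.
    near=> q'; split; near: q'; first exact: nW.
    exact: ray_uniform.
  near=> h; have h0 : h != 0 by near: h; exact: nbhs_dnbhs_neq.
  have hr : `|h| * (`|dirv R a| + 1) < r.
    rewrite -ltr_pdivlMr; last by rewrite ltr_wpDl.
    near: h; apply: dnbhs0_lt; rewrite divr_gt0// ltr_wpDl//.
  have inb (s : R) : `|s| <= `|h| -> `|q - (s *: dirv R a + q)| < r.
    move=> sh; rewrite opprD addrCA subrr addr0 normrN normrZ.
    apply: le_lt_trans hr; apply: ler_pM => //.
    by rewrite lerDl.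
  have Wh : W (h *: dirv R a + q) by have [] := rP _ (inb h (lexx _)).
  pose q' := h *: dirv R a + q.
  have -> : rad k.+1 (rpartial a g) q - h^-1 *: (rad k g q' - rad k g q) =
      int01 (fun t => t ^+ k.+1 * rpartial a g (ray q t)
        + - h^-1 * (t ^+ k * g (ray q' t) + (- 1) * (t ^+ k * g (ray q t)))).
    rewrite int01D; first last.
    - apply: cont01Z; apply: cont01D; first exact: cont01_rad.
      by apply: cont01Z; exact: cont01_rad.
    - exact: cont01_rad.
    rewrite int01Z; last first.
      apply: cont01D; first exact: cont01_rad.
      by apply: cont01Z; exact: cont01_rad.
    rewrite int01D; first last.
    - by apply: cont01Z; exact: cont01_rad.
    - exact: cont01_rad.
    rewrite int01Z; last exact: cont01_rad.
    by rewrite mulN1r mulNr.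
  apply: int01_le => [|t t01].
    apply: cont01D; first exact: cont01_rad.
    apply: cont01Z; apply: cont01D; first exact: cont01_rad.
    by apply: cont01Z; exact: cont01_rad.
  (* The intermediate parameter [s] depends on [t]; only the bound [|s| <= |h|] is used. *)
  have [|s sh gE] := @MVT_line R _ (fun x => g (ray x t))
    (fun x => t * rpartial a g (ray x t)) q (dirv R a) h.
    move=> s sh; apply: is_derive_ray; apply: derivableP.
    have [Ws _] := rP _ (inb s sh); exact: (g0 _ (starW Ws t01)).2.
  have -> : t ^+ k.+1 * rpartial a g (ray q t)
      + - h^-1 * (t ^+ k * g (ray q' t) + -1 * (t ^+ k * g (ray q t)))
      = t ^+ k.+1 * (rpartial a g (ray q t) - rpartial a g (ray (s *: dirv R a + q) t)).
    rewrite mulN1r -mulrBr gE exprS; move: (rpartial a g _) (rpartial a g _) => A B.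
    by field.
  have [_ U] := rP _ (inb s sh); rewrite normrM.
  apply: (@le_trans _ _ (1 * `|rpartial a g (ray q t) - rpartial a g (ray (s *: dirv R a + q) t)|)).
    by case/andP: t01 => t0 t1; rewrite ler_wpM2r// ger0_norm ?exprn_ge0// exprn_ile1.
  by rewrite mul1r ltW// U.
apply: DeriveDef; first by apply/cvg_ex; eexists; exact: lim.
exact/cvg_lim.
Unshelve. all: by end_near. Qed.

Lemma rad_rsm k j g : (forall i, rsm i W g) -> rsm j W (rad k g).
Proof.
elim: j k g => [|j IHj] k g gs /=; first by move=> p; exact: rad_continuous.
split=> [p Wp|a].
  by split=> [|a]; [exact: rad_continuous|have [] := rad_is_derive k a (gs 1%N) Wp].
apply: eq_rsm (IHj k.+1 (rpartial a g) _) => [//|p|i]; last exact: ((gs i.+1).2 a).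
by rewrite inE => Wp; have [_ <-] := rad_is_derive k a (gs 1%N) Wp.
Qed.

(** The derivative of [t ^+ k * g (c + t *: (q - c))] is integrated over the unit interval. The
    lower boundary term [0 ^+ k * g c] survives only for [k = 0]; in that case the last term carries
    the factor zero, so the truncated predecessor is harmless. *)
Lemma rad_euler k g q : rsm 1 W g -> W q ->
  \sum_i (q - c).1 0 i * rad k (rpartial (inl i) g) q
  + \sum_i (q - c).2 0 i * rad k (rpartial (inr i) g) q
  = g q - 0 ^+ k * g c - k%:R * rad k.-1 g q.
Proof.
move=> gs Wq; have [g0 g1] := gs; have gc := rsmW gs.
have c1 a : cont01 (fun t => t ^+ k * rpartial a g (ray q t)).
  by apply: cont01_rad => //; exact: (g1 a).
have c2 a x : cont01 (fun t => x * (t ^+ k * rpartial a g (ray q t))).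
  exact: cont01Z.
have c3 : cont01 (fun t => k%:R * (t ^+ k.-1 * g (ray q t))).
  by apply: cont01Z; exact: cont01_rad.
have F : int01 (fun t => (\sum_i (q - c).1 0 i * (t ^+ k * rpartial (inl i) g (ray q t))
    + \sum_i (q - c).2 0 i * (t ^+ k * rpartial (inr i) g (ray q t)))
    + k%:R * (t ^+ k.-1 * g (ray q t))) = g q - 0 ^+ k * g c.
  have -> : g q - 0 ^+ k * g c = 1 ^+ k * g (ray q 1) - 0 ^+ k * g (ray q 0).
    by rewrite /ray scale1r scale0r addr0 addrCA subrr addr0 expr1n mul1r.
  apply: (@int01_FTC R _ (fun t => t ^+ k * g (ray q t))).
    by apply: cont01D => //; apply: cont01D; apply: cont01_sum => i; exact: c2.
  move=> t t01.
  have dg : is_derive t 1 (fun t : R => g (ray q t)) (ddir g (q - c) (ray q t)).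
    have := is_derive_ddir (q - c) oW gs (starW Wq t01).
    rewrite [X in is_derive X]addrC => /is_derive_line.
    congr is_derive.
    by apply/funext => s; rewrite /ray addrC.
  have dt : is_derive t 1 (fun t : R => t ^+ k) (k%:R * t ^+ k.-1).
    have -> : (fun t : R => t ^+ k) = (id : R -> R) ^+ k.
      by apply/funext => s; elim: (k) => [|m IH]; rewrite ?expr0// !exprS IH.
    by apply: is_derive_eq; rewrite /= /GRing.scale/= mulr1 -mulr_natl.
  have := @is_deriveM _ _ (fun t : R => t ^+ k) (fun t : R => g (ray q t)) _ _ _ _ dt dg.
  move=> H; apply: (is_derive_eq H); rewrite /GRing.scale/= /ddir mulrDr !mulr_sumr.
  congr (_ + _ + _); last by rewrite mulrCA [g _ * _]mulrC.
    by apply: eq_bigr => i _; rewrite mulrCA.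
  by apply: eq_bigr => i _; rewrite mulrCA.
move: F; rewrite int01D//; last first.
  by apply: cont01D; apply: cont01_sum => i; exact: c2.
rewrite int01D ?int01Z; [|exact: cont01_rad|apply: cont01_sum => i; exact: c2..].
rewrite !int01_sum; [|move=> i; exact: c2..] => <-.
rewrite addrK; congr (_ + _); apply: eq_bigr => i _; by rewrite int01Z.
Qed.
End Radial.

(** * Complex-valued functions and their partial derivatives *)

Section ComplexParts.
Variable R : realType.
Implicit Types x y : R[i].

Lemma ReIm_eq x y : complex.Re x = complex.Re y -> complex.Im x = complex.Im y -> x = y.
Proof. by case: x y => [a b] [c d] /= -> ->. Qed.

Lemma cReD x y : complex.Re (x + y) = complex.Re x + complex.Re y.
Proof. by case: x y => [a b] [c d]. Qed.

Lemma cImD x y : complex.Im (x + y) = complex.Im x + complex.Im y.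
Proof. by case: x y => [a b] [c d]. Qed.

Lemma cReN x : complex.Re (- x) = - complex.Re x.
Proof. by case: x. Qed.

Lemma cImN x : complex.Im (- x) = - complex.Im x.
Proof. by case: x. Qed.

Lemma cReM x y :
  complex.Re (x * y) = complex.Re x * complex.Re y - complex.Im x * complex.Im y.
Proof. by case: x y => [a b] [c d]. Qed.

Lemma cImM x y :
  complex.Im (x * y) = complex.Re x * complex.Im y + complex.Im x * complex.Re y.
Proof. by case: x y => [a b] [c d]. Qed.

Lemma cRe_sum (I : Type) (s : seq I) (P : pred I) (F : I -> R[i]) :
  complex.Re (\sum_(i <- s | P i) F i) = \sum_(i <- s | P i) complex.Re (F i).
Proof. by apply: (big_morph (@complex.Re R)) => //; exact: cReD. Qed.

Lemma cIm_sum (I : Type) (s : seq I) (P : pred I) (F : I -> R[i]) :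
  complex.Im (\sum_(i <- s | P i) F i) = \sum_(i <- s | P i) complex.Im (F i).
Proof. by apply: (big_morph (@complex.Im R)) => //; exact: cImD. Qed.

End ComplexParts.

Section ComplexCalculus.
Variables (R : realType) (n : nat).
Local Notation TB := (TB R n).
Local Notation C := R[i].
Variable W : set TB.
Hypothesis oW : open W.
Implicit Types (f g : TB -> C) (r : TB -> R).

Lemma rsmooth_partial r a : rsmooth W r -> rsmooth W (rpartial a r).
Proof. by move=> /rsmoothP rs; apply/rsmoothP => k; exact: (rs k.+1).2. Qed.

Lemma rsmooth_derivable r a p : rsmooth W r -> W p -> derivable r p (dirv R a).
Proof. by move=> rs Wp; have [_] := rs [::] p Wp. Qed.

Lemma eq_csmooth f g : {in W, f =1 g} -> csmooth W f -> csmooth W g.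
Proof.
move=> fg [/rsmoothP h1 /rsmoothP h2]; split; apply/rsmoothP => k.
  by apply: eq_rsm (h1 k) => // p Wp; rewrite fg.
by apply: eq_rsm (h2 k) => // p Wp; rewrite fg.
Qed.

Lemma csmooth_cst c : csmooth W (fun=> c).
Proof. by split; apply/rsmoothP => k; exact: rsm_cst. Qed.

Lemma csmoothD f g : csmooth W f -> csmooth W g -> csmooth W (fun p => f p + g p).
Proof.
move=> [/rsmoothP f1 /rsmoothP f2] [/rsmoothP g1 /rsmoothP g2].
split; apply/rsmoothP => k.
  by apply: eq_rsm (rsmD oW (f1 k) (g1 k)) => // p _; rewrite cReD.
by apply: eq_rsm (rsmD oW (f2 k) (g2 k)) => // p _; rewrite cImD.
Qed.

Lemma csmoothM f g : csmooth W f -> csmooth W g -> csmooth W (fun p => f p * g p).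
Proof.
move=> [/rsmoothP f1 /rsmoothP f2] [/rsmoothP g1 /rsmoothP g2].
split; apply/rsmoothP => k.
  apply: eq_rsm (rsmD oW (rsmM oW (f1 k) (g1 k)) (rsmN oW (rsmM oW (f2 k) (g2 k)))) => // p _.
  by rewrite cReM.
apply: eq_rsm (rsmD oW (rsmM oW (f1 k) (g2 k)) (rsmM oW (f2 k) (g1 k))) => // p _.
by rewrite cImM.
Qed.

Lemma csmoothZ c f : csmooth W f -> csmooth W (fun p => c * f p).
Proof. by apply: csmoothM; exact: csmooth_cst. Qed.

Lemma csmoothN f : csmooth W f -> csmooth W (fun p => - f p).
Proof. by move=> fs; apply: eq_csmooth (csmoothZ (-1) fs) => p _; rewrite mulN1r. Qed.

Lemma csmoothB f g : csmooth W f -> csmooth W g -> csmooth W (fun p => f p - g p).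
Proof. by move=> fs gs; exact: (csmoothD fs (csmoothN gs)). Qed.

Lemma csmooth_sum (I : Type) (s : seq I) (P : pred I) (F : I -> TB -> C) :
  (forall i, P i -> csmooth W (F i)) -> csmooth W (fun p => \sum_(i <- s | P i) F i p).
Proof.
move=> Fs; elim: s => [|i s IHs].
  by under eq_fun do rewrite big_nil; exact: csmooth_cst.
case Pi: (P i); last first.
  by apply: (eq_csmooth _ IHs) => p _; rewrite big_cons Pi.
by apply: (eq_csmooth _ (csmoothD (Fs i Pi) IHs)) => p _; rewrite big_cons Pi.
Qed.

Lemma csmooth_cpartial f a : csmooth W f -> csmooth W (cpartial a f).
Proof. by move=> [f1 f2]; split; exact: rsmooth_partial. Qed.

Lemma csmooth_real r : rsmooth W r -> csmooth W (fun p => (r p)%:C).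
Proof. by move=> rs; split; [exact: rs|apply/rsmoothP => k; exact: rsm_cst]. Qed.

Lemma csmooth_inv f : (forall p, W p -> f p != 0) -> csmooth W f ->
  csmooth W (fun p => (f p)^-1).
Proof.
move=> f0 [/rsmoothP f1 /rsmoothP f2].
have nn p : W p -> complex.Re (f p) * complex.Re (f p) + complex.Im (f p) * complex.Im (f p) != 0.
  move=> Wp; apply: contra (f0 p Wp); case: (f p) => a b /=.
  rewrite paddr_eq0 ?mulf_eq0 ?orbb; [|by rewrite -expr2 sqr_ge0..].
  by move=> /andP[/eqP -> /eqP ->].
have ns k := rsmV oW nn (rsmD oW (rsmM oW (f1 k) (f1 k)) (rsmM oW (f2 k) (f2 k))).
split; apply/rsmoothP => k.
  apply: eq_rsm (rsmM oW (f1 k) (ns k)) => // p _.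
  by case: (f p) => a b /=; rewrite -!expr2.
apply: eq_rsm (rsmN oW (rsmM oW (f2 k) (ns k))) => // p _.
by case: (f p) => a b /=; rewrite -!expr2.
Qed.

Lemma eq_rpartial a r r' p : r =1 r' -> rpartial a r p = rpartial a r' p.
Proof. by move/funext ->. Qed.

Lemma eq1_cpartial a f g p : f =1 g -> cpartial a f p = cpartial a g p.
Proof. by move/funext ->. Qed.

Lemma cpartial_near a f g p :
  (\forall q \near p, f q = g q) -> cpartial a f p = cpartial a g p.
Proof.
move=> fg; rewrite /cpartial; congr (_ +i* _); apply: rpartial_near;
  by near=> q; rewrite (near fg q).
Unshelve. all: by end_near. Qed.

Lemma eq_cpartial a f g p : {in W, f =1 g} -> W p -> cpartial a f p = cpartial a g p.
Proof.
by move=> fg Wp; apply: cpartial_near; apply: (open_eq_near oW).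
Qed.

Lemma cpartial_cst a (c : C) (p : TB) : cpartial a (fun=> c) p = 0.
Proof. by apply: ReIm_eq; exact: derive_cst. Qed.

Lemma cpartialD a f g p : csmooth W f -> csmooth W g -> W p ->
  cpartial a (fun q => f q + g q) p = cpartial a f p + cpartial a g p.
Proof.
move=> [f1 f2] [g1 g2] Wp.
have d r : rsmooth W r -> is_derive p (dirv R a) r (rpartial a r p).
  by move=> rs; apply: derivableP; exact: rsmooth_derivable.
apply: ReIm_eq.
  rewrite cReD.
  have [_ E] := is_deriveD (d _ f1) (d _ g1).
  rewrite -[RHS]E /cpartial /=; apply: eq_rpartial => q; exact: cReD.
rewrite cImD; have [_ E] := is_deriveD (d _ f2) (d _ g2).
rewrite -[RHS]E /cpartial /=; apply: eq_rpartial => q; exact: cImD.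
Qed.

Lemma cpartialM a f g p : csmooth W f -> csmooth W g -> W p ->
  cpartial a (fun q => f q * g q) p = cpartial a f p * g p + f p * cpartial a g p.
Proof.
move=> [f1 f2] [g1 g2] Wp.
have d r : rsmooth W r -> is_derive p (dirv R a) r (rpartial a r p).
  by move=> rs; apply: derivableP; exact: rsmooth_derivable.
have [[[d1 d2] d3] d4] := (d _ f1, d _ f2, d _ g1, d _ g2).
apply: ReIm_eq.
  have [_ E] := is_deriveB (is_deriveM d1 d3) (is_deriveM d2 d4).
  transitivity (rpartial a ((fun q => complex.Re (f q)) * (fun q => complex.Re (g q)) -
     (fun q => complex.Im (f q)) * (fun q => complex.Im (g q))) p).
    by apply: eq_rpartial => q; rewrite cReM.
  rewrite [LHS]E cReD !cReM /cpartial /= /GRing.scale /=.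
  move: (rpartial _ _ _) (rpartial _ _ _) (rpartial _ _ _) (rpartial _ _ _) => A B A' B'.
  ring.
have [_ E] := is_deriveD (is_deriveM d1 d4) (is_deriveM d2 d3).
transitivity (rpartial a ((fun q => complex.Re (f q)) * (fun q => complex.Im (g q)) +
    (fun q => complex.Im (f q)) * (fun q => complex.Re (g q))) p).
  by apply: eq_rpartial => q; rewrite cImM.
rewrite [LHS]E cImD !cImM /cpartial /= /GRing.scale /=.
move: (rpartial _ _ _) (rpartial _ _ _) (rpartial _ _ _) (rpartial _ _ _) => A B A' B'.
ring.
Qed.

Lemma cpartialZ a c f p : csmooth W f -> W p ->
  cpartial a (fun q => c * f q) p = c * cpartial a f p.
Proof.
move=> fs Wp; rewrite (cpartialM a (csmooth_cst c) fs Wp).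
by rewrite cpartial_cst mul0r add0r.
Qed.

Lemma cpartial_sum a (I : Type) (s : seq I) (P : pred I) (F : I -> TB -> C) p :
  (forall i, P i -> csmooth W (F i)) -> W p ->
  cpartial a (fun q => \sum_(i <- s | P i) F i q) p = \sum_(i <- s | P i) cpartial a (F i) p.
Proof.
move=> Fs Wp; elim: s => [|i s IHs].
  by rewrite big_nil -[RHS](cpartial_cst a 0 p); apply: eq1_cpartial => q; rewrite big_nil.
case Pi: (P i); last first.
  by rewrite big_cons Pi -IHs; apply: eq1_cpartial => q; rewrite big_cons Pi.
rewrite big_cons Pi -IHs -cpartialD//; [|exact: Fs|exact: csmooth_sum].
by apply: eq1_cpartial => q; rewrite big_cons Pi.
Qed.

Lemma cpartialC a b f p : csmooth W f -> W p ->
  cpartial a (cpartial b f) p = cpartial b (cpartial a f) p.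
Proof.
move=> [/rsmoothP f1 /rsmoothP f2] Wp.
by apply: ReIm_eq; [exact: (rpartialC a b oW (f1 2%N) Wp)|exact: (rpartialC a b oW (f2 2%N) Wp)].
Qed.

End ComplexCalculus.

Section LinearFunctions.
Variables (R : realType) (n : nat).
Local Notation TB := (TB R n).
Local Notation C := R[i].

Lemma is_derive_linear (l : TB -> R) p v :
  (forall h w q, l (h *: w + q) = h * l w + l q) -> is_derive p v l (l v).
Proof.
move=> lin; have lim : h^-1 *: (l (h *: v + p) - l p) @[h --> 0^'] --> l v.
  apply/cvgrPdist_le => e e0; near=> h.
  have h0 : h != 0 by near: h; exact: nbhs_dnbhs_neq.
  by rewrite lin addrK /GRing.scale/= mulrA mulVf// mul1r subrr normr0 ltW.
apply: DeriveDef; first by apply/cvg_ex; eexists; exact: lim.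
exact/cvg_lim.
Unshelve. all: by end_near. Qed.

Lemma rsm_linear (l : TB -> R) k W : continuous l ->
  (forall h w q, l (h *: w + q) = h * l w + l q) -> rsm k W l.
Proof.
move=> lc lin; case: k => [|k] /=; first by move=> p _; exact: lc.
split=> [p _|a]; first by split=> [|a]; [exact: lc|have [] := is_derive_linear p (dirv R a) lin].
have -> : rpartial a l = cst (l (dirv R a)).
  by apply/funext => p; have [_ E] := is_derive_linear p (dirv R a) lin; exact: E.
exact: rsm_cst.
Qed.

Definition xcoord i (p : TB) : R := p.1 0 i.
Definition ycoord i (p : TB) : R := p.2 0 i.

Lemma xcoord_lin i h w q : xcoord i (h *: w + q) = h * xcoord i w + xcoord i q.
Proof. by rewrite /xcoord /= !mxE. Qed.

Lemma ycoord_lin i h w q : ycoord i (h *: w + q) = h * ycoord i w + ycoord i q.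
Proof. by rewrite /ycoord /= !mxE. Qed.

Lemma xcoord_continuous i : continuous (xcoord i).
Proof.
move=> p; apply: (@continuous_comp _ _ _ fst (fun v : 'rV[R]_n => v 0 i)).
  exact: cvg_fst.
exact: coord_continuous.
Qed.

Lemma ycoord_continuous i : continuous (ycoord i).
Proof.
move=> p; apply: (@continuous_comp _ _ _ snd (fun v : 'rV[R]_n => v 0 i)).
  exact: cvg_snd.
exact: coord_continuous.
Qed.

Lemma csmooth_xcoord i W : csmooth W (fun p => (xcoord i p)%:C).
Proof.
apply: csmooth_real; apply/rsmoothP => k.
by apply: rsm_linear; [exact: xcoord_continuous|exact: xcoord_lin].
Qed.

Lemma csmooth_ycoord i W : csmooth W (fun p => (ycoord i p)%:C).
Proof.
apply: csmooth_real; apply/rsmoothP => k.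
by apply: rsm_linear; [exact: ycoord_continuous|exact: ycoord_lin].
Qed.

Lemma cpartial_xcoord a i p : cpartial a (fun p => (xcoord i p)%:C) p = (a == inl i)%:R.
Proof.
apply: ReIm_eq => /=.
  have [_] := is_derive_linear p (dirv R a) (xcoord_lin i).
  rewrite /rpartial => ->; case: a => j; rewrite /xcoord /= mxE ?eqxx//=.
  have -> : (inl j == inl i :> 'I_n + 'I_n) = (i == j) by exact: eq_sym.
  by case: (i == j).
rewrite /rpartial derive_cst; by case: (_ == _).
Qed.

Lemma cpartial_ycoord a i p : cpartial a (fun p => (ycoord i p)%:C) p = (a == inr i)%:R.
Proof.
apply: ReIm_eq => /=.
  have [_] := is_derive_linear p (dirv R a) (ycoord_lin i).
  rewrite /rpartial => ->; case: a => j; rewrite /ycoord /= mxE ?eqxx//=.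
  have -> : (inr j == inr i :> 'I_n + 'I_n) = (i == j) by exact: eq_sym.
  by case: (i == j).
rewrite /rpartial derive_cst; by case: (_ == _).
Qed.

End LinearFunctions.

(** * Wirtinger operators and holomorphic coordinates *)

Section CauchyRiemann.
Variables (R : realType) (n : nat).
Local Notation TB := (TB R n).
Local Notation C := R[i].
Variable W : set TB.
Hypothesis oW : open W.
Implicit Types f g : TB -> C.

(* [del 'i i] is [2 d/d(zbar_i)], [del (- 'i) i] is [2 d/dz_i]. *)
Definition del (s : C) (i : 'I_n) f (p : TB) : C :=
  cpartial (inl i) f p + s * cpartial (inr i) f p.

Lemma csmooth_del s i f : csmooth W f -> csmooth W (del s i f).
Proof.
move=> fs; apply: (csmoothD oW (csmooth_cpartial (inl i) fs)).
exact: (csmoothZ oW s (csmooth_cpartial (inr i) fs)).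
Qed.

Lemma eq_del s i f g p : {in W, f =1 g} -> W p -> del s i f p = del s i g p.
Proof. by move=> fg Wp; rewrite /del !(eq_cpartial oW _ fg Wp). Qed.

Lemma del_cst s i (c : C) (p : TB) : del s i (fun=> c) p = 0.
Proof. by rewrite /del !cpartial_cst mulr0 addr0. Qed.

Lemma delD s i f g p : csmooth W f -> csmooth W g -> W p ->
  del s i (fun q => f q + g q) p = del s i f p + del s i g p.
Proof.
move=> fs gs Wp.
rewrite /del (cpartialD (inl i) fs gs Wp) (cpartialD (inr i) fs gs Wp).
move: (cpartial (inl i) f p) (cpartial (inr i) f p) (cpartial (inl i) g p)
  (cpartial (inr i) g p) (f p) (g p) => *; ring.
Qed.

Lemma delM s i f g p : csmooth W f -> csmooth W g -> W p ->
  del s i (fun q => f q * g q) p = del s i f p * g p + f p * del s i g p.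
Proof.
move=> fs gs Wp.
rewrite /del (cpartialM (inl i) fs gs Wp) (cpartialM (inr i) fs gs Wp).
move: (cpartial (inl i) f p) (cpartial (inr i) f p) (cpartial (inl i) g p)
  (cpartial (inr i) g p) (f p) (g p) => *; ring.
Qed.

Lemma delZ s i c f p : csmooth W f -> W p ->
  del s i (fun q => c * f q) p = c * del s i f p.
Proof.
move=> fs Wp.
rewrite /del (cpartialZ (inl i) c fs Wp) (cpartialZ (inr i) c fs Wp).
by move: (cpartial (inl i) f p) (cpartial (inr i) f p) => *; ring.
Qed.

Lemma del_sum s i (I : Type) (r : seq I) (P : pred I) (F : I -> TB -> C) p :
  (forall j, P j -> csmooth W (F j)) -> W p ->
  del s i (fun q => \sum_(j <- r | P j) F j q) p = \sum_(j <- r | P j) del s i (F j) p.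
Proof.
move=> Fs Wp; rewrite /del (cpartial_sum oW _ _ Fs Wp) (cpartial_sum oW _ _ Fs Wp).
by rewrite mulr_sumr -big_split.
Qed.

Lemma delC s t i j f p : csmooth W f -> W p ->
  del s i (del t j f) p = del t j (del s i f) p.
Proof.
move=> fs Wp; have cs a := csmooth_cpartial a fs.
have E a b k : cpartial a (del k b f) p
    = cpartial a (cpartial (inl b) f) p + k * cpartial a (cpartial (inr b) f) p.
  rewrite (cpartialD a (cs _) (csmoothZ oW k (cs _)) Wp).
  by rewrite (cpartialZ a k (cs _) Wp).
have alg (A1 A2 A3 A4 B1 B2 B3 B4 : C) : A1 = B1 -> A2 = B3 -> A3 = B2 -> A4 = B4 ->
  (A1 + t * A2) + s * (A3 + t * A4) = (B1 + s * B2) + t * (B3 + s * B4).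
  by move=> -> -> -> ->; ring.
have L : del s i (del t j f) p = _ := f_equal2 (fun x y => x + s * y) (E _ _ _) (E _ _ _).
have R' : del t j (del s i f) p = _ := f_equal2 (fun x y => x + t * y) (E _ _ _) (E _ _ _).
refine (etrans L (etrans _ (esym R'))).
by apply: alg; exact: (cpartialC oW _ _ fs Wp).
Qed.

Variable c : TB.

Definition zc (i : 'I_n) (q : TB) : C :=
  (q.1 0 i - c.1 0 i)%:C + 'i * (q.2 0 i - c.2 0 i)%:C.
Definition zcb (i : 'I_n) (q : TB) : C :=
  (q.1 0 i - c.1 0 i)%:C - 'i * (q.2 0 i - c.2 0 i)%:C.

Lemma affine_csmooth_cpartial (s : C) i : let w := fun q : TB =>
    (q.1 0 i - c.1 0 i)%:C + s * (q.2 0 i - c.2 0 i)%:C in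
  csmooth W w /\ forall a p, W p -> cpartial a w p = (a == inl i)%:R + s * (a == inr i)%:R.
Proof.
move=> w.
have xs := csmooth_xcoord i W; have ys := csmooth_ycoord i W.
have ts := csmooth_cst W (- (c.1 0 i)%:C - s * (c.2 0 i)%:C).
have ss := csmoothD oW xs (csmoothZ oW s ys).
have -> : w = fun q => ((xcoord i q)%:C + s * (ycoord i q)%:C) + (- (c.1 0 i)%:C - s * (c.2 0 i)%:C).
  by apply/funext => q; rewrite /w /xcoord /ycoord !rmorphB/=; ring.
split=> [|a p Wp]; first exact: (csmoothD oW ss ts).
rewrite (cpartialD a ss ts Wp) (cpartialD a xs (csmoothZ oW s ys) Wp).
by rewrite (cpartialZ a s ys Wp) cpartial_cst cpartial_xcoord cpartial_ycoord addr0.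
Qed.

Lemma csmooth_zc i : csmooth W (zc i).
Proof. exact: (affine_csmooth_cpartial _ i).1. Qed.

Lemma csmooth_zcb i : csmooth W (zcb i).
Proof.
have -> : zcb i = fun q => (q.1 0 i - c.1 0 i)%:C + (- 'i) * (q.2 0 i - c.2 0 i)%:C.
  by apply/funext => q; rewrite /zcb mulNr.
exact: (affine_csmooth_cpartial _ i).1.
Qed.

Lemma cii : 'i * 'i = -1 :> C.
Proof. by rewrite -expr2 sqr_i. Qed.

Lemma del_zc s i j p : W p -> del s i (zc j) p = (1 + s * 'i) * (i == j)%:R.
Proof.
move=> Wp; rewrite /del !(affine_csmooth_cpartial _ j).2//.
have -> : (inl i == inl j :> 'I_n + 'I_n) = (i == j) by [].
have -> : (inr i == inr j :> 'I_n + 'I_n) = (i == j) by [].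
by rewrite /= mulr0 addr0 add0r; ring.
Qed.

Lemma del_zcb s i j p : W p -> del s i (zcb j) p = (1 - s * 'i) * (i == j)%:R.
Proof.
have -> : zcb j = fun q => (q.1 0 j - c.1 0 j)%:C + (- 'i) * (q.2 0 j - c.2 0 j)%:C.
  by apply/funext => q; rewrite /zcb mulNr.
move=> Wp; rewrite /del !(affine_csmooth_cpartial _ j).2//.
have -> : (inl i == inl j :> 'I_n + 'I_n) = (i == j) by [].
have -> : (inr i == inr j :> 'I_n + 'I_n) = (i == j) by [].
by rewrite /= mulr0 addr0 add0r; ring.
Qed.

Lemma delbar_zc i j p : W p -> del 'i i (zc j) p = 0.
Proof. by move=> Wp; rewrite del_zc// cii subrr mul0r. Qed.

Lemma delbar_zcb i j p : W p -> del 'i i (zcb j) p = 2 * (i == j)%:R.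
Proof. by move=> Wp; rewrite del_zcb// cii opprK. Qed.

Lemma delz_zc i j p : W p -> del (- 'i) i (zc j) p = 2 * (i == j)%:R.
Proof. by move=> Wp; rewrite del_zc// mulNr cii opprK. Qed.

(** A solution, equal to 1 at [c], of the equations [del 'i i f = b i * f]. Twisting by it removes
    the term that dbar picks up from differentiating T^beta. *)
Definition expl (b : 'I_n -> R) (q : TB) : C :=
  (expR (\sum_i b i * (q.1 0 i - c.1 0 i)))%:C.

Lemma explN b q : expl b q * expl (fun i => - b i) q = 1.
Proof.
rewrite /expl -rmorphM -expRD/= -big_split big1 ?expR0// => i _.
by rewrite /= mulNr subrr.
Qed.

Lemma expl_center b : expl b c = 1.
Proof. by rewrite /expl big1 ?expR0// => i _; rewrite subrr mulr0. Qed.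

Lemma expl_exponent b : let l := fun q : TB => \sum_i b i * (q.1 0 i - c.1 0 i) in
  (forall k, rsm k W l) /\
  forall a p, is_derive p (dirv R a) l (if a is inl i then b i else 0).
Proof.
move=> l; pose l0 (q : TB) := \sum_i b i * xcoord i q.
have El : l = l0 \+ cst (- l0 c).
  apply/funext => q; rewrite /l /l0 /= -sumrN -big_split; apply: eq_bigr => i _.
  by rewrite mulrBr.
have l0lin h w q : l0 (h *: w + q) = h * l0 w + l0 q.
  rewrite /l0 mulr_sumr -big_split; apply: eq_bigr => i _.
  by rewrite xcoord_lin mulrDr mulrCA.
have l0c : continuous l0.
  rewrite /l0; apply: continuous_big => [|i _ p]; first exact: add_continuous.
  by apply: cvgM; [exact: cvg_cst|exact: xcoord_continuous].
split=> [k|a p].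
  by rewrite El; apply: rsmD => //; [exact: rsm_linear|exact: rsm_cst].
rewrite El; have := is_deriveD (is_derive_linear p (dirv R a) l0lin) (is_derive_cst (- l0 c) p (dirv R a)).
rewrite addr0; have -> // : l0 (dirv R a) = if a is inl i then b i else 0.
rewrite /l0; case: a => i; rewrite /xcoord /=; last first.
  by rewrite big1// => j _; rewrite mxE mulr0.
rewrite (bigD1 i)//= big1 ?addr0 => [|j ji]; first by rewrite mxE !eqxx mulr1.
by rewrite mxE eqxx (negPf ji) mulr0.
Qed.

Lemma csmooth_expl b : csmooth W (expl b).
Proof.
apply: csmooth_real; apply/rsmoothP => k.
exact: (rsm_expR oW ((expl_exponent b).1 k)).
Qed.

(** The exponent depends on x alone, so the weight [s] of the y-derivative does not enter. *)
Lemma del_expl s b i p : del s i (expl b) p = (b i)%:C * expl b p.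
Proof.
have E a : cpartial a (expl b) p = (if a is inl i then b i else 0)%:C * expl b p.
  have [_ dl] := expl_exponent b.
  have [_ E] := is_derive_comp1 (is_derive_expR _) (dl a p).
  apply: ReIm_eq; rewrite /cpartial /=; first by rewrite mul0r subr0 [RHS]mulrC; exact: E.
  by rewrite /rpartial derive_cst mul0r mulr0 addr0.
by rewrite /del !E mul0r mulr0 addr0.
Qed.

End CauchyRiemann.

(** * Radial integrals of complex functions *)

Section ComplexRadial.
Variables (R : realType) (n : nat).
Local Notation TB := (TB R n).
Local Notation C := R[i].
Variables (c : TB) (W : set TB).
Hypothesis oW : open W.
Hypothesis starW : forall q (t : R), W q -> 0 <= t <= 1 -> W (c + t *: (q - c)).
Implicit Types f g : TB -> C.

Definition crad k f (q : TB) : C :=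
  rad c k (fun p => complex.Re (f p)) q +i* rad c k (fun p => complex.Im (f p)) q.

Lemma csmooth_crad k f : csmooth W f -> csmooth W (crad k f).
Proof.
by move=> [/rsmoothP f1 /rsmoothP f2]; split; apply/rsmoothP => j; exact: rad_rsm.
Qed.

Lemma eq_crad k f g q : {in W, f =1 g} -> W q -> crad k f q = crad k g q.
Proof.
move=> fg Wq; have E t : 0 <= t <= 1 -> f (c + t *: (q - c)) = g (c + t *: (q - c)).
  by move=> t01; apply: fg; rewrite inE; exact: starW.
by apply: ReIm_eq => /=; apply: eq_int01 => t t01; rewrite E.
Qed.

Lemma cpartial_crad a k f q : csmooth W f -> W q ->
  cpartial a (crad k f) q = crad k.+1 (cpartial a f) q.
Proof.
move=> [/rsmoothP f1 /rsmoothP f2] Wq; apply: ReIm_eq.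
  by have [_ E] := rad_is_derive oW starW k a (f1 1%N) Wq; exact: E.
by have [_ E] := rad_is_derive oW starW k a (f2 1%N) Wq; exact: E.
Qed.

Lemma radD k (r s : TB -> R) q : rsm 0 W r -> rsm 0 W s -> W q ->
  rad c k (fun p => r p + s p) q = rad c k r q + rad c k s q.
Proof.
move=> rs ss Wq; rewrite /rad -int01D; [|exact: cont01_rad rs Wq|exact: cont01_rad ss Wq].
by apply: eq_int01 => t _; rewrite mulrDr.
Qed.

Lemma radZ k x (r : TB -> R) q : rsm 0 W r -> W q ->
  rad c k (fun p => x * r p) q = x * rad c k r q.
Proof.
move=> rs Wq; rewrite /rad -int01Z; last exact: cont01_rad rs Wq.
by apply: eq_int01 => t _; rewrite mulrCA.
Qed.

Lemma csmooth_rsm0 f : csmooth W f ->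
  rsm 0 W (fun p => complex.Re (f p)) /\ rsm 0 W (fun p => complex.Im (f p)).
Proof. by move=> [/rsmoothP f1 /rsmoothP f2]; split; [exact: f1|exact: f2]. Qed.

Lemma cradD k f g q : csmooth W f -> csmooth W g -> W q ->
  crad k (fun p => f p + g p) q = crad k f q + crad k g q.
Proof.
move=> /csmooth_rsm0[f1 f2] /csmooth_rsm0[g1 g2] Wq; apply: ReIm_eq.
  by rewrite cReD /= -radD//; apply: eq_int01 => t _; rewrite cReD.
by rewrite cImD /= -radD//; apply: eq_int01 => t _; rewrite cImD.
Qed.

Lemma cradZ k x f q : csmooth W f -> W q -> crad k (fun p => x * f p) q = x * crad k f q.
Proof.
move=> fs Wq; have [f1 f2] := csmooth_rsm0 fs; have [x1 x2] := csmooth_rsm0 (csmoothZ oW x fs).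
have z1 y : rsm 0 W (fun p => y * complex.Re (f p)).
  exact: (rsmM oW (@rsm_cst R n 0 W y) f1).
have z2 y : rsm 0 W (fun p => y * complex.Im (f p)).
  exact: (rsmM oW (@rsm_cst R n 0 W y) f2).
apply: ReIm_eq.
  rewrite cReM /= -[in RHS]mulNr -!radZ// -radD//.
  by apply: eq_int01 => t _; rewrite cReM mulNr.
rewrite cImM /= -!radZ// -radD//.
by apply: eq_int01 => t _; rewrite cImM.
Qed.

Lemma crad_sum k (I : Type) (s : seq I) (P : pred I) (F : I -> TB -> C) q :
  (forall i, P i -> csmooth W (F i)) -> W q ->
  crad k (fun p => \sum_(i <- s | P i) F i p) q = \sum_(i <- s | P i) crad k (F i) q.
Proof.
move=> Fs Wq; elim: s => [|i s IHs].
  rewrite big_nil; have -> : (fun p : TB => \sum_(i <- [::] | P i) F i p) = (fun=> 0 * 0).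
    by apply/funext => p; rewrite big_nil mul0r.
  by rewrite cradZ ?mul0r//; exact: csmooth_cst.
case Pi: (P i); last first.
  by rewrite big_cons Pi -IHs; apply: (eq_crad _ _ Wq) => p _; rewrite big_cons Pi.
rewrite big_cons Pi -IHs -(cradD k (Fs i Pi) (csmooth_sum oW s Fs) Wq).
by apply: (eq_crad _ _ Wq) => p _; rewrite big_cons Pi.
Qed.

(** A function that is linear along the rays contributes one factor of the ray parameter, which
    raises the weight by one and lets its value at [q] leave the integral. *)
Lemma crad_real_linear k (l : TB -> R) f q : csmooth W f -> W q ->
  (forall t, l (c + t *: (q - c)) = t * l q) ->
  crad k (fun p => (l p)%:C * f p) q = (l q)%:C * crad k.+1 f q.
Proof.
move=> fs Wq lt; have [f1 f2] := csmooth_rsm0 fs.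
apply: ReIm_eq.
  rewrite cReM /= mul0r subr0 -radZ//; apply: eq_int01 => t _.
  by rewrite cReM /= mul0r subr0 lt exprS; ring.
rewrite cImM /= mul0r addr0 -radZ//; apply: eq_int01 => t _.
by rewrite cImM /= mul0r addr0 lt exprS; ring.
Qed.

Lemma crad_zc (s : C) k i f q : csmooth W f -> W q ->
  crad k (fun p => ((p.1 0 i - c.1 0 i)%:C + s * (p.2 0 i - c.2 0 i)%:C) * f p) q
  = ((q.1 0 i - c.1 0 i)%:C + s * (q.2 0 i - c.2 0 i)%:C) * crad k.+1 f q.
Proof.
move=> fs Wq.
have xs : csmooth W (fun p => (p.1 0 i - c.1 0 i)%:C * f p).
  have h := csmoothB oW (csmooth_xcoord i W) (csmooth_cst W (c.1 0 i)%:C).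
  by apply: (eq_csmooth oW _ (csmoothM oW h fs)) => p _; rewrite rmorphB.
have ys : csmooth W (fun p => (p.2 0 i - c.2 0 i)%:C * f p).
  have h := csmoothB oW (csmooth_ycoord i W) (csmooth_cst W (c.2 0 i)%:C).
  by apply: (eq_csmooth oW _ (csmoothM oW h fs)) => p _; rewrite rmorphB.
have l1 t : (c + t *: (q - c)).1 0 i - c.1 0 i = t * (q.1 0 i - c.1 0 i).
  by rewrite /= !mxE; ring.
have l2 t : (c + t *: (q - c)).2 0 i - c.2 0 i = t * (q.2 0 i - c.2 0 i).
  by rewrite /= !mxE; ring.
rewrite mulrDl -mulrA -(crad_real_linear k (l := fun p => p.1 0 i - c.1 0 i) fs Wq l1).
rewrite -(crad_real_linear k (l := fun p => p.2 0 i - c.2 0 i) fs Wq l2).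
rewrite -(cradZ k s ys Wq) -(cradD k xs (csmoothZ oW s ys) Wq).
by apply: (eq_crad _ _ Wq) => p _; rewrite mulrDl mulrA.
Qed.

Lemma crad_mul_zc k i f q : csmooth W f -> W q ->
  crad k (fun p => zc c i p * f p) q = zc c i q * crad k.+1 f q.
Proof. exact: crad_zc. Qed.

Lemma del_crad s i k f q : csmooth W f -> W q ->
  del s i (crad k f) q = crad k.+1 (del s i f) q.
Proof.
move=> fs Wq; have cs a := csmooth_cpartial a fs.
rewrite /del (cradD k.+1 (cs _) (csmoothZ oW s (cs _)) Wq) (cradZ k.+1 s (cs _) Wq).
by rewrite (cpartial_crad (inl i) k fs Wq) (cpartial_crad (inr i) k fs Wq).
Qed.

(** The real Euler identity in complex coordinates. The sum of [zcb * del 'i] and [zc * del (- 'i)]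
    is twice the Euler field, because both operators are twice the usual Wirtinger derivatives. *)
Lemma crad_euler k f q : csmooth W f -> W q ->
  \sum_i zcb c i q * crad k (del 'i i f) q + \sum_i zc c i q * crad k (del (- 'i) i f) q
  = 2 * (f q - 0 ^+ k * f c - k%:R * crad k.-1 f q).
Proof.
move=> fs Wq; have [/rsmoothP f1 /rsmoothP f2] := fs; have cs a := csmooth_cpartial a fs.
have E s i : crad k (del s i f) q =
    crad k (cpartial (inl i) f) q + s * crad k (cpartial (inr i) f) q.
  by rewrite (cradD k (cs _) (csmoothZ oW s (cs _)) Wq) (cradZ k s (cs _) Wq).
have Rk (m : nat) : complex.Re (m%:R : C) = m%:R /\ complex.Im (m%:R : C) = 0.
  elim: m => [//|m [h1 h2]]; rewrite -[m.+1]addn1 !natrD cReD cImD h1 h2 /=.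
  by split=> //; rewrite add0r.
have R0 : complex.Re ((0 : C) ^+ k) = 0 ^+ k /\ complex.Im ((0 : C) ^+ k) = 0.
  by rewrite !expr0n; case: (k == 0)%N.
have F : \sum_i (q.1 0 i - c.1 0 i)%:C * crad k (cpartial (inl i) f) q
    + \sum_i (q.2 0 i - c.2 0 i)%:C * crad k (cpartial (inr i) f) q
    = f q - 0 ^+ k * f c - k%:R * crad k.-1 f q.
  have rE x (y : C) : complex.Re (x%:C * y) = x * complex.Re y /\ complex.Im (x%:C * y) = x * complex.Im y.
    by case: y => a b /=; rewrite !mul0r subr0 addr0.
  have gR (a b d : C) : complex.Re (a - 0 ^+ k * b - k%:R * d) =
      complex.Re a - 0 ^+ k * complex.Re b - k%:R * complex.Re d.
    by rewrite !cReD !cReN !cReM (Rk k).1 (Rk k).2 R0.1 R0.2 !mul0r !subr0.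
  have gI (a b d : C) : complex.Im (a - 0 ^+ k * b - k%:R * d) =
      complex.Im a - 0 ^+ k * complex.Im b - k%:R * complex.Im d.
    by rewrite !cImD !cImN !cImM (Rk k).1 (Rk k).2 R0.1 R0.2 !mul0r !addr0.
  have gS (h : C -> R) (x y : 'I_n -> R) (A B : 'I_n -> C) : (forall u v, h (u + v) = h u + h v) ->
      h 0 = 0 -> (forall u v, h (u%:C * v) = u * h v) ->
      h (\sum_i (x i)%:C * A i + \sum_i (y i)%:C * B i) = \sum_i x i * h (A i) + \sum_i y i * h (B i).
    move=> hD h0 hM; have hs (F : 'I_n -> C) : h (\sum_i F i) = \sum_i h (F i).
      exact: (big_morph h hD h0).
    by rewrite hD !hs; congr (_ + _); apply: eq_bigr => i _; rewrite hM.
  have q1 i : (q - c).1 0 i = q.1 0 i - c.1 0 i by rewrite /= !mxE.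
  have q2 i : (q - c).2 0 i = q.2 0 i - c.2 0 i by rewrite /= !mxE.
  apply: ReIm_eq.
    rewrite (gS _ _ _ _ _ (@cReD R) (erefl _) (fun u v => (rE u v).1)) gR.
    refine (etrans _ (rad_euler oW starW k (f1 1%N) Wq)).
    by congr (_ + _); apply: eq_bigr => i _; rewrite ?q1 ?q2.
  rewrite (gS _ _ _ _ _ (@cImD R) (erefl _) (fun u v => (rE u v).2)) gI.
  refine (etrans _ (rad_euler oW starW k (f2 1%N) Wq)).
  by congr (_ + _); apply: eq_bigr => i _; rewrite ?q1 ?q2.
rewrite -F.
have ii := @cii R.
have alg (x y A B : C) : (x - 'i * y) * (A + 'i * B) + (x + 'i * y) * (A + - 'i * B)
    = 2 * (x * A) + 2 * (y * B).
  have -> : (x - 'i * y) * (A + 'i * B) + (x + 'i * y) * (A + - 'i * B)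
    = 2 * (x * A) - 2 * (('i * 'i) * (y * B)) by ring.
  by rewrite ii mulN1r mulrN opprK.
have alg2 (X Y A B : 'I_n -> C) :
    \sum_i (X i - 'i * Y i) * (A i + 'i * B i) + \sum_i (X i + 'i * Y i) * (A i + - 'i * B i)
    = 2 * (\sum_i X i * A i + \sum_i Y i * B i).
  by rewrite mulrDr !mulr_sumr -big_split -[RHS]big_split; apply: eq_bigr => i _; exact: alg.
refine (etrans (f_equal2 +%R _ _) (alg2 _ _ _ _)).
  by apply: eq_bigr => i _; rewrite E.
by apply: eq_bigr => i _; rewrite E.
Qed.

End ComplexRadial.

(** * Complex series with geometric bounds *)

Section GeometricSeries.
Variable R : realType.
Local Notation C := R[i].
Implicit Types (u v : nat -> R) (a b : nat -> C).

Definition geo (B : R) u := forall N, `|u N| <= B / 2 ^+ N.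

Lemma geo_ge0 B u : geo B u -> 0 <= B.
Proof. by move=> /(_ 0%N); rewrite expr0 divr1; apply: le_trans. Qed.

Lemma geo_cvg B u : geo B u -> cvgn (series u).
Proof.
move=> uB; apply: normed_cvg.
apply: (@series_le_cvg _ (fun N => `|u N|) (geometric B (1 / 2))) => [N|N|N|].
- exact: normr_ge0.
- rewrite /geometric /= mulr_ge0// ?exprn_ge0//.
  exact: geo_ge0 uB.
- by rewrite /geometric /= div1r exprVn; exact: uB.
apply: is_cvg_geometric_series.
by rewrite ger0_norm ?divr_ge0// ltr_pdivrMr// mul1r ltr1n.
Qed.

Lemma geo_le B u : geo B u -> `|limn (series u)| <= B * 2.
Proof.
move=> uB; have uc := geo_cvg uB.
have nc : cvgn (fun N => `|series u N|) by exact: is_cvg_norm.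
rewrite -lim_norm//; apply: limr_le => //.
apply: nearW => N; rewrite /series /=.
apply: le_trans (ler_norm_sum _ _ _) _.
have B0 := geo_ge0 uB.
have : \sum_(0 <= k < N) `|u k| <= B * (2 - 2 / 2 ^+ N).
  elim: N => [|N IHN]; first by rewrite big_nil expr0 divr1 subrr mulr0.
  rewrite big_nat_recr//=; apply: le_trans (lerD IHN (uB N)) _.
  rewrite -mulrDr ler_wpM2l// exprS invfM.
  have -> : 2 - 2 / 2 ^+ N + (2 ^+ N)^-1 = 2 - (2 ^+ N)^-1 :> R by ring.
  by rewrite mulrA divff ?mul1r.
move=> /le_trans; apply; rewrite ler_wpM2l// gerBl.
by rewrite divr_ge0// exprn_ge0.
Qed.

Definition cgeo (B : R) a := forall N, `|a N| <= (B / 2 ^+ N)%:C.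

Lemma normc_ge_Im (x : C) : `|complex.Im x|%:C <= `|x|.
Proof.
have i1 : `|'i : C| = 1 by rewrite normc_def /= expr0n/= add0r expr1n sqrtr1.
have -> : `|x| = `|'i * x| by rewrite normrM i1 mul1r.
apply: le_trans (normc_ge_Re _); rewrite lecR cReM /= mul0r mul1r sub0r normrN.
exact: lexx.
Qed.

Lemma cgeo_Re B a : cgeo B a -> geo B (fun N => complex.Re (a N)).
Proof. by move=> aB N; rewrite -lecR; apply: le_trans (normc_ge_Re _) (aB N). Qed.

Lemma cgeo_Im B a : cgeo B a -> geo B (fun N => complex.Im (a N)).
Proof. by move=> aB N; rewrite -lecR; apply: le_trans (normc_ge_Im _) (aB N). Qed.

(** [csum] is a limit with a default value on divergent series. This predicate keeps convergence
    together with the value, so that sums can be added, scaled and shifted. *)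
Definition has_csum a (s : C) :=
  series (fun N => complex.Re (a N)) @ \oo --> complex.Re s /\
  series (fun N => complex.Im (a N)) @ \oo --> complex.Im s.

Lemma has_csum_eq a s : has_csum a s -> csum a = s.
Proof. by move=> [h1 h2]; apply: ReIm_eq; apply/cvg_lim. Qed.

Lemma cgeo_has_csum B a : cgeo B a -> has_csum a (csum a).
Proof.
by move=> aB; split; apply: geo_cvg; [exact: cgeo_Re aB|exact: cgeo_Im aB].
Qed.

Lemma eq_csum a b : a =1 b -> csum a = csum b.
Proof. by move/funext ->. Qed.

Lemma seriesD u v : series (fun N => u N + v N) = series u \+ series v.
Proof. by apply/funext => N; rewrite /series /= big_split. Qed.

Lemma seriesZ k u : series (fun N => k * u N) = (fun N => k * series u N).
Proof. by apply/funext => N; rewrite /series /= mulr_sumr. Qed.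

Lemma has_csumD a b s t : has_csum a s -> has_csum b t ->
  has_csum (fun N => a N + b N) (s + t).
Proof.
move=> [a1 a2] [b1 b2]; split.
  rewrite cReD; under [X in series X]eq_fun do rewrite cReD.
  by rewrite seriesD; exact: cvgD.
rewrite cImD; under [X in series X]eq_fun do rewrite cImD.
by rewrite seriesD; exact: cvgD.
Qed.

Lemma has_csumZ c a s : has_csum a s -> has_csum (fun N => c * a N) (c * s).
Proof.
move=> [a1 a2]; have zz k u l : series u @ \oo --> (l : R) ->
    series (fun N => k * u N) @ \oo --> k * l.
  by move=> ul; rewrite seriesZ; apply: cvgM => //; exact: cvg_cst.
split.
  rewrite cReM; under [X in series X]eq_fun do rewrite cReM -mulNr.
  rewrite -mulNr seriesD; apply: cvgD; exact: zz.
rewrite cImM; under [X in series X]eq_fun do rewrite cImM.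
by rewrite seriesD; apply: cvgD; exact: zz.
Qed.

Lemma has_csum_fin a M : (forall N, (M <= N)%N -> a N = 0) ->
  has_csum a (\sum_(N < M) a N).
Proof.
move=> a0; have E (f : C -> R) : f 0 = 0 -> (forall x y, f (x + y) = f x + f y) ->
    series (fun N => f (a N)) @ \oo --> f (\sum_(N < M) a N).
  move=> f0 fD; apply: (@cvg_trans _ (f (\sum_(N < M) a N) @[N --> \oo])); last exact: cvg_cst.
  apply: near_eq_cvg; exists M => // N /= MN.
  rewrite /series /= (big_morph f fD f0) -(big_mkord xpredT (fun i => f (a i))).
  rewrite [RHS](big_cat_nat (leq0n M) MN)/= -[LHS]addr0; congr (_ + _).
  by rewrite big_nat_cond big1// => i; rewrite andbT => /andP[Mi _]; rewrite a0.
by split; apply: E => //; [exact: cReD|exact: cImD].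
Qed.

Lemma has_csum_sum (I : Type) (r : seq I) (F : I -> nat -> C) (s : I -> C) :
  (forall i, has_csum (F i) (s i)) ->
  has_csum (fun N => \sum_(i <- r) F i N) (\sum_(i <- r) s i).
Proof.
move=> Fs; elim: r => [|i r IHr].
  rewrite big_nil; have := @has_csum_fin (fun=> 0) 0 (fun _ _ => erefl).
  rewrite big_ord0; congr has_csum; apply/funext => N; by rewrite big_nil.
rewrite big_cons; have := has_csumD (Fs i) IHr.
by congr has_csum; apply/funext => N; rewrite big_cons.
Qed.

Lemma has_csum_shift a s : has_csum a s ->
  has_csum (fun N => if N is N'.+1 then a N' else 0) s.
Proof.
move=> [a1 a2]; split.
  rewrite -cvg_shiftS; move: a1; apply: cvg_trans; apply: near_eq_cvg; apply: nearW => N.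
  by rewrite /series /= big_nat_recl//= add0r.
rewrite -cvg_shiftS; move: a2; apply: cvg_trans; apply: near_eq_cvg; apply: nearW => N.
by rewrite /series /= big_nat_recl//= add0r.
Qed.

End GeometricSeries.

(** * Products of series *)

Section CauchyProduct.
Variable R : realType.
Local Notation C := R[i].
Implicit Types (a b : nat -> C).

(** The rate 8 is 2 times 2 times 2: in the estimate of a Cauchy product two factors absorb a number
    of terms of order [N * N], and the third leaves a geometric bound. *)
Definition rapid (B : R) a := forall N, `|a N| <= (B / 8 ^+ N)%:C.

Lemma rapid_ge0 B a : rapid B a -> 0 <= B.
Proof.
by move=> /(_ 0%N); rewrite expr0 divr1 => h; rewrite -ler0c; apply: le_trans h.
Qed.

Lemma natr_le_expr2 N : N%:R <= 2 ^+ N :> R.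
Proof. by rewrite -natrX ler_nat ltnW// ltn_expl. Qed.

Lemma expr8 N : 8 ^+ N = 2 ^+ N * (2 ^+ N * 2 ^+ N) :> R.
Proof. by rewrite -!exprMn_comm ?/GRing.comm// -!natrM. Qed.

Lemma rapid_cgeo B a : rapid B a -> cgeo B a.
Proof.
move=> aB N; apply: le_trans (aB N) _; rewrite lecR ler_wpM2l ?(rapid_ge0 aB)//.
by rewrite lef_pV2 ?posrE ?exprn_gt0// lerXn2r ?nnegrE ?ler_nat.
Qed.

Lemma has_csumP a s : has_csum a s <->
  (complex.Re (\sum_(i < N) a i) @[N --> \oo] --> complex.Re s /\
   complex.Im (\sum_(i < N) a i) @[N --> \oo] --> complex.Im s).
Proof.
rewrite /has_csum.
have -> : (fun N : nat => complex.Re (\sum_(i < N) a i)) = series (fun N => complex.Re (a N)).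
  by apply/funext => N; rewrite cRe_sum /series /= big_mkord.
have -> // : (fun N : nat => complex.Im (\sum_(i < N) a i)) = series (fun N => complex.Im (a N)).
by apply/funext => N; rewrite cIm_sum /series /= big_mkord.
Qed.

Lemma cauchy_triangle a b N :
  \sum_(m < N) \sum_(i < m.+1) a i * b (m - i)%N = \sum_(i < N) \sum_(j < N - i) a i * b j.
Proof.
elim: N => [|N IHN]; first by rewrite !big_ord0.
rewrite big_ord_recr/= IHN [RHS]big_ord_recr/= subSnn big_ord1.
rewrite [X in _ + X]big_ord_recr/= subnn addrA -big_split/=; congr (_ + _).
by apply: eq_bigr => i _; rewrite subSn ?big_ord_recr// ltnW.
Qed.

(** The difference is the sum over the pairs of indices below [N] with [i + j >= N]. There are at
    most [N * N] of them, and each term is bounded by [A * B / 8 ^+ N]. *)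
Lemma cauchy_error A B a b N : rapid A a -> rapid B b ->
  `|(\sum_(i < N) a i) * (\sum_(i < N) b i) - \sum_(m < N) \sum_(i < m.+1) a i * b (m - i)%N|
  <= (A * B / 2 ^+ N)%:C.
Proof.
move=> aA bB; have A0 := rapid_ge0 aA; have B0 := rapid_ge0 bB.
rewrite cauchy_triangle mulr_suml -sumrB.
apply: (@le_trans _ _ (\sum_(i < N) (N%:R * (A * B / 8 ^+ N))%:C)); last first.
  rewrite sumr_const card_ord -rmorphMn lecR -mulr_natl expr8 !invfM.
  have h : N%:R * (N%:R * (2 ^+ N)^-1 * (2 ^+ N)^-1) <= 1 :> R.
    have e0 : 0 < (2 : R) ^+ N by rewrite exprn_gt0.
    rewrite mulrA mulrA -mulrA -invfM ler_pdivrMr ?mulr_gt0// mul1r.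
    by apply: ler_pM => //; exact: natr_le_expr2.
  have -> : N%:R * (N%:R * (A * B * ((2 ^+ N)^-1 * ((2 ^+ N)^-1 / 2 ^+ N)))) =
      A * B * (2 ^+ N)^-1 * (N%:R * (N%:R * (2 ^+ N)^-1 * (2 ^+ N)^-1)) :> R by ring.
  by rewrite ler_piMr// !mulr_ge0// invr_ge0 exprn_ge0.
apply: le_trans (ler_norm_sum _ _ _) _; apply: ler_sum => i _.
have iN := ltnW (ltn_ord i).
rewrite -(big_mkord xpredT (fun j => b j)) (big_cat_nat (leq0n _) (leq_subr i N))/=.
rewrite mulrDr -mulr_sumr big_mkord addrAC subrr add0r mulr_sumr.
apply: le_trans (ler_norm_sum _ _ _) _.
apply: (@le_trans _ _ (\sum_(N - i <= j < N) (A * B / 8 ^+ N)%:C)); last first.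
  rewrite sumr_const_nat -rmorphMn lecR -mulr_natl ler_wpM2r ?divr_ge0 ?mulr_ge0 ?exprn_ge0//.
  by rewrite ler_nat leq_subr.
rewrite big_nat_cond [X in _ <= X]big_nat_cond; apply: ler_sum => j.
rewrite andbT => /andP[Nj _]; rewrite normrM.
apply: le_trans (ler_pM _ _ (aA i) (bB j)) _ => //.
rewrite -rmorphM lecR mulrACA ler_wpM2l ?mulr_ge0// -invfM -exprD.
rewrite lef_pV2 ?posrE ?exprn_gt0// ler_weXn2l ?ler1n//.
by rewrite -leq_subLR.
Qed.

Lemma cauchy_product A B a b : rapid A a -> rapid B b ->
  has_csum (fun N => \sum_(i < N.+1) a i * b (N - i)%N) (csum a * csum b).
Proof.
move=> aA bB.
have /has_csumP[a1 a2] := cgeo_has_csum (rapid_cgeo aA).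
have /has_csumP[b1 b2] := cgeo_has_csum (rapid_cgeo bB).
pose e N := (\sum_(i < N) a i) * (\sum_(i < N) b i) - \sum_(m < N) \sum_(i < m.+1) a i * b (m - i)%N.
have gE : geometric (A * B) (1 / 2) = (fun N => A * B / 2 ^+ N) :> (nat -> R).
  by apply/funext => N; rewrite /geometric /= div1r exprVn.
have g0 : A * B / 2 ^+ N @[N --> \oo] --> (0 : R).
  rewrite -gE; apply: cvg_geometric.
  by rewrite ger0_norm ?divr_ge0// ltr_pdivrMr// mul1r ltr1n.
have e0 (f : C -> R) : (forall x, `|f x|%:C <= `|x|) -> f (e N) @[N --> \oo] --> (0 : R).
  move=> fle; apply/norm_cvg0P.
  apply: (@squeeze_cvgr _ _ _ _ (fun=> 0) (fun N => A * B / 2 ^+ N)) => //; last exact: cvg_cst.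
  apply: nearW => N; rewrite normr_ge0 -lecR /=.
  exact: le_trans (fle _) (cauchy_error N aA bB).
apply/has_csumP; split.
  have -> : (fun N => complex.Re (\sum_(m < N) \sum_(i < m.+1) a i * b (m - i)%N)) =
    (fun N => complex.Re (\sum_(i < N) a i) * complex.Re (\sum_(i < N) b i)
     - complex.Im (\sum_(i < N) a i) * complex.Im (\sum_(i < N) b i) - complex.Re (e N)).
    by apply/funext => N; rewrite /e cReD cReN -cReM opprB addrC subrK.
  rewrite cReM -[X in _ --> X]subr0; apply: cvgB; last exact: e0 (@normc_ge_Re _).
  by apply: cvgB; apply: cvgM.
have -> : (fun N => complex.Im (\sum_(m < N) \sum_(i < m.+1) a i * b (m - i)%N)) =
    (fun N => complex.Re (\sum_(i < N) a i) * complex.Im (\sum_(i < N) b i)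
     + complex.Im (\sum_(i < N) a i) * complex.Re (\sum_(i < N) b i) - complex.Im (e N)).
  by apply/funext => N; rewrite /e cImD cImN -cImM opprB addrC subrK.
rewrite cImM -[X in _ --> X]subr0; apply: cvgB; last exact: e0 (@normc_ge_Im _).
by apply: cvgD; apply: cvgM.
Qed.

End CauchyProduct.

(** * Polynomial coefficients by averaging over roots of unity *)

Section CauchyCoefficient.
Variable R : realType.
Local Notation C := R[i].

(** In characteristic zero X^m - 1 is separable, so it has [m] distinct complex roots, and a full
    set of m-th roots of unity contains a primitive one. *)
Lemma prim_root_exists (m : nat) : (0 < m)%N -> {z : C | m.-primitive_root z}.
Proof.
move=> m0; apply/sigW; pose p : {poly C} := 'X^m - 1.
have [r def_p] := closed_field_poly_normal p.
have size_p : size p = m.+1 by rewrite size_XnsubC.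
rewrite (monicP (monicXnsubC _ m0)) scale1r in def_p.
have r_un : all m.-unity_root r.
  by apply/allP => z; rewrite -root_prod_XsubC -def_p.
have sr : (m <= size r)%N.
  by rewrite -ltnS -(size_prod_XsubC r id) -def_p size_p.
have [|z] := hasP (has_prim_root m0 r_un _ sr); last by exists z.
by rewrite -separable_prod_XsubC -def_p separable_Xn_sub_1 // pnatr_eq0 -lt0n.
Qed.

Definition zeta (m : nat) : C := if m is m'.+1 then sval (prim_root_exists (ltn0Sn m')) else 1.

Lemma zetaP m : m.+1.-primitive_root (zeta m.+1).
Proof. by rewrite /zeta; case: prim_root_exists. Qed.

Lemma norm_zeta m k : `|zeta m.+1 ^+ k| = 1.
Proof.
have : `|zeta m.+1| ^+ m.+1 = 1 by rewrite -normrX (prim_expr_order (zetaP m)) normr1.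
by rewrite normrX => /eqP; rewrite pexpr_eq1// => /eqP ->; rewrite expr1n.
Qed.

(** A discrete Cauchy integral. It bounds a coefficient by the maximum on the unit circle, and it is
    a finite linear combination of values, with no limit involved. *)
Definition cauchy_coef (m : nat) (f : C -> C) (j : nat) : C :=
  m%:R^-1 * \sum_(k < m) (zeta m ^+ (k * j))^-1 * f (zeta m ^+ k).

Lemma sum_zeta m i j : (i < m.+1)%N -> (j < m.+1)%N ->
  \sum_(k < m.+1) (zeta m.+1 ^+ (k * j))^-1 * zeta m.+1 ^+ (k * i) = (i == j)%:R * m.+1%:R.
Proof.
move=> im jm; have zP := zetaP m; set z := zeta m.+1 in zP *.
have z0 : z != 0.
  apply/eqP => z0; have := prim_expr_order zP; rewrite z0 expr0n => /esym/eqP.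
  by rewrite oner_eq0.
have -> : \sum_(k < m.+1) (z ^+ (k * j))^-1 * z ^+ (k * i)
    = \sum_(k < m.+1) (z ^+ i / z ^+ j) ^+ k.
  by apply: eq_bigr => k _; rewrite exprMn exprVn mulrC -!exprM ![(k * _)%N]mulnC.
have [->|nij] := eqVneq i j.
  rewrite divff ?expf_neq0// mul1r; under eq_bigr do rewrite expr1n.
  by rewrite sumr_const card_ord.
set w := z ^+ i / z ^+ j; have w1 : w != 1.
  apply: contra nij => /eqP w1; have : z ^+ i == z ^+ j.
    by apply/eqP; rewrite -[LHS](@divfK _ (z ^+ j)) ?expf_neq0// -/w w1 mul1r.
  by rewrite (eq_prim_root_expr zP) !modn_small.
rewrite mul0r; have : (w - 1) * \sum_(k < m.+1) w ^+ k = 0.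
  by rewrite -subrX1 /w exprMn exprVn -!exprM ![(_ * m.+1)%N]mulnC !exprM
    (prim_expr_order zP) !expr1n invr1 mulr1 subrr.
by move/eqP; rewrite mulf_eq0 subr_eq0 (negPf w1) => /eqP.
Qed.

(** With more roots of unity than the degree, distinct exponents are orthogonal, so no other
    coefficient is mixed in. *)
Lemma cauchy_coefE m (p : {poly C}) j : (size p <= m.+1)%N -> (j < m.+1)%N ->
  cauchy_coef m.+1 (fun x => p.[x]) j = p`_j.
Proof.
move=> sp jm; rewrite /cauchy_coef.
under eq_bigr do rewrite (horner_coef_wide _ sp) mulr_sumr.
rewrite exchange_big/=.
have -> : \sum_(i < m.+1) \sum_(k < m.+1)
    (zeta m.+1 ^+ (k * j))^-1 * (p`_i * (zeta m.+1 ^+ k) ^+ i)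
  = \sum_(i < m.+1) p`_i * (((i : nat) == j)%:R * m.+1%:R).
  apply: eq_bigr => i _; rewrite -(sum_zeta (ltn_ord i) jm) mulr_sumr.
  by apply: eq_bigr => k _; rewrite mulrCA -exprM.
rewrite (bigD1 (Ordinal jm))//= eqxx mul1r big1 ?addr0 => [|i /eqP ij].
  by rewrite mulrCA mulVf ?mulr1// pnatr_eq0.
have /negPf -> : (i : nat) != j by apply/eqP => e; apply: ij; apply/val_inj.
by rewrite mul0r mulr0.
Qed.

Lemma cauchy_coef_le m f j (M : C) : (forall x, `|x| = 1 -> `|f x| <= M) ->
  `|cauchy_coef m.+1 f j| <= M.
Proof.
move=> fM; rewrite /cauchy_coef normrM.
have -> : `|m.+1%:R^-1 : C| = m.+1%:R^-1 by rewrite ger0_norm// invr_ge0.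
rewrite ler_pdivrMl ?ltr0n//; apply: le_trans (ler_norm_sum _ _ _) _.
rewrite mulr_natl -[X in _ *+ X](card_ord m.+1) -sumr_const; apply: ler_sum => k _.
by rewrite normrM normfV norm_zeta invr1 mul1r fM// norm_zeta.
Qed.

(** Cauchy's estimate bounds each coefficient by [M]. For [|e| <= 1] the powers of [e] are dominated
    by the first, respectively the second one, and at most [N] terms remain. *)
Lemma poly_taylor1 N (p : {poly C}) (M e : C) : (size p <= N.+1)%N ->
  (forall x, `|x| = 1 -> `|p.[x]| <= M) -> `|e| <= 1 ->
  `|p.[e] - p.[0]| <= `|e| * (N%:R * M) /\
  `|p.[e] - p.[0] - e * p`_1| <= `|e| ^+ 2 * (N%:R * M).
Proof.
move=> sp pM e1.
have cM j : (j < N.+1)%N -> `|p`_j| <= M.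
  by move=> jN; rewrite -(cauchy_coefE sp jN); exact: cauchy_coef_le.
have M0 : 0 <= M by apply: le_trans (cM 0%N _).
have pe : p.[e] - p.[0] = \sum_(i < N) p`_i.+1 * e ^+ i.+1.
  rewrite (horner_coef_wide _ sp) horner_coef0 big_ord_recl/= expr0 mulr1.
  by rewrite addrC addKr.
have le1 i : `|e| ^+ i.+1 <= `|e|.
  by rewrite exprS ler_piMr// exprn_ile1.
split.
  rewrite pe; apply: le_trans (ler_norm_sum _ _ _) _.
  rewrite mulrCA mulr_natl -[X in _ *+ X](card_ord N) -sumr_const; apply: ler_sum => i _.
  by rewrite normrM normrX mulrC; apply: ler_pM => //; apply: cM; rewrite ltnS.
case: N sp cM pe => [|N] sp cM pe.
  rewrite pe big_ord0 sub0r nth_default// mulr0 oppr0 normr0 mul0r mulr0//.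
rewrite pe big_ord_recl/= expr1 [p`_1 * e]mulrC addrAC subrr add0r.
apply: le_trans (ler_norm_sum _ _ _) _.
apply: (@le_trans _ _ (\sum_(i < N) `|e| ^+ 2 * M)).
  apply: ler_sum => i _; rewrite normrM normrX mulrC; apply: ler_pM => //.
  - by rewrite /bump/= add1n exprS [leRHS]expr2 ler_wpM2l// le1.
  - by apply: cM; rewrite /bump/= add1n !ltnS.
rewrite sumr_const card_ord -[leLHS]mulr_natl [leLHS]mulrCA ler_wpM2l ?exprn_ge0//.
by rewrite ler_wpM2r// ler_nat.
Qed.

End CauchyCoefficient.

(** * Series of polynomials along an affine map *)

Section EntireSeries.
Variables (R : realType) (n : nat).
Local Notation TB := (TB R n).
Local Notation C := R[i].
Local Notation V := ('rV[C]_n * 'rV[C]_n)%type.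

Definition bnd (r : R) (v : V) : Prop :=
  forall i, `|v.1 0 i| <= r%:C /\ `|v.2 0 i| <= r%:C.

(** Polynomiality is asked on complex lines only: this is what Taylor estimates in one direction
    use, and it spares polynomials in several variables. *)
Definition linepoly N (f : V -> C) : Prop :=
  forall s d, exists2 p : {poly C}, (size p <= N.+1)%N & forall x, f (s + x *: d) = p.[x].

Definition adm (a : nat -> V -> C) : Prop :=
  (forall N, linepoly N (a N)) /\
  forall r, exists B, forall s, bnd r s -> rapid B (fun N => a N s).

(** The linear coefficient along [d], as an average over [N.+2] roots of unity: one more than degree
    [N] requires, so that index 1 is in range also for [N = 0]. As an average of translates it
    inherits polynomiality on lines and bounds on polydiscs. *)
Definition ddc (d : V) (a : nat -> V -> C) (N : nat) (s : V) : C :=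
  cauchy_coef N.+2 (fun x => a N (s + x *: d)) 1.

Lemma bndD r s d (x : C) : bnd r s -> bnd 1 d -> `|x| <= 1 -> bnd (r + 1) (s + x *: d).
Proof.
move=> rs rd x1 i; have [s1 s2] := rs i; have [d1 d2] := rd i; rewrite /= !mxE rmorphD.
split; apply: le_trans (ler_normD _ _) _; rewrite lerD// normrM.
  by rewrite -[leRHS]mulr1; apply: ler_pM.
by rewrite -[leRHS]mulr1; apply: ler_pM.
Qed.

Lemma ddcE d a N s (p : {poly C}) : (size p <= N.+1)%N ->
  (forall x, a N (s + x *: d) = p.[x]) -> ddc d a N s = p`_1.
Proof.
move=> sp ap; rewrite /ddc; have -> : (fun x => a N (s + x *: d)) = (fun x => p.[x]).
  by apply/funext => x; rewrite ap.
by rewrite cauchy_coefE// (leq_trans sp).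
Qed.

Lemma adm_ddc d a : bnd 1 d -> adm a -> adm (ddc d a).
Proof.
move=> d1 [alp ab]; split=> [N s e|r].
  have /choice[p hp] : forall k : 'I_N.+2, exists p : {poly C}, (size p <= N.+1)%N /\
      forall x, a N (s + zeta R N.+2 ^+ k *: d + x *: e) = p.[x].
    by move=> k; have [p ? ?] := alp N (s + zeta R N.+2 ^+ k *: d) e; exists p.
  exists (N.+2%:R^-1 *: \sum_(k < N.+2) (zeta R N.+2 ^+ (k * 1))^-1 *: p k).
    apply: leq_trans (size_scale_leq _ _) _; apply: leq_trans (size_sum _ _ _) _.
    by apply/bigmax_leqP => k _; apply: leq_trans (size_scale_leq _ _) (hp k).1.
  move=> x; rewrite /ddc /cauchy_coef hornerZ horner_sum; congr (_ * _).
  by apply: eq_bigr => k _; rewrite hornerZ -(hp k).2 addrAC.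
have [B aB] := ab (r + 1); exists B => s rs N; apply: cauchy_coef_le => x x1.
by apply: aB; apply: bndD => //; rewrite x1.
Qed.

Variables (tt L : TB -> V).
Hypothesis tt_aff : forall (h : R) w p, tt (h *: w + p) = tt p + h%:C *: L w.
Hypothesis L_bnd : forall w, `|w| <= 1 -> bnd 1 (L w).
Hypothesis tt_bnd : forall p, exists r, bnd r (tt p).

Definition fsum (a : nat -> V -> C) (p : TB) : C := csum (fun N => a N (tt p)).

Lemma adm_has_csum a p : adm a -> has_csum (fun N => a N (tt p)) (fsum a p).
Proof.
move=> [_ ab]; have [r rp] := tt_bnd p; have [B aB] := ab r.
exact: cgeo_has_csum (rapid_cgeo (aB _ rp)).
Qed.

Lemma geo_scale (M B : R) N : 0 <= B -> M * (N%:R * (B / 8 ^+ N)) <= M * B / 2 ^+ N \/ M < 0.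
Proof.
move=> B0; have [M0|M0] := leP 0 M; [left|by right].
rewrite -mulrA ler_wpM2l// mulrCA ler_wpM2l// expr8 !invfM.
have e0 : 0 < (2 : R) ^+ N by rewrite exprn_gt0.
rewrite mulrCA -[leRHS]mulr1 ler_wpM2l ?invr_ge0 ?(ltW e0)//.
rewrite mulrA -[leRHS](@mulfV _ (2 ^+ N)) ?gt_eqF//.
rewrite ler_wpM2r ?invr_ge0 ?(ltW e0)// ler_pdivrMr//.
apply: le_trans (natr_le_expr2 R N) _.
by rewrite ler_peMr ?(ltW e0)// exprn_ege1// ler1n.
Qed.

(** The Taylor estimates in one variable are applied to each term and summed; the number [N] of
    coefficients is absorbed by passing from the rate 8 to the rate 2. The same [M] serves all
    directions in the unit ball, so that continuity and differentiability both follow. *)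
Lemma fsum_taylor a p : adm a -> exists2 M : R, 0 <= M & forall (e : R) w, `|e| <= 1 -> `|w| <= 1 ->
  forall f : C -> R, f = @complex.Re R \/ f = @complex.Im R ->
  `|f (fsum a (e *: w + p) - fsum a p)| <= `|e| * M /\
  `|f (fsum a (e *: w + p) - fsum a p - e%:C * fsum (ddc (L w) a) p)| <= `|e| ^+ 2 * M.
Proof.
move=> aa; have [alp ab] := aa; have [r rp] := tt_bnd p; have [B aB] := ab (r + 1).
have B0 : 0 <= B.
  apply: (@rapid_ge0 _ _ (fun N => a N (tt p))); apply: aB => i.
  by have [h1 h2] := rp i; split; apply: le_trans (_ : r%:C <= _) => //; rewrite lecR lerDl.
exists (B * 2); first by rewrite mulr_ge0.
move=> e w e1 w1 f fRI; have Lw := L_bnd w1.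
have nE : `|e%:C| = `|e|%:C by rewrite normc_def /= expr0n/= addr0 sqrtr_sqr.
have key N : `|a N (tt (e *: w + p)) - a N (tt p)| <= (`|e| * B / 2 ^+ N)%:C /\
   `|a N (tt (e *: w + p)) - a N (tt p) - e%:C * ddc (L w) a N (tt p)| <= (`|e| ^+ 2 * B / 2 ^+ N)%:C.
  have [q sq aq] := alp N (tt p) (L w).
  have q0 : a N (tt p) = q.[0] by rewrite -aq scale0r addr0.
  rewrite (ddcE sq aq) tt_aff aq q0.
  have qb x : `|x| = 1 -> `|q.[x]| <= (B / 8 ^+ N)%:C.
    by move=> x1; rewrite -aq; apply: aB; apply: bndD => //; rewrite x1.
  have e1C : `|e%:C| <= 1 by rewrite nE lecR.
  have [h1 h2] := poly_taylor1 sq qb e1C.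
  have NC : (N%:R : C) = (N%:R : R)%:C by rewrite rmorph_nat.
  split.
    apply: (le_trans h1); rewrite nE NC -!rmorphM lecR.
    by have [//|] := geo_scale `|e| N B0; rewrite ltNge normr_ge0.
  apply: (le_trans h2); rewrite nE NC -rmorphXn -!rmorphM lecR.
  by have [//|] := geo_scale (`|e| ^+ 2) N B0; rewrite ltNge exprn_ge0.
have hm := has_csumZ (-1) (adm_has_csum p aa).
have h1 := has_csumD (adm_has_csum (e *: w + p) aa) hm.
have h2 := has_csumD h1 (has_csumZ (- e%:C) (adm_has_csum p (adm_ddc Lw aa))).
have E1 : csum (fun N => a N (tt (e *: w + p)) - a N (tt p)) = fsum a (e *: w + p) - fsum a p.
  rewrite -mulN1r -(has_csum_eq h1); apply: eq_csum => N; by rewrite mulN1r.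
have E2 : csum (fun N => a N (tt (e *: w + p)) - a N (tt p) - e%:C * ddc (L w) a N (tt p))
   = fsum a (e *: w + p) - fsum a p - e%:C * fsum (ddc (L w) a) p.
  rewrite -mulNr -(mulN1r (fsum a p)) -(has_csum_eq h2); apply: eq_csum => N.
  by rewrite mulN1r mulNr.
have g1 : cgeo (`|e| * B) (fun N => a N (tt (e *: w + p)) - a N (tt p)) by move=> N; case: (key N).
have g2 : cgeo (`|e| ^+ 2 * B) (fun N => a N (tt (e *: w + p)) - a N (tt p) - e%:C * ddc (L w) a N (tt p)).
  by move=> N; case: (key N).
rewrite -E2 -E1 !mulrA; case: fRI => ->; split.
- exact: geo_le (cgeo_Re g1).
- exact: geo_le (cgeo_Re g2).
- exact: geo_le (cgeo_Im g1).
- exact: geo_le (cgeo_Im g2).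
Qed.

Lemma fsum_continuous a (f : C -> R) : adm a -> f = @complex.Re R \/ f = @complex.Im R ->
  continuous (fun p => f (fsum a p)).
Proof.
move=> aa fRI p; have [M M0 TM] := fsum_taylor p aa.
have fB x y : f (x - y) = f x - f y.
  by case: fRI => ->; rewrite ?cReD ?cReN ?cImD ?cImN.
apply/cvgrPdist_le => eps eps0.
have d0 : 0 < Num.min 1 (eps / (M + 1)) by rewrite lt_min ltr01 divr_gt0// ltr_wpDl.
have nb : \forall q \near p, `|p - q| < Num.min 1 (eps / (M + 1)).
  by apply/nbhs_normP; exists (Num.min 1 (eps / (M + 1))).
near=> q; have : `|p - q| < Num.min 1 (eps / (M + 1)) by near: q.
rewrite lt_min => /andP[pq1 pqe].
pose e := `|q - p|; have e1 : `|e| <= 1 by rewrite normr_id distrC ltW.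
have [qp|nqp] := eqVneq q p; first by rewrite qp subrr normr0 ltW.
have e0 : 0 < e by rewrite normr_gt0 subr_eq0.
have w1 : `|e^-1 *: (q - p)| <= 1.
  by rewrite normrZ normfV normr_id mulVf// gt_eqF.
have qE : q = e *: (e^-1 *: (q - p)) + p by rewrite scalerA divff ?gt_eqF// scale1r subrK.
have [h _] := TM e _ e1 w1 f fRI.
rewrite distrC {1}qE -fB; apply: le_trans h _; rewrite normr_id -/e.
apply: (@le_trans _ _ (e * (M + 1))); first by rewrite ler_wpM2l ?lerDl// ltW.
by rewrite -ler_pdivlMr ?ltr_wpDl// ltW// /e distrC.
Unshelve. all: by end_near. Qed.

Lemma fsum_is_derive a (f : C -> R) p w : adm a -> f = @complex.Re R \/ f = @complex.Im R ->
  `|w| <= 1 -> is_derive p w (fun p => f (fsum a p)) (f (fsum (ddc (L w) a) p)).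
Proof.
move=> aa fRI w1; have [M M0 TM] := fsum_taylor p aa.
have fB x y : f (x - y) = f x - f y.
  by case: fRI => ->; rewrite ?cReD ?cReN ?cImD ?cImN.
have fZ (h : R) x : f (h%:C * x) = h * f x.
  by case: fRI => ->; rewrite ?cReM ?cImM /= mul0r ?subr0 ?addr0.
have lim : h^-1 *: (f (fsum a (h *: w + p)) - f (fsum a p)) @[h --> 0^'] --> f (fsum (ddc (L w) a) p).
  apply/cvgrPdist_le => eps eps0; near=> h.
  have h0 : h != 0 by near: h; exact: nbhs_dnbhs_neq.
  have h1 : `|h| <= 1 by near: h; apply: dnbhs0_le.
  have hM : `|h| <= eps / (M + 1).
    by near: h; apply: dnbhs0_le; rewrite divr_gt0// ltr_wpDl.
  have [_ H] := TM h w h1 w1 f fRI.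
  rewrite !fB fZ in H.
  have -> : f (fsum (ddc (L w) a) p) - h^-1 *: (f (fsum a (h *: w + p)) - f (fsum a p)) =
     - h^-1 * (f (fsum a (h *: w + p)) - f (fsum a p) - h * f (fsum (ddc (L w) a) p)).
    by rewrite /GRing.scale/=; field.
  rewrite normrM normrN normfV; rewrite ler_pdivrMl ?normr_gt0//.
  apply: le_trans H _; rewrite expr2 -mulrA ler_wpM2l//.
  apply: (@le_trans _ _ (`|h| * (M + 1))); first by rewrite ler_wpM2l ?lerDl.
  by rewrite -ler_pdivlMr ?ltr_wpDl.
apply: DeriveDef; first by apply/cvg_ex; eexists; exact: lim.
exact/cvg_lim.
Unshelve. all: by end_near. Qed.

Lemma norm_dirv_le1 c : `|dirv R c : TB| <= 1.
Proof.
have dl (i : 'I_n) : mx_norm (delta_mx 0 i : 'rV[R]_n) <= 1.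
  have [->//|/mx_norm_neq0[j ->]] := eqVneq (mx_norm (delta_mx 0 i : 'rV[R]_n)) 0.
  by rewrite mxE; case: (_ && _); rewrite /= ?normr1 ?normr0.
by case: c => i; rewrite /dirv prod_normE ge_max/= normr0 ler01 ?andbT/=; exact: dl.
Qed.

Lemma rsm_fsum k a (f : C -> R) W : adm a -> f = @complex.Re R \/ f = @complex.Im R ->
  rsm k W (fun p => f (fsum a p)).
Proof.
elim: k a => [|k IHk] a aa fRI /=; first by move=> p _; exact: fsum_continuous.
split=> [p _|c].
  split=> [|c]; first exact: fsum_continuous.
  by have [] := fsum_is_derive p aa fRI (norm_dirv_le1 c).
have -> : rpartial c (fun p => f (fsum a p)) = (fun p => f (fsum (ddc (L (dirv R c)) a) p)).
  by apply/funext => p; have [_ E] := fsum_is_derive p aa fRI (norm_dirv_le1 c); exact: E.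
by apply: IHk => //; apply: adm_ddc => //; apply: L_bnd; exact: norm_dirv_le1.
Qed.

Lemma csmooth_fsum a W : adm a -> csmooth W (fsum a).
Proof.
by move=> aa; split; apply/rsmoothP => k; apply: rsm_fsum => //; [left|right].
Qed.

Lemma cpartial_fsum c a p : adm a -> cpartial c (fsum a) p = fsum (ddc (L (dirv R c)) a) p.
Proof.
move=> aa; apply: ReIm_eq.
  by have [_ E] := fsum_is_derive p aa (or_introl erefl) (norm_dirv_le1 c); exact: E.
by have [_ E] := fsum_is_derive p aa (or_intror erefl) (norm_dirv_le1 c); exact: E.
Qed.

End EntireSeries.

(** * Exterior algebra on coefficient functions *)

Section ExteriorSigns.
Variables (R : realType) (n : nat).
Local Notation C := R[i].
Local Notation wsgn := (wsgn R).
Implicit Types (J K L : {set 'I_n}) (i j : 'I_n) (x y z : {set 'I_n} -> C).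
Local Open Scope set_scope.

Definition osgn i j : C := if (j < i)%N then -1 else 1.

(** As a product over pairs the sign is multiplicative in both arguments, which turns identities
    between signs into splittings of products over disjoint unions. *)
Lemma wsgnE J K : wsgn J K =
  if (fintype.disjoint (mem J) (mem K)) then \prod_(j in J) \prod_(k in K) osgn j k else 0.
Proof.
rewrite /wsgn; case: ifP => // _.
rewrite pair_big_dep /= -prodr_const.
rewrite [RHS](bigID (fun jk : 'I_n * 'I_n => (jk.2 < jk.1)%N))/=.
rewrite [X in _ = _ * X]big1 ?mulr1 => [|jk /andP[_ /negPf h]]; last by rewrite /osgn h.
apply: eq_big => [jk|jk]; first by rewrite !inE.
by rewrite !inE => /andP[_ h]; rewrite /osgn h.
Qed.

Lemma wsgn0l K : wsgn finset.set0 K = 1.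
Proof.
by rewrite wsgnE -finset.setI_eq0 finset.set0I eqxx big_pred0// => i; rewrite inE.
Qed.

Lemma wsgn0r J : wsgn J finset.set0 = 1.
Proof.
rewrite wsgnE -finset.setI_eq0 finset.setI0 eqxx big1// => i _.
by rewrite big_pred0// => j; rewrite inE.
Qed.

Lemma wsgn_neq0 J K : wsgn J K != 0 -> (fintype.disjoint (mem J) (mem K)).
Proof. by rewrite wsgnE; case: ifP => //; rewrite eqxx. Qed.

Lemma prod_setU (J K : {set 'I_n}) (F : 'I_n -> C) : fintype.disjoint (mem J) (mem K) ->
  \prod_(i in J :|: K) F i = (\prod_(i in J) F i) * \prod_(i in K) F i.
Proof.
by move=> d; rewrite -bigU//; apply: eq_bigl => i; rewrite !inE.
Qed.

(** Associativity at the level of signs: for pairwise disjoint sets both sides are the product over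
    all pairs from [J] and [K], [J] and [L], [K] and [L]; otherwise both vanish. *)
Lemma wsgn_cocycle J K L :
  wsgn J K * wsgn (J :|: K) L = wsgn J (K :|: L) * wsgn K L.
Proof.
rewrite !wsgnE.
rewrite -!finset.setI_eq0 !finset.setIUr !finset.setIUl !finset.setU_eq0.
case: (boolP (J :&: K == finset.set0)) => [JK|_]; last by rewrite !mul0r.
case: (boolP (J :&: L == finset.set0)) => [JL|_]; last by rewrite mulr0 mul0r.
case: (boolP (K :&: L == finset.set0)) => [KL|_]; last by rewrite !mulr0.
have dJK : fintype.disjoint (mem J) (mem K) by rewrite -finset.setI_eq0.
have dKL : fintype.disjoint (mem K) (mem L) by rewrite -finset.setI_eq0.
rewrite (prod_setU _ dJK)/= mulrA; congr (_ * _).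
rewrite -big_split; apply: eq_bigr => j _ /=.
by rewrite (prod_setU _ dKL).
Qed.

Definition sg i J : C := wsgn [set i] J.

Lemma sgE i J : sg i J = if i \in J then 0 else \prod_(k in J) osgn i k.
Proof. by rewrite /sg wsgnE finset.disjoints1 big_set1; case: (i \in J). Qed.

Lemma osgn_anti i j : i != j -> osgn i j = - osgn j i.
Proof.
rewrite /osgn -val_eqE /= => ij; case: (ltngtP i j) ij => //; rewrite ?opprK //.
Qed.

Lemma osgn_sq i j : osgn i j * osgn i j = 1.
Proof. by rewrite /osgn; case: ifP => _; rewrite ?mulrNN mulr1. Qed.

Lemma sgU i j J : i != j -> j \notin J -> sg i (j |: J) = osgn i j * sg i J.
Proof.
move=> ij jJ; rewrite !sgE finset.in_setU1 (negPf ij) /=; case: ifP; first by rewrite mulr0.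
by move=> _; rewrite big_setU1.
Qed.

Lemma sg_sq i J : i \notin J -> sg i J * sg i J = 1.
Proof.
move=> iJ; rewrite sgE (negPf iJ) -big_split big1// => k _; exact: osgn_sq.
Qed.

(** [Eop i] is left exterior multiplication by the i-th generator and [Iop i] the contraction with
    it, acting on coefficients. They serve for the dx_i as well as for the e_i. *)
Definition Eop i x : {set 'I_n} -> C :=
  fun J => if i \in J then sg i (J :\ i) * x (J :\ i) else 0.
Definition Iop i x : {set 'I_n} -> C :=
  fun J => if i \in J then 0 else sg i J * x (i |: J).

Lemma Eop_anti i j x J : Eop i (Eop j x) J = - Eop j (Eop i x) J.
Proof.
have [->|ij] := eqVneq i j.
  by rewrite /Eop finset.setD11 mulr0 if_same oppr0.
rewrite /Eop !finset.in_setD1 ij eq_sym ij /=.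
case iJ: (i \in J); last by case: (j \in J); rewrite ?mulr0 oppr0.
case jJ: (j \in J); last by rewrite mulr0 oppr0.
have -> : J :\ j :\ i = J :\ i :\ j by apply/finset.setP => k; rewrite !inE andbCA.
set K := J :\ i :\ j.
have -> : J :\ i = j |: K by rewrite finset.setD1K// !inE jJ eq_sym ij.
have -> : J :\ j = i |: K.
  have -> : K = J :\ j :\ i by apply/finset.setP => k; rewrite !inE andbCA.
  by rewrite finset.setD1K// !inE iJ ij.
have jK : j \notin K by rewrite !inE eqxx.
have iK : i \notin K by rewrite !inE eqxx andbF.
have ji : j != i by rewrite eq_sym.
rewrite (sgU ij jK) (sgU ji iK).
rewrite (osgn_anti ij); ring.
Qed.

(** The canonical anticommutation relation. For [i = j] exactly one summand applies, depending on
    whether [i] lies in [J], and its signs square to one; for distinct indices the two orders differ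
    by the antisymmetric sign [osgn]. *)
Lemma Clifford i j x J : Iop i (Eop j x) J + Eop j (Iop i x) J = (i == j)%:R * x J.
Proof.
rewrite /Iop /Eop; have [<-|ij] := eqVneq i j.
  rewrite mul1r; case: (boolP (i \in J)) => iJ.
    by rewrite add0r !inE eqxx /= finset.setD1K// mulrA sg_sq ?mul1r// !inE eqxx.
  by rewrite addr0 !inE eqxx /= finset.setU1K// mulrA sg_sq ?mul1r.
rewrite mul0r !inE (negPf ij) eq_sym (negPf ij) /=.
case: (boolP (i \in J)) => iJ; first by rewrite mulr0 if_same addr0.
case: (boolP (j \in J)) => jJ; last by rewrite mulr0 addr0.
have jK : j \notin J :\ j by rewrite !inE eqxx.
have iK : i \notin J :\ j by rewrite !inE negb_and iJ orbT.
have E : (i |: J) :\ j = i |: (J :\ j).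
  by apply/finset.setP => k; rewrite !inE; case: eqP => // ->; rewrite eq_sym (negPf ij).
have ji : j != i by rewrite eq_sym.
have -> : sg i J = osgn i j * sg i (J :\ j) by rewrite -(sgU ij jK) finset.setD1K.
rewrite E (sgU ji iK) (osgn_anti ij).
transitivity ((1 - osgn j i * osgn j i) * (sg i (J :\ j) * sg j (J :\ j) * x (i |: J :\ j))).
  by ring.
by rewrite osgn_sq subrr mul0r.
Qed.

Definition gs x : {set 'I_n} -> C := fun J => (-1) ^+ #|J| * x J.

Lemma gsK x : gs (gs x) =1 x.
Proof. by move=> J; rewrite /gs mulrA -expr2 sqrr_sign mul1r. Qed.

Lemma Eop_gs i x J : Eop i (gs x) J = - gs (Eop i x) J.
Proof.
rewrite /Eop /gs; case: ifP => iJ; last by rewrite mulr0 oppr0.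
by rewrite (cardsD1 i J) iJ exprS; ring.
Qed.

(** Summing over all pairs with union [L], where [wsgn] kills overlapping pairs, treats the two
    factors symmetrically. Triple products become sums over triples, to which [wsgn_cocycle]
    applies; [mulwE] recovers the sum over subsets used in [wedge]. *)
Definition mulw x y : {set 'I_n} -> C :=
  fun L => \sum_J \sum_(K | J :|: K == L) wsgn J K * x J * y K.

Lemma mulwE x y L : mulw x y L =
  \sum_(J : {set 'I_n} | J \subset L) wsgn J (L :\: J) * x J * y (L :\: J).
Proof.
rewrite /mulw [RHS]big_mkcond; apply: eq_bigr => J _.
case: ifP => [JL|nJL]; last first.
  by rewrite big_pred0// => K; apply/eqP => e; rewrite -e finset.subsetUl in nJL.
have JU : J :|: (L :\: J) == L.
  by apply/eqP/finset.setP => k; rewrite !inE; case kJ: (k \in J) => //=; rewrite (fintype.subsetP JL).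
rewrite (bigD1 (L :\: J))//= big1 ?addr0// => K /andP[/eqP e nK].
have -> : wsgn J K = 0; last by rewrite !mul0r.
apply: contraNeq nK => /wsgn_neq0 d; rewrite -e finset.setDUl finset.setDv finset.set0U.
by rewrite eq_sym; apply/eqP/finset.setDidPl; rewrite fintype.disjoint_sym.
Qed.

Lemma mulw_pair x y L : mulw x y L =
  \sum_J \sum_K (if J :|: K == L then wsgn J K * x J * y K else 0).
Proof. by apply: eq_bigr => J _; rewrite big_mkcond. Qed.

Lemma sum_delta (A : {set 'I_n}) (f : {set 'I_n} -> C) :
  \sum_P (if A == P then f P else 0) = f A.
Proof.
rewrite (bigD1 A)//= eqxx big1 ?addr0// => P /negPf; by rewrite eq_sym => ->.
Qed.

Lemma mulwA x y z L : mulw x (mulw y z) L = mulw (mulw x y) z L.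
Proof.
transitivity (\sum_J \sum_K \sum_M (if J :|: K :|: M == L then
    wsgn J (K :|: M) * wsgn K M * (x J * y K * z M) else 0)).
  rewrite mulw_pair; apply: eq_bigr => J _.
  transitivity (\sum_P \sum_K \sum_M (if K :|: M == P then
      (if J :|: P == L then wsgn J P * wsgn K M * (x J * y K * z M) else 0) else 0)).
    apply: eq_bigr => P _; rewrite mulw_pair; case: ifP => JP; last first.
      by rewrite big1// => K _; rewrite big1// => M _; case: ifP.
    rewrite mulr_sumr; apply: eq_bigr => K _; rewrite mulr_sumr; apply: eq_bigr => M _.
    by case: ifP => _; [ring|rewrite mulr0].
  rewrite exchange_big; apply: eq_bigr => K _; rewrite exchange_big; apply: eq_bigr => M _.
  refine (etrans (sum_delta (K :|: M) (fun P => if J :|: P == L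
    then wsgn J P * wsgn K M * (x J * y K * z M) else 0)) _).
  by rewrite finset.setUA.
transitivity (\sum_J \sum_K \sum_M (if J :|: K :|: M == L then
    wsgn J K * wsgn (J :|: K) M * (x J * y K * z M) else 0)).
  by do 3!(apply: eq_bigr => ? _); rewrite wsgn_cocycle.
rewrite mulw_pair.
have rot (f : {set 'I_n} -> {set 'I_n} -> {set 'I_n} -> C) :
    \sum_J \sum_K \sum_M f J K M = \sum_M \sum_J \sum_K f J K M.
  by under eq_bigr do rewrite exchange_big; rewrite exchange_big.
rewrite rot [RHS]exchange_big; apply: eq_bigr => M _ /=.
transitivity (\sum_P \sum_J \sum_K (if J :|: K == P then
      (if P :|: M == L then wsgn J K * wsgn P M * (x J * y K * z M) else 0) else 0)); last first.
  apply: eq_bigr => P _; rewrite mulw_pair; case: ifP => PM; last first.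
    by rewrite big1// => J _; rewrite big1// => K _; case: ifP.
  rewrite mulr_sumr mulr_suml; apply: eq_bigr => J _.
  rewrite mulr_sumr mulr_suml; apply: eq_bigr => K _.
  by case: ifP => _; [ring|rewrite mulr0 mul0r].
rewrite [RHS]exchange_big; apply: eq_bigr => J _ /=.
rewrite [RHS]exchange_big; apply: eq_bigr => K _ /=.
apply: esym; exact: (sum_delta (J :|: K) (fun P => if P :|: M == L
  then wsgn J K * wsgn P M * (x J * y K * z M) else 0)).
Qed.

Lemma mulwDl x x' y L : mulw (fun J => x J + x' J) y L = mulw x y L + mulw x' y L.
Proof. by rewrite !mulwE -big_split; apply: eq_bigr => J _ /=; ring. Qed.

Lemma mulwDr x y y' L : mulw x (fun J => y J + y' J) L = mulw x y L + mulw x y' L.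
Proof. by rewrite !mulwE -big_split; apply: eq_bigr => J _ /=; ring. Qed.

Lemma Eop_delta i x J : Eop i x J = mulw (fun K => (K == [set i])%:R) x J.
Proof.
rewrite mulwE big_mkcond (bigD1 [set i])//= eqxx mulr1 big1 ?addr0.
  by rewrite finset.sub1set /Eop /sg; case: ifP => //; rewrite mulr1.
by move=> K /negPf ->; rewrite mulr0 mul0r; case: ifP.
Qed.

Lemma Eop_mulwl i x y L : Eop i (mulw x y) L = mulw (Eop i x) y L.
Proof.
rewrite Eop_delta mulwA; congr mulw.
by apply/funext => J; rewrite Eop_delta.
Qed.

(** Moving the generator from between the factors to the front passes it over [x], which [gs] pays
    for. *)
Lemma Eop_mulwr i x y L : mulw (gs x) (Eop i y) L = mulw (Eop i x) y L.
Proof.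
have -> : Eop i y = mulw (fun K => (K == [set i])%:R) y.
  by apply/funext => J; rewrite Eop_delta.
rewrite mulwA; congr mulw; apply/funext => J.
rewrite /Eop mulwE big_mkcond.
case: ifP => iJ; last first.
  rewrite big1// => K _; case: ifP => // KJ.
  have -> : (J :\: K == [set i]) = false; last by rewrite mulr0.
  apply/negP => /eqP e; have : i \in J :\: K by rewrite e inE.
  by rewrite inE iJ andbF.
have iN : i \notin J :\ i by rewrite !inE eqxx.
have JE : J :\: (J :\ i) = [set i].
  by apply/finset.setP => k; rewrite !inE; case: eqP => [->|_] /=; rewrite ?iJ// andNb.
rewrite (bigD1 (J :\ i))//= finset.subD1set JE eqxx mulr1 big1 ?addr0 => [|K nK]; last first.
  case: ifP => // KJ; have -> : (J :\: K == [set i]) = false; last by rewrite mulr0.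
  apply: contraNF nK => /eqP e; apply/eqP/finset.setP => k.
  have : (k \in J :\: K) = (k \in [set i]) by rewrite e.
  rewrite !inE.
  case kK: (k \in K) => /= h; first by rewrite -h (fintype.subsetP KJ).
  by rewrite h; case: (k == i).
rewrite /gs mulrA; congr (_ * _).
rewrite sgE (negPf iN) wsgnE fintype.disjoint_sym.
have -> : fintype.disjoint (mem [set i]) (mem (J :\ i)) by rewrite finset.disjoints1.
under eq_bigr do rewrite big_set1.
rewrite -prodr_const -big_split; apply: eq_bigr => k; rewrite !inE => /andP[ki _] /=.
by rewrite (osgn_anti ki) mulrN1 opprK.
Qed.

Lemma mulwZl (c : C) x y L : mulw (fun J => c * x J) y L = c * mulw x y L.
Proof. by rewrite !mulwE mulr_sumr; apply: eq_bigr => J _; ring. Qed.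

Lemma mulwZr (c : C) x y L : mulw x (fun J => c * y J) L = c * mulw x y L.
Proof. by rewrite !mulwE mulr_sumr; apply: eq_bigr => J _; ring. Qed.

Lemma mulw_suml (T : Type) (r : seq T) (X : T -> {set 'I_n} -> C) y L :
  mulw (fun J => \sum_(i <- r) X i J) y L = \sum_(i <- r) mulw (X i) y L.
Proof.
rewrite mulwE; under [RHS]eq_bigr do rewrite mulwE.
rewrite exchange_big; apply: eq_bigr => J _.
by rewrite mulr_sumr mulr_suml.
Qed.

Lemma mulw_sumr (T : Type) (r : seq T) x (Y : T -> {set 'I_n} -> C) L :
  mulw x (fun J => \sum_(i <- r) Y i J) L = \sum_(i <- r) mulw x (Y i) L.
Proof.
rewrite mulwE; under [RHS]eq_bigr do rewrite mulwE.
by rewrite exchange_big; apply: eq_bigr => J _; rewrite mulr_sumr.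
Qed.

Lemma mulw1r x L : mulw x (fun J => (J == finset.set0)%:R) L = x L.
Proof.
rewrite mulwE (bigD1 L)//= finset.setDv eqxx wsgn0r mul1r mulr1 big1 ?addr0// => J /andP[JL nJL].
have -> : (L :\: J == finset.set0) = false; last by rewrite mulr0.
apply: contraNF nJL; rewrite finset.setD_eq0 => LJ.
by rewrite finset.eqEsubset JL LJ.
Qed.

Lemma mulw1l x L : mulw (fun J => (J == finset.set0)%:R) x L = x L.
Proof.
rewrite mulwE (bigD1 finset.set0) ?finset.sub0set//= finset.setD0 eqxx wsgn0l !mul1r.
by rewrite big1 ?addr0// => J /andP[_ /negPf ->]; rewrite mulr0 mul0r.
Qed.

Lemma eq_mulw x x' y y' L : x =1 x' -> y =1 y' -> mulw x y L = mulw x' y' L.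
Proof. by move=> /funext -> /funext ->. Qed.

End ExteriorSigns.

(** * Words of degree one classes in the operators *)

Section FukayaWords.
Variables (R : realType) (n : nat) (U : set 'rV[R]_n) (u0 : 'rV[R]_n).
Variable F : fukaya_algebra U u0.
Local Notation C := R[i].
Local Notation H := (dclass F).
Local Notation ext := (ext R n).
Local Notation mk := (@mk R n U u0 F).
Implicit Types (beta : H) (s : seq ext) (x y : ext) (K : {set 'I_n}).

Lemma mkD beta s1 s2 x y : mk beta (s1 ++ (x + y) :: s2)
  = mk beta (s1 ++ x :: s2) + mk beta (s1 ++ y :: s2).
Proof. by rewrite -[x]scale1r mk_linear !scale1r. Qed.

Lemma mk0 beta s1 s2 : mk beta (s1 ++ 0 :: s2) = 0.
Proof. by apply: (addrI (mk beta (s1 ++ 0 :: s2))); rewrite -mkD !addr0. Qed.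

Lemma mkZ beta s1 s2 (c : C) x : mk beta (s1 ++ c *: x :: s2) = c *: mk beta (s1 ++ x :: s2).
Proof. by rewrite -[c *: x]addr0 mk_linear mk0 addr0. Qed.

Lemma mk_sum beta s1 s2 (I : Type) (r : seq I) (G : I -> ext) :
  mk beta (s1 ++ (\sum_(i <- r) G i) :: s2) = \sum_(i <- r) mk beta (s1 ++ G i :: s2).
Proof.
elim: r => [|i r IHr]; first by rewrite !big_nil mk0.
by rewrite !big_cons mkD IHr.
Qed.

Lemma ext_ebase x : x = \sum_(I : {set 'I_n}) x I *: ebase R I.
Proof.
apply/ffunP => K; rewrite sum_ffunE (bigD1 K)//= big1 => [|I IK].
  by rewrite addr0 !ffunE eqxx /GRing.scale/= mulr1.
by rewrite !ffunE /GRing.scale/= eq_sym (negPf IK) mulr0.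
Qed.

Lemma mk_ebase beta s1 s2 x K : mk beta (s1 ++ x :: s2) K
  = \sum_(I : {set 'I_n}) x I * mk beta (s1 ++ ebase R I :: s2) K.
Proof.
rewrite {1}(ext_ebase x) mk_sum sum_ffunE; apply: eq_bigr => I _.
by rewrite mkZ !ffunE.
Qed.

Lemma mk_nseqZ beta s1 s2 (c : C) x l : mk beta (s1 ++ nseq l (c *: x) ++ s2)
  = c ^+ l *: mk beta (s1 ++ nseq l x ++ s2).
Proof.
elim: l s1 => [|l IHl] s1 /=; first by rewrite scale1r.
by rewrite mkZ -cat_rcons IHl cat_rcons scalerA exprS.
Qed.

Lemma H1D (a b : 'rV[C]_n) : H1 (a + b) = H1 a + H1 b.
Proof.
by rewrite /H1 -big_split; apply: eq_bigr => i _; rewrite mxE scalerDl.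
Qed.

Lemma H1Z (c : C) (b : 'rV[C]_n) : H1 (c *: b) = c *: H1 b.
Proof.
by rewrite /H1 scaler_sumr; apply: eq_bigr => i _; rewrite mxE scalerA.
Qed.

Lemma H1_0 : H1 0 = 0 :> ext.
Proof. by rewrite /H1 big1// => i _; rewrite mxE scale0r. Qed.

Lemma H1E (b : 'rV[C]_n) K : H1 b K = \sum_i b 0 i * (K == [set i]%SET)%:R.
Proof. by rewrite /H1 sum_ffunE; apply: eq_bigr => i _; rewrite !ffunE. Qed.

Lemma gsgn_H1 (b : 'rV[C]_n) : - gsgn (H1 b) = H1 b.
Proof.
apply/ffunP => K; rewrite !ffunE -[H1 b K]/(H1 b K) H1E -mulNr.
rewrite mulr_sumr; apply: eq_bigr => i _; have [->|_] := eqVneq K [set i]%SET.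
  by rewrite cards1 expr1 opprK mul1r.
by rewrite !mulr0.
Qed.

(* The word with entries [ab.1 + x ab.2] is a polynomial in [x]; [wder] is its
   linear coefficient. *)
Fixpoint wder beta s (w : seq (ext * ext)) : ext :=
  if w is ab :: w' then
    mk beta (s ++ ab.2 :: [seq ab.1 | ab <- w']) + wder beta (rcons s ab.1) w'
  else 0.

(** Each letter is affine in [x], so multilinearity gives a polynomial. Only letters with nonzero
    slope are counted, so that the constant letter e_I does not raise the degree. *)
Lemma mk_word_poly beta s (w : seq (ext * ext)) K : exists p : {poly C},
  [/\ (size p <= (count (fun ab : ext * ext => ab.2 != 0%R) w).+1)%N,
      forall x : C, mk beta (s ++ [seq ab.1 + x *: ab.2 | ab <- w]) K = p.[x],
      p`_0 = mk beta (s ++ [seq ab.1 | ab <- w]) K & p`_1 = wder beta s w K].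
Proof.
elim: w s => [|[a b] w IHw] s.
  exists (mk beta s K)%:P; split.
  - exact: size_polyC_leq1.
  - by move=> x; rewrite cats0 hornerC.
  - by rewrite coefC cats0.
  - by rewrite coefC /= ffunE.
have [p [sp pE p0 p1]] := IHw (rcons s a).
have [q [sq qE q0 q1]] := IHw (rcons s b).
have E (x : C) : mk beta (s ++ [seq ab.1 + x *: ab.2 | ab <- (a, b) :: w]) K
    = x * mk beta (rcons s b ++ [seq ab.1 + x *: ab.2 | ab <- w]) K
      + mk beta (rcons s a ++ [seq ab.1 + x *: ab.2 | ab <- w]) K.
  by rewrite /= addrC mk_linear !ffunE !cat_rcons.
have [b0|b0] := eqVneq b 0.
  exists p; split=> /=.
  - by rewrite b0 eqxx add0n.
  - by move=> x; rewrite E -pE b0 cat_rcons mk0 ffunE mulr0 add0r.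
  - by rewrite p0 cat_rcons.
  - by rewrite p1 ffunE b0 mk0 ffunE add0r.
exists ('X * q + p); split => /=.
- rewrite b0 add1n; apply: leq_trans (size_polyD _ _) _; rewrite geq_max.
  rewrite (leq_trans sp) ?andbT//; have [->|q00] := eqVneq q 0.
    by rewrite mulr0 size_poly0.
  by rewrite mulrC size_mulX.
- by move=> x; rewrite E hornerD hornerM hornerX -pE -qE.
- by rewrite coefD mulrC coefMX/= add0r p0 cat_rcons.
- by rewrite coefD mulrC coefMX/= q0 p1 cat_rcons ffunE.
Qed.

(** The derivative of the block [nseq l a] in the direction [b]: one copy of [a] at a time is
    replaced. For [l = 0] the sum is empty, which makes the truncated predecessor harmless. *)
Definition rep beta (b a : ext) l s1 s2 : ext :=
  \sum_(j < l) mk beta (s1 ++ nseq j a ++ b :: nseq (l.-1 - j) a ++ s2).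

Lemma repS beta b a l s1 s2 : rep beta b a l.+1 s1 s2 =
  mk beta (s1 ++ b :: nseq l a ++ s2) + rep beta b a l (rcons s1 a) s2.
Proof.
rewrite /rep big_ord_recl /= subn0; congr (_ + _); apply: eq_bigr => j _.
by rewrite cat_rcons /bump /= add1n; case: l j => [[]|l j] //=; rewrite subSS.
Qed.

Lemma rep_linear beta (c : C) b b' a l s1 s2 :
  rep beta (c *: b + b') a l s1 s2 = c *: rep beta b a l s1 s2 + rep beta b' a l s1 s2.
Proof.
rewrite /rep scaler_sumr -big_split; apply: eq_bigr => j _.
by rewrite !catA mk_linear.
Qed.

Lemma wder_nseq beta s1 l a b w : wder beta s1 (nseq l (a, b) ++ w)
  = rep beta b a l s1 [seq ab.1 | ab <- w] + wder beta (s1 ++ nseq l a) w.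
Proof.
elim: l s1 => [|l IHl] s1 /=; first by rewrite /rep big_ord0 add0r cats0.
by rewrite IHl repS map_cat map_nseq addrA cat_rcons.
Qed.

Fixpoint ins beta (b : ext) s1 s : ext :=
  mk beta (s1 ++ b :: s) + (if s is a :: s' then ins beta b (rcons s1 a) s' else 0).

(** Inserting [b] in all positions among [l] copies of [a] is the same as replacing one letter among
    [l.+1] copies. This links derivatives of words with the left side of the divisor equation. *)
Lemma ins_nseq beta b s1 l a c s2 : ins beta b s1 (nseq l a ++ c :: s2)
  = rep beta b a l.+1 s1 (c :: s2) + ins beta b (s1 ++ rcons (nseq l a) c) s2.
Proof.
elim: l s1 => [|l IHl] s1 /=.
  by rewrite repS /rep big_ord0 addr0 -cats1.
by rewrite IHl [in RHS]repS addrA cat_rcons.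
Qed.

Lemma ins_nseq0 beta b s1 l a : ins beta b s1 (nseq l a) = rep beta b a l.+1 s1 [::].
Proof.
elim: l s1 => [|l IHl] s1 /=; first by rewrite repS /rep big_ord0.
by rewrite IHl [in RHS]repS cats0.
Qed.

Lemma insE beta b s1 s :
  ins beta b s1 s = \sum_(i < (size s).+1) mk beta (s1 ++ take i s ++ b :: drop i s).
Proof.
elim: s s1 => [|a s IHs] s1 /=.
  by rewrite big_ord_recl big_ord0.
rewrite IHs [RHS]big_ord_recl /=; congr (_ + _); apply: eq_bigr => i _.
by rewrite cat_rcons.
Qed.

Lemma weave0 b k s : weave b (nseq k 0%N) s = s.
Proof. by elim: k s => [//|k IHk] [|a s] //=; rewrite IHk. Qed.

Lemma map_eq_iota0 (i m k : nat) : (i < m)%N ->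
  [seq nat_of_bool (j == i) | j <- iota m k] = nseq k 0%N.
Proof.
by elim: k m => [//|k IHk] m im; rewrite /= (gtn_eqF im) IHk// ltnW.
Qed.

Lemma weave1 b s (i m : nat) : (i <= size s)%N ->
  weave b [seq nat_of_bool (j == m + i)%N | j <- iota m (size s).+1] s = take i s ++ b :: drop i s.
Proof.
elim: s i m => [|a s IHs] [|i] m // si.
  by rewrite /= addn0 eqxx.
  rewrite -[iota m _]/(m :: iota m.+1 (size s).+1) map_cons addn0 eqxx.
  rewrite map_eq_iota0// /=; congr [:: _, _ & _].
  exact: (weave0 b (size s).+1 s).
rewrite -[iota m _]/(m :: iota m.+1 (size s).+1) map_cons.
by rewrite -[X in X == _]addn0 eqn_add2l /= -(IHs i m.+1)// addSnnS.
Qed.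

(** The divisor equation with a single insertion: a tuple of zeros and ones of sum one is the
    indicator of a position. *)
Lemma ins_divisor beta (b : 'rV[C]_n) s :
  ins beta (H1 b) [::] s = bpair b beta *: mk beta s.
Proof.
have := mk_divisor beta b 1 s; have -> : (1`!)%N = 1%N by [].
rewrite invr1 mul1r expr1 => <-.
rewrite insE /=.
pose tp (i : 'I_(size s).+1) : (size s).+1.-tuple 'I_2 :=
  [tuple (if j == i then (1 : 'I_2) else (0 : 'I_2)) | j < (size s).+1].
pose tpi (ls : (size s).+1.-tuple 'I_2) := odflt ord0 [pick j | tnth ls j == 1].
have tpE i : map (@nat_of_ord 2) (tp i) = mkseq (fun j => nat_of_bool (j == i)) (size s).+1.
  apply: (@eq_from_nth _ 0%N); first by rewrite size_map size_tuple size_mkseq.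
  move=> j; rewrite size_map size_tuple => js; rewrite nth_mkseq//.
  rewrite (nth_map 0) ?size_tuple// -[j]/(nat_of_ord (Ordinal js)) -tnth_nth tnth_mktuple.
  by rewrite -val_eqE /=; case: (j == i).
have sumE (ls : (size s).+1.-tuple 'I_2) :
    \sum_(j <- ls) (j : nat) = (\sum_k (tnth ls k : nat))%N.
  exact: (big_tuple _ _ _ _ (fun j : 'I_2 => (j : nat))).
have sumtp i : \sum_(j <- tp i) (j : nat) == 1%N.
  rewrite sumE (bigD1 i)//= tnth_mktuple eqxx big1 ?addn0// => j /negPf ji.
  by rewrite tnth_mktuple ji.
rewrite [RHS](reindex tp) /=; last first.
  exists tpi => [i _|ls].
    rewrite /tpi; case: pickP => [j|/(_ i)]; rewrite tnth_mktuple; last by rewrite eqxx.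
    by case: (eqVneq j i) => [->|_].
  rewrite inE sumE => /eqP s1; rewrite /tpi; case: pickP => [j /eqP j1|n1]; last first.
    have : (\sum_k (tnth ls k : nat))%N = 0%N.
      by apply: big1 => k _; have := n1 k; case: (tnth ls k) => [[|[|//]]] //=.
    by rewrite s1.
  apply: eq_from_tnth => k; rewrite tnth_mktuple; case: eqVneq => [->//|kj] /=.
  move: s1; rewrite (bigD1 j)//= j1 => /eqP; rewrite -[X in _ == X]addn0 eqn_add2l sum_nat_eq0.
  by move=> /forallP/(_ k); rewrite kj /= => /eqP k0; apply/val_inj.
rewrite [RHS](eq_bigl xpredT) => [|i]; last exact: sumtp.
by apply: eq_bigr => i _; rewrite tpE weave1 // -ltnS.
Qed.

(** Inserting one more b into the word b^k, the divisor equation gives (k + 1) m_{k+1}(b, ..., b) as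
    a multiple of m_k(b, ..., b), so the vanishing of m_0 propagates. *)
Lemma mk_nseq_H1 (b : 'rV[C]_n) beta k : mk beta [::] = 0 -> mk beta (nseq k (H1 b)) = 0.
Proof.
move=> m0; elim: k => [//|k IHk].
have := ins_divisor beta b (nseq k (H1 b)); rewrite IHk scaler0 ins_nseq0 /rep.
have E (j : 'I_k.+1) : mk beta ([::] ++ nseq j (H1 b) ++ H1 b :: nseq (k.+1.-1 - j) (H1 b) ++ [::])
    = mk beta (nseq k.+1 (H1 b)).
  have jk : (j <= k)%N by rewrite -ltnS.
  by rewrite cats0 /= -[_ :: nseq _ _]/(nseq (k - j).+1 _) -nseqD addnS subnKC.
under eq_bigr do rewrite E.
rewrite sumr_const card_ord -scaler_nat => /eqP; rewrite scaler_eq0 => /orP[|/eqP//].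
by rewrite pnatr_eq0.
Qed.

Local Notation V := ('rV[C]_n * 'rV[C]_n)%type.

(* Total degree [N] part of the series defining [Qcoef]. *)
Definition AN beta I K (N : nat) (v : V) : C :=
  \sum_(l < N.+1) mk beta (nseq l (H1 v.1) ++ ebase R I :: nseq (N - l) (H1 v.2)) K.

Lemma AN_poly beta I K N (s d : V) : exists p : {poly C},
  [/\ (size p <= N.+1)%N, forall x : C, AN beta I K N (s + x *: d) = p.[x] &
    p`_1 = \sum_(l < N.+1)
      (rep beta (H1 d.1) (H1 s.1) l [::] (ebase R I :: nseq (N - l) (H1 s.2))
       + rep beta (H1 d.2) (H1 s.2) (N - l) (rcons (nseq l (H1 s.1)) (ebase R I)) [::]) K].
Proof.
pose w (l : nat) : seq (ext * ext) :=
  nseq l (H1 s.1, H1 d.1) ++ (ebase R I, 0) :: nseq (N - l) (H1 s.2, H1 d.2).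
have /choice[p hp] := fun l : 'I_N.+1 => mk_word_poly beta [::] (w l) K.
exists (\sum_l p l); split.
- apply: leq_trans (size_sum _ _ _) _; apply/bigmax_leqP => l _.
  have [sp _ _ _] := hp l; apply: leq_trans sp _; rewrite ltnS /w count_cat /= eqxx add0n !count_nseq.
  have lN : (l <= N)%N by rewrite -ltnS.
  rewrite -[leqRHS](subnKC lN) leq_add// -[leqRHS]mul1n leq_mul2r leq_b1 orbT//.
- move=> x; rewrite /AN horner_sum; apply: eq_bigr => l _; have [_ pE _ _] := hp l.
  rewrite -pE /= map_cat /= !map_nseq /= scaler0 addr0.
  by rewrite !H1D !H1Z.
- rewrite coef_sum; apply: eq_bigr => l _; have [_ _ _ ->] := hp l.
  rewrite wder_nseq /= map_nseq /= mk0 add0r.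
  by rewrite -[nseq (N - l) (_, _)]cats0 wder_nseq /= addr0.
Qed.

Lemma linepoly_AN beta I K N : linepoly N (AN beta I K N).
Proof. by move=> s d; have [p [? ? _]] := AN_poly beta I K N s d; exists p. Qed.

Lemma ddc_AN beta I K N (s d : V) : ddc d (AN beta I K) N s = \sum_(l < N.+1)
    (rep beta (H1 d.1) (H1 s.1) l [::] (ebase R I :: nseq (N - l) (H1 s.2))
     + rep beta (H1 d.2) (H1 s.2) (N - l) (rcons (nseq l (H1 s.1)) (ebase R I)) [::]) K.
Proof. by have [p [sp pE p1]] := AN_poly beta I K N s d; rewrite (ddcE sp pE). Qed.

Lemma ddc_AN_linear beta I K N (s d e : V) (c : C) :
  ddc (c *: d + e) (AN beta I K) N s = c * ddc d (AN beta I K) N s + ddc e (AN beta I K) N s.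
Proof.
rewrite !ddc_AN mulr_sumr -big_split; apply: eq_bigr => l _ /=.
by rewrite !H1D !H1Z !rep_linear !ffunE /GRing.scale/=; ring.
Qed.

(** Differentiating along [(e, e)] replaces one letter of either block by [e]. Summed over the
    position of e_I, these replacements are exactly all insertions of [e] into the words of total
    degree [N - 1], which the divisor equation evaluates. *)
Lemma ddc_AN_diag beta I K N (s : V) (e : 'rV[C]_n) : ddc (e, e) (AN beta I K) N s =
  if N is N'.+1 then bpair e beta * AN beta I K N' s else 0.
Proof.
rewrite ddc_AN /=; case: N => [|N].
  by rewrite big_ord1 /rep !big_ord0 !ffunE addr0.
have insl (l : 'I_N.+1) : ins beta (H1 e) [::] (nseq l (H1 s.1) ++ ebase R I :: nseq (N - l) (H1 s.2))
   = rep beta (H1 e) (H1 s.1) l.+1 [::] (ebase R I :: nseq (N - l) (H1 s.2))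
     + rep beta (H1 e) (H1 s.2) (N - l).+1 (rcons (nseq l (H1 s.1)) (ebase R I)) [::].
  by rewrite ins_nseq ins_nseq0.
rewrite /AN mulr_sumr.
transitivity (\sum_(l < N.+1) ins beta (H1 e) [::] (nseq l (H1 s.1) ++ ebase R I :: nseq (N - l) (H1 s.2)) K); last first.
  by apply: eq_bigr => l _; rewrite ins_divisor ffunE.
under [RHS]eq_bigr => l _ do rewrite insl ffunE.
under eq_bigr => l _ do rewrite ffunE.
rewrite !big_split /=; congr (_ + _).
  rewrite big_ord_recl /= {1}/rep big_ord0 ffunE add0r; apply: eq_bigr => l _.
  by rewrite /bump /= add1n subSS.
rewrite big_ord_recr /= subnn {2}/rep big_ord0 ffunE addr0; apply: eq_bigr => l _.
by rewrite subSn// -ltnS.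
Qed.

Lemma AN_homogeneous beta I K N (c : C) (v : V) : AN beta I K N (c *: v) = c ^+ N * AN beta I K N v.
Proof.
rewrite /AN mulr_sumr; apply: eq_bigr => l _ /=; rewrite !H1Z.
have lN : (l <= N)%N by rewrite -ltnS.
have E1 := mk_nseqZ beta [::] (ebase R I :: nseq (N - l) (c *: H1 v.2)) c (H1 v.1) l.
have E2 := mk_nseqZ beta (rcons (nseq l (H1 v.1)) (ebase R I)) [::] c (H1 v.2) (N - l).
rewrite !cat_rcons !cats0 in E2; rewrite /= in E1; rewrite E1 E2 !ffunE /GRing.scale/=.
by rewrite mulrA -exprD subnKC.
Qed.

(** The degree [N] part is homogeneous, so the bound of [mk_convergent] on the polydisc of radius
    [8 * r] gives decay of order 8^-N at radius [r]. The terms with [k + l = N] form a part of the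
    double sum bounded there. *)
Lemma adm_AN beta I K : adm (AN beta I K).
Proof.
split=> [N|r]; first exact: linepoly_AN.
have [B hB] := mk_convergent beta I K (8 * r); exists B => v vr N.
have v8 : bnd (8 * r) ((8 : C) *: v).
  move=> i; have [v1 v2] := vr i; rewrite /= !mxE !normrM ger0_norm// rmorphM rmorph_nat.
  by split; rewrite ler_wpM2l.
have h := hB (8 *: v.1) (8 *: v.2) (fun i => (v8 i).1) (fun i => (v8 i).2) N.+1.
have e8 : 0 < (8 : C) ^+ N by rewrite exprn_gt0.
have : (8 : C) ^+ N * `|AN beta I K N v| <= B%:C.
  rewrite -[X in X * _]ger0_norm ?(ltW e8)// -normrM -AN_homogeneous.
  apply: le_trans h; rewrite /AN; apply: le_trans (ler_norm_sum _ _ _) _.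
  rewrite exchange_big /=; apply: ler_sum => l _.
  have lN : (N - l < N.+1)%N by rewrite ltnS leq_subr.
  rewrite (bigD1 (Ordinal lN))//= lerDl sumr_ge0// => k _.
rewrite mulrC -ler_pdivlMr// rmorphM fmorphV rmorphXn rmorph_nat.
exact.
Qed.

End FukayaWords.

(** * The monoid of disk classes *)

Section DiskMonoid.
Variables (R : realType) (n : nat) (U : set 'rV[R]_n) (u0 : 'rV[R]_n).
Variable F : fukaya_algebra U u0.
Hypothesis u0U : U u0.
Local Notation H := (dclass F).
Local Notation G := (@disk_monoid R n U u0 F).
Implicit Types (b c d beta : H).

Lemma energy_u0 b : energy u0 b = energy0 b.
Proof. by rewrite /energy big1 ?addr0// => i _; rewrite subrr mulr0. Qed.

Lemma generator_energy_gt0 b : moduli_nonempty F b -> b != 0 -> 0 < energy0 b.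
Proof. by move=> mb b0; rewrite -energy_u0; exact: energy_gt0. Qed.

Lemma disk_monoid0 : G 0. Proof. exact: monoid_gen0. Qed.

Lemma disk_monoidD b c : G b -> G c -> G (b + c).
Proof.
move=> + Gc; elim=> [|a d Sa _ IH]; first by rewrite add0r.
by rewrite -addrA; apply: monoid_genD.
Qed.

Lemma disk_monoid_energy_ge0 b : G b -> 0 <= energy0 b.
Proof.
elim=> [|a c Sa _ IH]; first by rewrite raddf0.
rewrite raddfD addr_ge0//; have [->|a0] := eqVneq a 0; first by rewrite raddf0.
exact/ltW/generator_energy_gt0.
Qed.

Lemma disk_monoidP b : G b -> b = 0 \/
  exists a c, [/\ moduli_nonempty F a, a != 0, G c & b = a + c].
Proof.
elim=> [|a c Sa Gc IH]; first by left.
have [->|a0] := eqVneq a 0; first by rewrite add0r.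
by right; exists a, c.
Qed.

Lemma disk_monoid_energy0 b : G b -> energy0 b = 0 -> b = 0.
Proof.
move=> /disk_monoidP[//|[a [c [Sa a0 Gc ->]]]]; rewrite raddfD => E.
suff : 0 < energy0 a + energy0 c by rewrite E ltxx.
by rewrite ltr_pwDl ?generator_energy_gt0 ?disk_monoid_energy_ge0.
Qed.

Lemma seq_positive_bound (s : seq H) (P : H -> Prop) : (forall b, b \in s -> P b -> 0 < energy0 b) ->
  exists2 e : R, 0 < e & forall b, b \in s -> P b -> e <= energy0 b.
Proof.
elim: s => [|a s IHs] sP; first by exists 1.
have [|e e0 es] := IHs; first by move=> b bs; apply: sP; rewrite inE bs orbT.
have [Pa|nPa] := pselect (P a); last first.
  by exists e => // b; rewrite inE => /orP[/eqP ->|/es//].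
exists (Num.min e (energy0 a)).
  by rewrite lt_min e0 sP// mem_head.
by move=> b; rewrite inE ge_min => /orP[/eqP -> _|/es h /h ->//]; rewrite lexx orbT.
Qed.

(** Finitely many generators have energy at most [E], so the nonzero ones among them have energy at
    least some [e > 0]. Removing one generator lowers the energy by at least [e], and the induction
    on the number of removals ends after about [E / e] steps. *)
Lemma disk_monoid_locally_finite (E : R) : finite_set [set b | G b /\ energy0 b <= E].
Proof.
pose S := [set b | moduli_nonempty F b /\ energy0 b <= E].
have finS : finite_set S by exact: gromov_compactness.
have [e e0 eS] : exists2 e : R, 0 < e & forall b, S b -> b != 0 -> e <= energy0 b.
  have /finite_seqP[s sE] := finS.
  have [|e e0 es] := @seq_positive_bound s (fun b => S b /\ b != 0).
    by move=> b _ [[mb _] b0]; exact: generator_energy_gt0.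
  by exists e => // b Sb b0; apply: es => //; move: Sb; rewrite sE.
suff P m : forall E', E' <= E -> E' < m%:R * e -> finite_set [set b | G b /\ energy0 b <= E'].
  apply: (P (Num.truncn (E / e)).+1) => //.
  by rewrite -ltr_pdivrMr// truncnS_gt.
elim: m => [|m IHm] E' E'E.
  rewrite mul0r => E'0; rewrite (_ : [set _ | _] = set0) //.
  apply/seteqP; split=> // b [Gb Eb]; have := disk_monoid_energy_ge0 Gb.
  by rewrite leNgt (le_lt_trans Eb E'0).
rewrite -natr1 mulrDl mul1r -ltrBlDr => E'm.
have fin1 : finite_set [set b | G b /\ energy0 b <= E' - e].
  by apply: IHm => //; rewrite lerBlDr (le_trans E'E)// lerDl ltW.
apply: (@sub_finite_set _ _ ([set 0] `|` \bigcup_(a in S) ((+%R a) @` [set b | G b /\ energy0 b <= E' - e]))).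
  move=> b [Gb Eb]; have [->|[a [c [Sa a0 Gc bE]]]] := disk_monoidP Gb; first by left.
  have Ea : energy0 b = energy0 a + energy0 c by rewrite bE raddfD.
  have c0 := disk_monoid_energy_ge0 Gc.
  have SSa : S a.
    by split=> //; apply: le_trans E'E; apply: le_trans Eb; rewrite Ea lerDl.
  right; exists a => //; exists c => //; split=> //.
  by rewrite lerBrDr; apply: le_trans Eb; rewrite Ea addrC lerD2r eS.
rewrite finite_setU; split; first exact: finite_set1.
by apply: bigcup_finite => // a _; exact: finite_image.
Qed.

(** Local finiteness of the monoid supplies the finiteness below energy bounds. *)
Lemma novikov_suppE (P : set H) : novikov_supp P <-> P `<=` G.
Proof.
split=> [[]//|PG]; split=> // E; apply: sub_finite_set (disk_monoid_locally_finite E).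
by move=> b [Pb]; rewrite energy_u0; split=> //; exact: PG.
Qed.

Lemma splits_finite beta : finite_set (splits beta : set H).
Proof.
apply: sub_finite_set (disk_monoid_locally_finite (energy0 beta)) => c [Gc Gbc].
by split=> //; have := disk_monoid_energy_ge0 Gbc; rewrite raddfB subr_ge0.
Qed.

Definition sp beta : seq H := finmap.enum_fset (fset_set (splits beta)).

Lemma mem_sp beta c : (c \in sp beta) = `[< G c /\ G (beta - c) >].
Proof.
rewrite /sp in_fset_set; last exact: splits_finite.
by apply/idP/idP => [/set_mem h|/asboolP h]; [exact/asboolP|exact/mem_set].
Qed.

Lemma sp_uniq beta : uniq (sp beta). Proof. exact: finmap.fset_uniq. Qed.

Lemma spE (Z : nmodType) beta (T : H -> Z) :
  \sum_(c \in splits beta) T c = \sum_(c <- sp beta) T c.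
Proof. by rewrite fsbig_finite//; exact: splits_finite. Qed.

Lemma sp_comm (Z : nmodType) beta (T : H -> H -> Z) :
  \sum_(c <- sp beta) T c (beta - c) = \sum_(c <- sp beta) T (beta - c) c.
Proof.
transitivity (\sum_(c <- [seq beta - c | c <- sp beta]) T (beta - c) c).
  by rewrite big_map; apply: eq_bigr => c _; rewrite subKr.
apply: perm_big; apply: uniq_perm; rewrite ?sp_uniq// ?map_inj_uniq ?sp_uniq//.
  by move=> x y; apply: subrI.
move=> c; apply/mapP/idP => [[d + ->]|]; rewrite !mem_sp => /asboolP[h1 h2].
  by apply/asboolP; rewrite subKr.
by exists (beta - c); rewrite ?subKr// mem_sp; apply/asboolP; rewrite subKr.
Qed.

(** Both sides run over the ordered triples of elements of the monoid with sum [beta]; closure under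
    addition makes the two nested index sets match. *)
Lemma sp_assoc (Z : nmodType) beta (T : H -> H -> H -> Z) :
  \sum_(c <- sp beta) \sum_(d <- sp (beta - c)) T c d (beta - c - d)
  = \sum_(c <- sp beta) \sum_(d <- sp c) T d (c - d) (beta - c).
Proof.
pose T' (t : H * (H * H)) := T t.1 t.2.1 t.2.2.
transitivity (\sum_(t <- [seq (c, (d, beta - c - d)) | c <- sp beta, d <- sp (beta - c)]) T' t).
  by rewrite big_allpairs_dep.
transitivity (\sum_(t <- [seq (d, (c - d, beta - c)) | c <- sp beta, d <- sp c]) T' t); last first.
  by rewrite big_allpairs_dep.
apply: perm_big; apply: uniq_perm.
- apply: allpairs_uniq_dep; [exact: sp_uniq|by move=> c _; exact: sp_uniq|].
  by move=> [c d] [c' d'] _ _ /= [-> -> _].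
- apply: allpairs_uniq_dep; [exact: sp_uniq|by move=> c _; exact: sp_uniq|].
  by move=> [c d] [c' d'] _ _ /= [-> /addIr ->].
move=> [a [b e]]; apply/allpairsPdep/allpairsPdep => -[c [d []]]; rewrite !mem_sp.
  move=> /asboolP[Gc Gbc] /asboolP[Gd Gbcd] [-> -> ->]; exists (c + d), c; rewrite !mem_sp.
  rewrite [c + d - c]addrC addKr opprD addrA; split=> //.
    by apply/asboolP; split=> //; exact: disk_monoidD.
  by apply/asboolP.
move=> /asboolP[Gc Gbc] /asboolP[Gd Gcd] [-> -> ->]; exists d, (c - d); rewrite !mem_sp.
have E : beta - d - (c - d) = beta - c by rewrite opprB addrA subrK.
split; last by rewrite E.
  by apply/asboolP; split=> //; have := disk_monoidD Gbc Gcd; rewrite addrA subrK.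
by apply/asboolP; rewrite E.
Qed.

(** The number of splittings serves as induction measure for the successive approximation: unlike
    the energy it is a natural number. *)
Definition rk beta : nat := size (sp beta).

Lemma sp_antisym b c : G (b - c) -> G (c - b) -> b = c.
Proof.
move=> Gbc Gcb; apply/eqP; rewrite -subr_eq0; apply/eqP/disk_monoid_energy0 => //.
apply/eqP; rewrite eq_le disk_monoid_energy_ge0// andbT -oppr_ge0 -raddfN opprB.
exact: disk_monoid_energy_ge0.
Qed.

(** Each splitting of [c] is one of [beta], while [beta] occurs only among those of [beta]:
    otherwise [beta - c] and [c - beta] would both lie in the monoid, whose only element of energy
    zero is 0. *)
Lemma rk_lt beta c : G (beta - c) -> G c -> c != beta -> (rk c < rk beta)%N.
Proof.
move=> Gbc Gc ncb; apply: (@leq_trans (size (beta :: sp c))) => //.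
apply: uniq_leq_size => [|d].
  rewrite /= sp_uniq andbT mem_sp; apply/asboolP => -[_ Gcb].
  by move/eqP: ncb; apply; exact: sp_antisym.
rewrite inE => /orP[/eqP ->|]; rewrite !mem_sp.
  apply/asboolP; rewrite subrr; split; last exact: disk_monoid0.
  by have := disk_monoidD Gbc Gc; rewrite subrK.
move=> /asboolP[Gd Gcd]; apply/asboolP; split=> //.
by have := disk_monoidD Gbc Gcd; rewrite addrA subrK.
Qed.

End DiskMonoid.

(** * Vanishing of m_0 *)

Section Potential.
Variables (R : realType) (n : nat) (U : set 'rV[R]_n) (u0 : 'rV[R]_n).
Variable F : fukaya_algebra U u0.
Hypothesis u0U : U u0.
Local Notation mk := (@mk R n U u0 F).

(** At the point over [u0] with y = 0 the class [tau] vanishes, so the series of the potential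
    reduces to its term [k = 0], the unit coefficient of m_0. *)
Lemma m0_eq0 : weakly_unobstructed F -> (forall p, U p.1 -> potential F p = 0) ->
  forall beta, mk beta [::] = 0.
Proof.
move=> [c hc] W0 beta; pose p : TB R n := (u0, 0).
have t0 : tau p = 0.
  by apply/rowP => i; rewrite !mxE mulr0.
have := congr1 (fun w => w beta) (W0 p u0U); rewrite /potential /= t0 H1_0.
have /has_csum_eq -> : has_csum (fun k => mk beta (nseq k 0) finset.set0)
    (\sum_(k < 1) mk beta (nseq k 0) finset.set0).
  apply: has_csum_fin => -[//|k] _ /=.
  by rewrite -[0 :: _]/([::] ++ 0 :: nseq k 0) mk0 ffunE.
rewrite big_ord1 /= hc !ffunE eqxx /GRing.scale/= mulr1 => E.
have c0 : c beta = 0 := E.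
rewrite c0; exact: (scale0r (ebase R finset.set0 : ext R n)).
Qed.

End Potential.

(** * The coefficients of Q *)

Section QCoefficients.
Variables (R : realType) (n : nat) (U : set 'rV[R]_n) (u0 : 'rV[R]_n).
Variable F : fukaya_algebra U u0.
Hypothesis u0U : U u0.
Local Notation C := R[i].
Local Notation H := (dclass F).
Local Notation TB := (TB R n).
Local Notation V := ('rV[C]_n * 'rV[C]_n)%type.
Local Notation mk := (@mk R n U u0 F).
Hypothesis m0 : forall beta, mk beta [::] = 0.
Variables (u : 'rV[R]_n) (alpha : 'rV[C]_n).
Implicit Types (beta : H) (I K L : {set 'I_n}) (p : TB).

Definition tt p : V := (tau p, theta u alpha p).
Definition ttlin p : V :=
  (\row_i (- 'i * (p.2 0 i)%:C), \row_i ((p.1 0 i)%:C)).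

Lemma tt_affine (h : R) (w p : TB) : tt (h *: w + p) = tt p + h%:C *: ttlin w.
Proof.
rewrite /tt /ttlin /tau /theta; congr pair; apply/rowP => i; rewrite !mxE /=.
  by rewrite ?mxE rmorphD rmorphM; ring.
by rewrite ?mxE !rmorphB rmorphD rmorphM; ring.
Qed.

Lemma normi : `|'i| = 1 :> C.
Proof. by rewrite normc_def /= expr0n/= add0r expr1n sqrtr1. Qed.

Lemma norm_realc (x : R) : `|x%:C| = `|x|%:C.
Proof. by rewrite normc_def /= expr0n/= addr0 sqrtr_sqr. Qed.

Lemma le_norm_row (v : 'rV[R]_n) i : `|v 0 i| <= `|v|.
Proof.
rewrite /Num.norm/= mx_normrE.
exact: (le_bigmax _ (fun ij : 'I_1 * 'I_n => `|v ij.1 ij.2|) (0, i)).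
Qed.

Lemma bnd_ttlin w : `|w| <= 1 -> bnd 1 (ttlin w).
Proof.
rewrite prod_normE ge_max => /andP[w1 w2] i; rewrite /= !mxE normrM normrN normi mul1r.
rewrite !norm_realc !lecR.
by split; [apply: le_trans w2|apply: le_trans w1]; exact: le_norm_row.
Qed.

Lemma bnd_tt p : exists r, bnd r (tt p).
Proof.
exists (\sum_i (complex.Re `|(tt p).1 0 i| + complex.Re `|(tt p).2 0 i|)) => i.
have nR (x : C) : `|x| = (complex.Re `|x|)%:C by [].
have n0 (x : C) : 0 <= complex.Re `|x| by rewrite -ler0c -nR.
have le x : x <= complex.Re `|(tt p).1 0 i| + complex.Re `|(tt p).2 0 i| ->
    x <= \sum_i (complex.Re `|(tt p).1 0 i| + complex.Re `|(tt p).2 0 i|).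
  move=> /le_trans; apply; rewrite (bigD1 i)//= lerDl sumr_ge0// => j _.
  by apply: addr_ge0; exact: n0.
split; rewrite nR lecR; apply: le; [rewrite lerDl|rewrite lerDr]; exact: n0.
Qed.

Local Notation th := (theta u alpha).

Lemma QcoefE p beta I K : Qcoef th p beta I K = fsum tt (AN beta I K) p.
Proof. by []. Qed.

Lemma csmooth_Qcoef W beta I K : csmooth W (fun p => Qcoef th p beta I K).
Proof. exact: (csmooth_fsum tt_affine bnd_ttlin bnd_tt W (adm_AN beta I K)). Qed.

(** The x_i derivative moves [theta] by e_i, and the y_i derivative moves [tau] by -sqrt(-1) e_i.
    Their combination in [del 'i i] is therefore the diagonal direction (e_i, e_i), where the
    divisor equation applies. *)
Lemma del_Qcoef i beta I K p :
  del 'i i (fun p => Qcoef th p beta I K) p = (boundary beta 0 i)%:~R * Qcoef th p beta I K.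
Proof.
have cE a := cpartial_fsum tt_affine bnd_ttlin bnd_tt a p (adm_AN beta I K).
transitivity (fsum tt (ddc (ttlin (dirv R (inl i))) (AN beta I K)) p
   + 'i * fsum tt (ddc (ttlin (dirv R (inr i))) (AN beta I K)) p).
  exact: (f_equal2 (fun x y => x + 'i * y) (cE (inl i)) (cE (inr i))).
have bl : bnd 1 (ttlin (dirv R (inl i))) by apply: bnd_ttlin; exact: norm_dirv_le1.
have br : bnd 1 (ttlin (dirv R (inr i))) by apply: bnd_ttlin; exact: norm_dirv_le1.
have hs d : bnd 1 d -> has_csum (fun N => ddc d (AN beta I K) N (tt p)) (fsum tt (ddc d (AN beta I K)) p).
  by move=> bd; apply: (adm_has_csum bnd_tt); apply: adm_ddc => //; exact: adm_AN.
have h1 := has_csumD (has_csumZ 'i (hs _ br)) (hs _ bl).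
have e : 'i *: ttlin (dirv R (inr i)) + ttlin (dirv R (inl i))
    = (delta_mx 0 i : 'rV[C]_n, delta_mx 0 i : 'rV[C]_n).
  rewrite /ttlin; congr pair; apply/rowP => j; rewrite ?mxE /= ?mxE ?eqxx /=.
    rewrite mulr0 addr0 mulrA mulrN cii opprK mul1r.
    by case: (j == i).
  by rewrite mulr0 add0r; case: (j == i).
(* The term of degree [N] of the derivative is a multiple of the term of degree [N - 1] of the
   series, and its term of degree 0 vanishes, hence the shift. *)
have h2 := has_csum_shift (has_csumZ (bpair (delta_mx 0 i) beta)
  (adm_has_csum bnd_tt p (adm_AN beta I K))).
rewrite addrC -(has_csum_eq h1).
have bE : bpair (delta_mx 0 i) beta = (boundary beta 0 i)%:~R :> C.
  rewrite /bpair (bigD1 i)//= big1 => [|j ji]; first by rewrite mxE !eqxx mul1r addr0.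
  by rewrite mxE eqxx (negPf ji) mul0r.
rewrite bE in h2; rewrite -(has_csum_eq h2); apply: eq_csum => N.
by rewrite -ddc_AN_linear e ddc_AN_diag bE.
Qed.

Lemma Qcoef_supp p beta I K : ~ disk_monoid beta -> Qcoef th p beta I K = 0.
Proof.
move=> nG; rewrite QcoefE; apply: has_csum_eq.
have := @has_csum_fin R (fun=> 0) 0 (fun _ _ => erefl); rewrite big_ord0.
congr has_csum; apply/funext => N; rewrite /AN big1// => l _.
by rewrite mk_supp// ffunE.
Qed.

(** For beta = 0 only m_2 survives, so only the words (tau, e_I) and (e_I, theta) contribute. With
    the sign in m_2 they give minus tau wedge e_I and theta wedge e_I. *)
Lemma Qcoef0 p I K : Qcoef th p (0 : H) I K =
  \sum_i (theta u alpha p 0 i - tau p 0 i) * Eop i (fun J => (J == I)%:R) K.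
Proof.
rewrite QcoefE.
have h : has_csum (fun N => AN (0 : H) I K N (tt p)) (\sum_(N < 2) AN (0 : H) I K N (tt p)).
  apply: has_csum_fin => N N2; rewrite /AN big1// => l _.
  rewrite mk_classical ?ffunE// size_cat /= !size_nseq addnS subnKC -1?ltnS//.
  by rewrite eqSS gtn_eqF.
rewrite /fsum (has_csum_eq h) big_ord_recl big_ord1 /bump /=.
have -> : AN (0 : H) I K 0 (tt p) = 0.
  by rewrite /AN big_ord1 /= mk_classical// ffunE.
rewrite add0r /AN big_ord_recl big_ord1 /bump /=.
have wE (x y : ext R n) : wedge x y K = mulw x y K by rewrite ffunE mulwE.
have e1 : ebase R I =1 (fun J => (J == I)%:R) by move=> J; rewrite ffunE.
have H1op (b : 'rV[C]_n) : H1 b =1 (fun J => \sum_i b 0 i * Eop i (fun J => (J == finset.set0)%:R) J).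
  move=> J; rewrite H1E; apply: eq_bigr => i _; congr (_ * _).
  by rewrite Eop_delta mulw1r.
rewrite !mk_classical2 !wE.
have -> : mulw (gsgn (ebase R I)) (H1 (theta u alpha p)) K =
    \sum_i theta u alpha p 0 i * Eop i (fun J => (J == I)%:R) K.
  rewrite (eq_mulw (x' := gs (fun J => (J == I)%:R)) _ _ (H1op _)); last first.
    by move=> J; rewrite ffunE e1.
  rewrite mulw_sumr; apply: eq_bigr => i _.
  by rewrite mulwZr Eop_mulwr mulw1r.
have -> : mulw (gsgn (H1 (tau p))) (ebase R I) K =
    - \sum_i tau p 0 i * Eop i (fun J => (J == I)%:R) K.
  rewrite (eq_mulw (x' := fun J => \sum_i (- tau p 0 i) * (J == [set i]%SET)%:R) _ _ e1); last first.
    move=> J; rewrite -[gsgn _]opprK gsgn_H1 ffunE H1E -sumrN.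
    by apply: eq_bigr => i _; rewrite mulNr.
  rewrite mulw_suml -sumrN; apply: eq_bigr => i _.
  by rewrite mulwZl Eop_delta mulNr.
by rewrite -sumrB; apply: eq_bigr => i _; rewrite mulrBl.
Qed.

(** Up to sign, the top coefficient of m_1(e_I) is its pairing with the unit. Cyclicity moves the
    unit into the operator, where strict unitality kills it. *)
Lemma mk1_top beta I : mk beta [:: ebase R I] [set: 'I_n]%SET = 0.
Proof.
have := mk_cyclic beta [::] finset.set0 I; rewrite /= => E.
have u0E : mk beta [:: ebase R finset.set0] = 0 by apply: (@mk_unit _ _ _ _ F beta [::] [::]); rewrite orbT.
have wE (x y : ext R n) L : wedge x y L = mulw x y L by rewrite ffunE mulwE.
have z (x : ext R n) : pairing 0 x = 0.
  rewrite /pairing wE mulwE big1// => J _.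
  by rewrite ffunE ffunE !mulr0 mul0r.
rewrite u0E z mulr0 in E.
move: E; rewrite /pairing wE (eq_mulw (y' := fun J => (J == finset.set0)%:R) _ (fun=> erefl)); last first.
  by move=> J; rewrite ffunE.
rewrite mulw1r ffunE => /eqP; rewrite mulf_eq0 signr_eq0 /=.
by move/eqP.
Qed.

(* At the point where [theta] and [tau] agree, the divisor equation sums the
   degree [N] part to a multiple of the one of degree [N - 1]. *)
Lemma AN_diag_rec beta I K N (b : 'rV[C]_n) :
  N.+1%:R * AN beta I K N.+1 (b, b) = bpair b beta * AN beta I K N (b, b).
Proof.
pose T (l r : nat) := mk beta (nseq l (H1 b) ++ ebase R I :: nseq r (H1 b)).
have rep1 l r : rep beta (H1 b) (H1 b) l [::] (ebase R I :: nseq r (H1 b)) = l%:R *: T l r.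
  rewrite /rep; transitivity (\sum_(j < l) T l r).
    apply: eq_bigr => j _; rewrite /T /=.
    rewrite -[H1 b :: nseq (l.-1 - j) _ ++ _]/(nseq (l.-1 - j).+1 _ ++ _) catA -nseqD.
    by rewrite addnS; case: l j => [[]//|l j] /=; rewrite subnKC// -ltnS.
  by rewrite sumr_const card_ord scaler_nat.
have rep2 l r : rep beta (H1 b) (H1 b) r (rcons (nseq l (H1 b)) (ebase R I)) [::] = r%:R *: T l r.
  rewrite /rep; transitivity (\sum_(j < r) T l r).
    apply: eq_bigr => j _; rewrite /T cat_rcons cats0.
    rewrite -[H1 b :: nseq (r.-1 - j) _]/(nseq (r.-1 - j).+1 _) -nseqD.
    by rewrite addnS; case: r j => [[]//|r j] /=; rewrite subnKC// -ltnS.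
  by rewrite sumr_const card_ord scaler_nat.
have := ddc_AN_diag beta I K N.+1 (b, b) b; rewrite ddc_AN => <-.
rewrite /AN mulr_sumr; apply: eq_bigr => l _; rewrite rep1 rep2 -scalerDl -natrD.
by rewrite subnKC ?ffunE// -ltnS.
Qed.

Lemma Qcoef_top p beta I : tau p = theta u alpha p -> Qcoef th p beta I [set: 'I_n]%SET = 0.
Proof.
move=> tE; rewrite QcoefE; apply: has_csum_eq.
have A0 N : AN beta I [set: 'I_n]%SET N (tt p) = 0.
  (* Degree zero is [mk1_top]; the recursion makes each higher degree a multiple of the previous
     one. *)
  rewrite /tt -tE; elim: N => [|N IHN].
    by rewrite /AN big_ord1 /= mk1_top.
  have := AN_diag_rec beta I [set: 'I_n]%SET N (tau p); rewrite IHN mulr0 => /eqP.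
  by rewrite mulf_eq0 pnatr_eq0 /= => /eqP.
have := @has_csum_fin R (fun=> 0) 0 (fun _ _ => erefl); rewrite big_ord0.
by congr has_csum; apply/funext => N; rewrite A0.
Qed.

End QCoefficients.

Lemma take_nseq_min (T : Type) i j (x : T) : take i (nseq j x) = nseq (minn i j) x.
Proof.
by case: (leqP i j) => ij; [rewrite take_nseq|rewrite take_oversize ?size_nseq// ltnW].
Qed.

(** * Sums over antidiagonals *)

Section Antidiagonal.
Variable Z : zmodType.

Definition anti (N : nat) (g : nat -> nat -> Z) : Z := \sum_(x < N.+1) g x (N - x)%N.

Lemma eq_anti N g h : (forall x y, (x + y)%N = N -> g x y = h x y) -> anti N g = anti N h.
Proof. by move=> gh; apply: eq_bigr => x _; apply: gh; rewrite subnKC// -ltnS. Qed.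

Lemma shift_sum N i (f : nat -> Z) : (i <= N)%N -> (forall m, (m < i)%N -> f m = 0) ->
  \sum_(m < N.+1) f m = \sum_(j < (N - i).+1) f (i + j)%N.
Proof.
move=> iN f0; rewrite -!(big_mkord xpredT) (big_cat_nat (leq0n i) (leqW iN))/=.
rewrite big_nat_cond big1 ?add0r; last by move=> m; rewrite andbT => /andP[_ /f0].
have := big_addn 0 N.+1 i xpredT f; rewrite add0n (subSn iN) => ->.
by rewrite big_mkord; apply: eq_bigr => j _; rewrite addnC.
Qed.

Lemma antiC N g : anti N g = anti N (fun x y => g y x).
Proof.
rewrite /anti (reindex_inj rev_ord_inj) /=; apply: eq_bigr => x _.
by rewrite subSS subKn// -ltnS.
Qed.

Lemma antiA N (h : nat -> nat -> nat -> Z) :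
  anti N (fun l k => anti l (fun a b => h a b k)) = anti N (fun a r => anti r (fun b k => h a b k)).
Proof.
transitivity (\sum_(m < N.+1) \sum_(i < N.+1) (if (i <= m)%N then h i (m - i)%N (N - m)%N else 0)).
  apply: eq_bigr => m _; rewrite /anti -(big_mkord xpredT (fun i => h i (m - i)%N (N - m)%N)).
  rewrite -(big_mkord xpredT (fun i => if (i <= m)%N then h i (m - i)%N (N - m)%N else 0)).
  rewrite [RHS](big_cat_nat (leq0n m.+1) (ltn_ord m))/= [X in _ = _ + X]big_nat_cond.
  rewrite [X in _ = _ + X]big1 ?addr0; last first.
    by move=> i; rewrite andbT => /andP[mi _]; rewrite leqNgt mi.
  by apply: eq_big_nat => i /andP[_]; rewrite ltnS => ->.
rewrite exchange_big /=; apply: eq_bigr => i _; have iN : (i <= N)%N by rewrite -ltnS.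
rewrite (shift_sum (f := fun m => if (i <= m)%N then h i (m - i)%N (N - m)%N else 0) iN); last first.
  by move=> m mi; rewrite leqNgt mi.
by apply: eq_bigr => j _; rewrite leq_addr addKn subnDA.
Qed.

Lemma anti_exchange M M' (h : nat -> nat -> nat -> nat -> Z) :
  anti M (fun b c => anti M' (fun a d => h a b c d))
  = anti M' (fun a d => anti M (fun b c => h a b c d)).
Proof. exact: exchange_big. Qed.

(** Both sides run over quadruples of sum [N]. The left groups the letters before e_I, [(a, b)], and
    those after it, [(c, d)]; the right groups the inner word, [(b, c)], and the outer word,
    [(a, d)]. *)
Lemma anti_quad N (h : nat -> nat -> nat -> nat -> Z) :
  anti N (fun l k => anti l (fun a b => anti k (fun c d => h a b c d)))
  = anti N (fun M M' => anti M (fun b c => anti M' (fun a d => h a b c d))).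
Proof.
rewrite (antiA N (fun a b k => anti k (fun c d => h a b c d))) [RHS]antiC.
transitivity (anti N (fun M' M => anti M' (fun a d => anti M (fun b c => h a b c d)))); last first.
  by apply: eq_anti => x y _; rewrite anti_exchange.
rewrite (antiA N (fun a d M => anti M (fun b c => h a b c d))).
apply: eq_anti => a r _; rewrite [RHS]antiC.
by rewrite (antiA r (fun b c d => h a b c d)).
Qed.

Lemma anti_sum (I : Type) (r : seq I) N (g : I -> nat -> nat -> Z) :
  \sum_(i <- r) anti N (g i) = anti N (fun x y => \sum_(i <- r) g i x y).
Proof. exact: exchange_big. Qed.

Lemma anti0 N g : (forall x y, g x y = 0) -> anti N g = 0.
Proof. by move=> g0; rewrite /anti big1. Qed.

End Antidiagonal.

Lemma sum_neq0 (Z : zmodType) (I : Type) (r : seq I) (P : pred I) (f : I -> Z) :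
  \sum_(i <- r | P i) f i != 0 -> exists2 i, P i & f i != 0.
Proof.
move=> s0; apply: contrapT => nex; move/eqP: s0; apply; apply: big1 => i Pi.
by apply/eqP; apply: contrapT => /negP fi; apply: nex; exists i.
Qed.

(** * Degrees and the square of Q *)

Section QAlgebra.
Variables (R : realType) (n : nat) (U : set 'rV[R]_n) (u0 : 'rV[R]_n).
Variable F : fukaya_algebra U u0.
Hypothesis u0U : U u0.
Local Notation C := R[i].
Local Notation H := (dclass F).
Local Notation TB := (TB R n).
Local Notation ext := (ext R n).
Local Notation mk := (@mk R n U u0 F).
Hypothesis m0 : forall beta, mk beta [::] = 0.
Variables (u : 'rV[R]_n) (alpha : 'rV[C]_n).
Local Notation th := (theta u alpha).
Local Notation tt := (tt u alpha).
Implicit Types (beta : H) (I K L : {set 'I_n}) (p : TB).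

Definition homog (d : nat) (x : ext) := forall J, x J != 0 -> #|J| = d.

Lemma homog_H1 (b : 'rV[C]_n) : homog 1 (H1 b).
Proof.
move=> J; rewrite H1E => /sum_neq0[i _].
by have [->|_] := eqVneq J [set i]%SET; rewrite ?cards1// mulr0 eqxx.
Qed.

Lemma homog_ebase I : homog #|I| (ebase R I).
Proof. by move=> J; rewrite ffunE; have [->//|_] := eqVneq J I; rewrite eqxx. Qed.

(** [mk_degree] speaks of basis words only, so the homogeneous letters are expanded in the basis one
    at a time, from the left. *)
Lemma mk_word_degree beta (Is : seq {set 'I_n}) (w : seq (ext * nat)) K :
  (forall k, (k < size w)%N -> homog (nth (0, 0%N) w k).2 (nth (0, 0%N) w k).1) ->
  mk beta (map (@ebase R n) Is ++ map fst w) K != 0 ->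
  (#|K|%:Z = \sum_(I <- Is) #|I|%:Z + (\sum_(xd <- w) xd.2)%N%:Z + 2
             - ((size Is)%:Z + (size w)%:Z) - maslov beta)%R.
Proof.
elim: w Is => [|[x d] w IHw] Is hw.
  by rewrite cats0 big_nil => /mk_degree ->; rewrite /= !addr0.
rewrite /= mk_ebase => /sum_neq0[J _]; rewrite mulf_eq0 negb_or => /andP[xJ mJ].
have Jd := hw 0%N (ltn0Sn _) J xJ; rewrite /= in Jd.
have := IHw (rcons Is J); rewrite map_rcons cat_rcons => /(_ _ mJ) ->; last first.
  by move=> k kw; exact: (hw k.+1).
rewrite -cats1 big_cat big_seq1 big_cons size_cat Jd /= addn1.
move: (\sum_(I <- Is) _) (\sum_(xd <- w) xd.2)%N (size Is) (size w) (maslov beta) => A B s1 s2 m.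
lia.
Qed.

(** A letter of degree one adds one to the total degree and one to the length of the word, and these
    cancel; hence the answer does not depend on [N]. *)
Lemma AN_degree beta I K N v : AN beta I K N v != 0 ->
  #|K|%:Z + maslov beta = #|I|%:Z + 1.
Proof.
move=> /sum_neq0[l _] h; have lN : (l <= N)%N by rewrite -ltnS.
pose w : seq (ext * nat) := nseq l (H1 v.1, 1%N) ++ (ebase R I, #|I|) :: nseq (N - l) (H1 v.2, 1%N).
have := @mk_word_degree beta [::] w K; rewrite /= !map_cat /= !map_nseq => /(_ _ h) ->.
  rewrite big_nil size_cat /= !size_nseq big_cat big_cons /=.
  rewrite !big_nseq !iter_addn_0 !mul1n.
  by move: (maslov beta) => m; lia.
move=> k kw; have : nth (0, 0%N) w k \in w by exact: mem_nth.
rewrite {2}/w mem_cat inE !mem_nseq => /or3P[/andP[_ /eqP ->]|/eqP ->|/andP[_ /eqP ->]].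
- exact: homog_H1.
- exact: homog_ebase.
- exact: homog_H1.
Qed.

Lemma Qcoef_degree p beta I K : Qcoef th p beta I K != 0 ->
  #|K|%:Z + maslov beta = #|I|%:Z + 1.
Proof.
move=> Q0; apply: contrapT => nE; move/eqP: Q0; apply; rewrite QcoefE; apply: has_csum_eq.
have := @has_csum_fin R (fun=> 0) 0 (fun _ _ => erefl); rewrite big_ord0.
congr has_csum; apply/funext => N; apply/eqP; rewrite eq_sym; apply: contrapT => /negP h.
exact/nE/(AN_degree h).
Qed.

(* The terms of the [A_infty] relation whose inner word avoids [e_I] vanish,
   since [m_k(b, ..., b) = 0]. *)
Lemma ainfty_words beta I (s t : 'rV[C]_n) (l k : nat) :
  \sum_(a < l.+1) \sum_(c < k.+1) \sum_(g <- sp beta)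
    mk (beta - g) (nseq a (H1 s) ++ mk g (nseq (l - a) (H1 s) ++ ebase R I :: nseq c (H1 t))
                   :: nseq (k - c) (H1 t)) = 0.
Proof.
set x := H1 s; set y := H1 t; set e := ebase R I.
pose w := nseq l x ++ e :: nseq k y.
have sw : size w = (l + k).+1 by rewrite size_cat /= !size_nseq addnS.
pose T i j := \sum_(g <- sp beta)
  mk (beta - g) (map (fun a => - gsgn a) (take i w) ++ mk g (take j (drop i w)) :: drop (i + j) w).
have T0 i j : (forall g, mk g (take j (drop i w)) = 0) -> T i j = 0.
  by move=> m; rewrite /T big1// => g _; rewrite m mk0.
have rel : \sum_(i < (l + k).+2) \sum_(j < ((l + k).+1 - i).+1) T i j = 0.
  have := mk_ainfty beta w; rewrite sw => E; rewrite -[RHS]E.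
  by apply: eq_bigr => i _; apply: eq_bigr => j _; rewrite /T spE.
rewrite -[RHS]rel.
have lk : (l.+1 <= (l + k).+2)%N by rewrite ltnS leqW// leq_addr.
rewrite -(big_mkord xpredT (fun i => \sum_(j < ((l + k).+1 - i).+1) T i j)).
rewrite (big_cat_nat (leq0n l.+1) lk)/= [X in _ = _ + X]big_nat_cond.
(* For [i > l] the inner word lies in the block of [y] after e_I. *)
rewrite [X in _ = _ + X]big1 ?addr0; last first.
  move=> i; rewrite andbT => /andP[li _]; apply: big1 => j _; apply: T0 => g.
  have [i' iE] : exists i', i = (l + i'.+1)%N by exists (i - l.+1)%N; rewrite addnS -addSn subnKC.
  have -> : drop i w = nseq (k - i') y.
    have -> : i = (i' + l.+1)%N by rewrite iE; lia.
    by rewrite /w -cat_rcons -drop_drop drop_size_cat ?drop_nseq// size_rcons size_nseq.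
  by rewrite take_nseq_min; exact: mk_nseq_H1.
rewrite big_mkord; apply: eq_bigr => a _; have al : (a <= l)%N by rewrite -ltnS.
have wE : w = nseq a x ++ (nseq (l - a) x ++ e :: nseq k y).
  by rewrite catA -nseqD subnKC.
have da : drop a w = nseq (l - a) x ++ e :: nseq k y by rewrite wE drop_size_cat// size_nseq.
have ta : take a w = nseq a x by rewrite wE take_size_cat// size_nseq.
have la : (l.+1 - a <= (l + k).+1 - a)%N by rewrite leq_sub2r// ltnS leq_addr.
(* For [j <= l - a] the inner word lies in the block of [x] before e_I. *)
rewrite (shift_sum (f := T a) la); last first.
  move=> j ja; apply: T0 => g; rewrite da takel_cat; last first.
    by rewrite size_nseq -ltnS -subSn.
  by rewrite take_nseq_min; exact: mk_nseq_H1.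
have -> : ((l + k).+1 - a - (l.+1 - a))%N = k by lia.
apply: eq_bigr => c _; have ck : (c <= k)%N by rewrite -ltnS.
apply: eq_bigr => g _; rewrite ta map_nseq gsgn_H1 da.
have -> : (l.+1 - a + c = size (nseq (l - a) x ++ e :: nseq c y))%N.
  by rewrite size_cat /= !size_nseq subSn// addnS addSn.
have -> : nseq (l - a) x ++ e :: nseq k y = (nseq (l - a) x ++ e :: nseq c y) ++ nseq (k - c) y.
  by rewrite -catA /= -nseqD subnKC.
rewrite take_size_cat//; congr (mk _ (_ ++ _ :: _)).
have -> : w = nseq a x ++ ((nseq (l - a) x ++ e :: nseq c y) ++ nseq (k - c) y).
  by rewrite wE -catA /= -nseqD subnKC.
by rewrite addnC -drop_drop drop_size_cat ?size_nseq// drop_size_cat.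
Qed.

(** Expanding the inner value in the basis e_K turns nested operators into products of coefficients;
    [anti_quad] regroups the lengths so that [ainfty_words] applies for each pair of blocks. *)
Lemma AN_ainfty beta I L N (s t : 'rV[C]_n) :
  \sum_(g <- sp beta) \sum_(K : {set 'I_n})
    anti N (fun M M' => AN g I K M (s, t) * AN (beta - g) K L M' (s, t)) = 0.
Proof.
set x := H1 s; set y := H1 t.
pose h g a b c d := mk (beta - g) (nseq a x ++ mk g (nseq b x ++ ebase R I :: nseq c y) :: nseq d y) L.
transitivity (\sum_(g <- sp beta) anti N (fun M M' => anti M (fun b c => anti M' (fun a d => h g a b c d)))).
  apply: eq_bigr => g _; rewrite anti_sum; apply: eq_anti => M M' _.
  transitivity (\sum_(K : {set 'I_n}) anti M (fun b c => anti M' (fun a d =>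
      mk g (nseq b x ++ ebase R I :: nseq c y) K * mk (beta - g) (nseq a x ++ ebase R K :: nseq d y) L))).
    apply: eq_bigr => K _; rewrite /AN mulr_suml; apply: eq_bigr => b _.
    by rewrite mulr_sumr.
  rewrite anti_sum; apply: eq_anti => b c _; rewrite anti_sum; apply: eq_anti => a d _.
  by rewrite /h mk_ebase.
under eq_bigr do rewrite -anti_quad.
rewrite anti_sum; apply: anti0 => l k.
have := congr1 (fun f : ext => f L) (ainfty_words beta I s t l k); rewrite [RHS]ffunE => E.
rewrite -[RHS]E /anti exchange_big /= sum_ffunE; apply: eq_bigr => a _.
rewrite exchange_big /= sum_ffunE; apply: eq_bigr => c _.
by rewrite sum_ffunE.
Qed.

(** Rapid decay allows the two series to be multiplied; the degree [N] part of the sum of products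
    is the relation [AN_ainfty]. *)
Lemma Qcoef_sq p beta I L :
  \sum_(g <- sp beta) \sum_(K : {set 'I_n}) Qcoef th p g I K * Qcoef th p (beta - g) K L = 0.
Proof.
have rap (g : H) K M : exists B, rapid B (fun N => AN g K M N (tt p)).
  have [_ ab] := adm_AN g K M; have [r pr] := bnd_tt u alpha p; have [B hB] := ab r.
  by exists B; exact: hB.
have hQ (g : H) K : has_csum (fun N => anti N (fun M M' => AN g I K M (tt p) * AN (beta - g) K L M' (tt p)))
    (Qcoef th p g I K * Qcoef th p (beta - g) K L).
  by have [A hA] := rap g I K; have [B hB] := rap (beta - g) K L; exact: (cauchy_product hA hB).
have h := has_csum_sum (sp beta) (fun g => has_csum_sum (index_enum _) (hQ g)).
rewrite -(has_csum_eq h); apply: has_csum_eq.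
have := @has_csum_fin R (fun=> 0) 0 (fun _ _ => erefl); rewrite big_ord0.
by congr has_csum; apply/funext => N; rewrite (AN_ainfty beta I L N).
Qed.

End QAlgebra.

(** * Convolution of series in T *)

Section Convolution.
Variables (R : realType) (n : nat) (U : set 'rV[R]_n) (u0 : 'rV[R]_n).
Variable F : fukaya_algebra U u0.
Hypothesis u0U : U u0.
Local Notation C := R[i].
Local Notation H := (dclass F).
Local Notation ser := (H -> {set 'I_n} -> C).
Implicit Types (f g h : ser) (beta : H) (L : {set 'I_n}).

Definition cv f g : ser := fun beta L => \sum_(c <- sp beta) mulw (f c) (g (beta - c)) L.

Lemma Ohol_mulE (f g : TB R n -> ser) p : Ohol_mul f g p = cv (f p) (g p).
Proof.
apply/funext => beta; apply/funext => L; rewrite /Ohol_mul spE//.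
by apply: eq_bigr => c _; rewrite mulwE.
Qed.

Lemma cvA f g h : cv f (cv g h) = cv (cv f g) h.
Proof.
apply/funext => beta; apply/funext => L; rewrite /cv.
transitivity (\sum_(c <- sp beta) \sum_(d <- sp (beta - c))
    mulw (f c) (mulw (g d) (h (beta - c - d))) L).
  by apply: eq_bigr => c _; exact: mulw_sumr.
rewrite (sp_assoc u0U beta (fun c d e => mulw (f c) (mulw (g d) (h e)) L)).
apply: eq_bigr => c _; rewrite [RHS]mulw_suml; apply: eq_bigr => d _.
by rewrite mulwA.
Qed.

Lemma cvDl f f' g beta L : cv (fun b J => f b J + f' b J) g beta L = cv f g beta L + cv f' g beta L.
Proof. by rewrite /cv -big_split; apply: eq_bigr => c _; rewrite mulwDl. Qed.

Lemma cvDr f g g' beta L : cv f (fun b J => g b J + g' b J) beta L = cv f g beta L + cv f g' beta L.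
Proof. by rewrite /cv -big_split; apply: eq_bigr => c _; rewrite mulwDr. Qed.

Lemma cv_suml (T : Type) (r : seq T) (X : T -> ser) g beta L :
  cv (fun b J => \sum_(i <- r) X i b J) g beta L = \sum_(i <- r) cv (X i) g beta L.
Proof.
by rewrite /cv [RHS]exchange_big; apply: eq_bigr => c _; rewrite mulw_suml.
Qed.

Lemma cv_sumr (T : Type) (r : seq T) f (Y : T -> ser) beta L :
  cv f (fun b J => \sum_(i <- r) Y i b J) beta L = \sum_(i <- r) cv f (Y i) beta L.
Proof.
by rewrite /cv [RHS]exchange_big; apply: eq_bigr => c _; rewrite mulw_sumr.
Qed.

Lemma cvZl (a : C) f g beta L : cv (fun b J => a * f b J) g beta L = a * cv f g beta L.
Proof. by rewrite /cv mulr_sumr; apply: eq_bigr => c _; rewrite mulwZl. Qed.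

Lemma Eop_sum (T : Type) (r : seq T) i (X : T -> {set 'I_n} -> C) L :
  Eop i (fun J => \sum_(t <- r) X t J) L = \sum_(t <- r) Eop i (X t) L.
Proof.
rewrite /Eop; case: ifP => _; first by rewrite mulr_sumr.
by rewrite big1.
Qed.

Lemma Eop_cvl i f g beta L : Eop i (cv f g beta) L = cv (fun b => Eop i (f b)) g beta L.
Proof. by rewrite /cv Eop_sum; apply: eq_bigr => c _; rewrite Eop_mulwl. Qed.

Lemma Eop_cvr i f g beta L :
  Eop i (cv f g beta) L = cv (fun b => gs (f b)) (fun b => Eop i (g b)) beta L.
Proof. by rewrite Eop_cvl /cv; apply: eq_bigr => c _; rewrite Eop_mulwr. Qed.

Definition cone : ser := fun beta J => ((beta == 0) && (J == finset.set0))%:R.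

Lemma cv1l f : (forall beta J, f beta J != 0 -> disk_monoid beta) -> cv cone f = f.
Proof.
move=> fG; apply/funext => beta; apply/funext => L; rewrite /cv.
have cE c : mulw (cone c) (f (beta - c)) L = if c == 0 then f beta L else 0.
  have [->|c0] := eqVneq c 0; last first.
    by rewrite mulwE big1// => J _; rewrite /cone (negPf c0) mulr0 mul0r.
  rewrite subr0 -[RHS]mulw1l; apply: eq_mulw => // J; by rewrite /cone eqxx.
under eq_bigr do rewrite cE.
rewrite -big_mkcond; have [fb|fb] := eqVneq (f beta L) 0; first by rewrite fb big1.
have Gb := fG _ _ fb; have s0 : 0 \in sp beta.
  by rewrite mem_sp//; apply/asboolP; rewrite subr0; split=> //; exact: disk_monoid0.
by rewrite (big_rem _ s0)/= eqxx big1_seq ?addr0// => c /andP[/eqP -> ];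
  rewrite mem_rem_uniq ?sp_uniq// !inE eqxx.
Qed.

Lemma cv1r f : (forall beta J, f beta J != 0 -> disk_monoid beta) -> cv f cone = f.
Proof.
move=> fG; apply/funext => beta; apply/funext => L; rewrite /cv.
rewrite (sp_comm u0U beta (fun c e => mulw (f c) (cone e) L)).
have cE c : mulw (f (beta - c)) (cone c) L = if c == 0 then f beta L else 0.
  have [->|c0] := eqVneq c 0; last first.
    by rewrite mulwE big1// => J _; rewrite /cone (negPf c0) mulr0.
  rewrite subr0 -[RHS]mulw1r; apply: eq_mulw => // J; by rewrite /cone eqxx.
under eq_bigr do rewrite cE.
rewrite -big_mkcond; have [fb|fb] := eqVneq (f beta L) 0; first by rewrite fb big1.
have Gb := fG _ _ fb; have s0 : 0 \in sp beta.
  by rewrite mem_sp//; apply/asboolP; rewrite subr0; split=> //; exact: disk_monoid0.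
by rewrite (big_rem _ s0)/= eqxx big1_seq ?addr0// => c /andP[/eqP -> ];
  rewrite mem_rem_uniq ?sp_uniq// !inE eqxx.
Qed.

Lemma cv_neq0 f g beta L : cv f g beta L != 0 -> exists c J K,
  [/\ disk_monoid c, disk_monoid (beta - c), f c J != 0, g (beta - c) K != 0
    & #|L| = (#|J| + #|K|)%N].
Proof.
rewrite /cv => s0; have [c cs m0] : exists2 c, c \in sp beta & mulw (f c) (g (beta - c)) L != 0.
  apply: contrapT => nex; move/eqP: s0; apply; apply: big1_seq => c /andP[_ cs].
  by apply/eqP; apply: contrapT => /negP h; apply: nex; exists c.
move: cs; rewrite mem_sp// => /asboolP[Gc Gbc].
move: m0; rewrite /mulw => /sum_neq0[J _ /sum_neq0[K /eqP JKL]].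
rewrite !mulf_eq0 !negb_or => /andP[/andP[w fJ] gK]; exists c, J, K; split=> //.
have d := wsgn_neq0 w; rewrite -JKL cardsU; apply/eqP.
by move: d; rewrite -finset.setI_eq0 => /eqP ->; rewrite cards0 subn0.
Qed.

End Convolution.

(** * Sheaves of sections extended by zero *)

Section SectionSheaf.
Variables (R : realType) (n : nat) (U : set 'rV[R]_n) (Z : zmodType).
Local Notation TB := (TB R n).
Local Notation T := 'rV[R]_n.
Implicit Types (V W : set T) (x y : TB -> Z).

Lemma zext_in V x p : V p.1 -> zext V x p = x p.
Proof. by move=> Vp; rewrite /zext asboolT. Qed.

Lemma zext_out V x p : ~ V p.1 -> zext V x p = 0.
Proof. by move=> Vp; rewrite /zext asboolF. Qed.

Lemma zext_eq V x y : (forall p, V p.1 -> x p = y p) -> zext V x = zext V y.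
Proof.
move=> xy; apply/funext => p; have [Vp|Vp] := pselect (V p.1).
  by rewrite !zext_in// xy.
by rewrite !zext_out.
Qed.

Lemma zextP V x : zext V x = x <-> forall p, ~ V p.1 -> x p = 0.
Proof.
split=> [<- p Vp|x0]; first by rewrite zext_out.
apply/funext => p; have [Vp|Vp] := pselect (V p.1); first by rewrite zext_in.
by rewrite zext_out// x0.
Qed.

Lemma zextB V x y : zext V (x - y) = zext V x - zext V y.
Proof.
apply/funext => p; rewrite !fctE; have [Vp|Vp] := pselect (V p.1).
  by rewrite !zext_in.
by rewrite !zext_out// subr0.
Qed.

Lemma zext_zext V W x : V `<=` W -> zext V (zext W x) = zext V x.
Proof. by move=> VW; apply: zext_eq => p Vp; rewrite zext_in//; exact: VW. Qed.

(** At each point a member of the cover containing it is chosen; compatibility makes the value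
    independent of the choice, as [glue_in] records. *)
Definition glue (D : set (set T)) (s : set T -> TB -> Z) : TB -> Z := fun p =>
  if pselect (exists2 W, D W & W p.1) is left e then s (xget set0 [set W | D W /\ W p.1]) p else 0.

Lemma glue_in (D : set (set T)) (s : set T -> TB -> Z) W p :
  (forall W W', D W -> D W' -> zext (W `&` W') (s W) = zext (W `&` W') (s W')) ->
  D W -> W p.1 -> glue D s p = s W p.
Proof.
move=> comp DW Wp; rewrite /glue; case: pselect => [e|[]]; last by exists W.
have [DX Xp] : [set W | D W /\ W p.1] (xget set0 [set W | D W /\ W p.1]).
  by apply: xgetI; split; [exact: DW|exact: Wp].
have := congr1 (fun x => x p) (comp _ _ DX DW); rewrite !zext_in//.
Qed.

Lemma glue_out (D : set (set T)) (s : set T -> TB -> Z) p :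
  ~ (\bigcup_(W in D) W) p.1 -> glue D s p = 0.
Proof. by move=> nD; rewrite /glue; case: pselect => // -[W DW Wp]; case: nD; exists W. Qed.

Variable P : set T -> int -> set (TB -> Z).
Variable Dop : (TB -> Z) -> TB -> Z.

(** A common criterion for the algebra and the module. Gluing is pointwise, so what remains is that
    being a section is a local condition and that [Dop] depends only on the values over an open
    set. *)
Lemma sheaf_of_sections :
  (forall V d, P V d 0) ->
  (forall V d x y, opn U V -> P V d x -> P V d y -> P V d (x - y)) ->
  (forall V d x, P V d x -> zext V x = x) ->
  (forall V W d x, opn U W -> W `<=` V -> P V d x -> P W d (zext W x)) ->
  (forall (D : set (set T)) d x, (forall W, D W -> opn U W) -> (forall W, D W -> P W d (zext W x)) ->
     zext (\bigcup_(W in D) W) x = x -> P (\bigcup_(W in D) W) d x) ->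
  (forall V d x, opn U V -> P V d x -> P V (d + 1) (zext V (Dop x))) ->
  (forall V d x y p, opn U V -> P V d x -> P V d y -> V p.1 -> Dop (x - y) p = Dop x p - Dop y p) ->
  (forall V x y p, opn U V -> (forall q, V q.1 -> x q = y q) -> V p.1 -> Dop x p = Dop y p) ->
  (forall V d x p, opn U V -> P V d x -> V p.1 -> Dop (zext V (Dop x)) p = 0) ->
  is_sheaf_of_complexes U
    (@RawComplex _ (TB -> Z) P (fun W x => zext W x) (fun V x => zext V (Dop x))).
Proof.
move=> P0 PB Pz Pr Pg PD DB Dl DD; split=> [V d oV|d D s oD sD comp] /=.
  split.
  - by split=> // x y; exact: PB.
  - by split=> [W x oW WV|W x y oW WV Px Py]; [exact: Pr|exact: zextB].
  - split=> [x|W W' x oW oW' WW WV Px]; first exact: Pz.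
    exact: zext_zext.
  - split=> [x|x y Px Py]; first exact: PD.
    rewrite -zextB; apply: zext_eq => p Vp; rewrite !fctE; exact: (DB V d).
  - split=> [x Px|W x oW WV Px].
      apply/funext => p; have [Vp|Vp] := pselect (V p.1); last by rewrite zext_out.
      by rewrite zext_in//; exact: (DD V d).
    rewrite zext_zext//; apply: zext_eq => p Wp.
    by apply: (Dl W) => // q Wq; rewrite zext_in.
have gE W p : D W -> W p.1 -> glue D s p = s W p by move=> DW Wp; apply: glue_in DW Wp => W1 W2; exact: comp.
have gW W : D W -> zext W (glue D s) = s W.
  move=> DW; rewrite -[RHS](Pz _ _ _ (sD W DW)); apply: zext_eq => p Wp; exact: gE.
exists (glue D s); split=> [|y [Py yW]].
  split=> [|W DW]; last exact: gW.
  apply: Pg => // [W DW|]; first by rewrite gW//; exact: sD.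
  by apply/zextP => p; exact: glue_out.
apply/funext => p; have [[W DW Wp]|nD] := pselect ((\bigcup_(W in D) W) p.1).
  by rewrite (gE W)// -(yW W DW) zext_in.
rewrite glue_out//; have /zextP := Pz _ _ _ Py; by move=> ->.
Qed.

End SectionSheaf.

(** * The sheaf O^hol of dg algebras *)

Section HolomorphicSheaf.
Variables (R : realType) (n : nat) (U : set 'rV[R]_n) (u0 : 'rV[R]_n).
Variable F : fukaya_algebra U u0.
Hypothesis u0U : U u0.
Local Notation C := R[i].
Local Notation H := (dclass F).
Local Notation TB := (TB R n).
Local Notation T := 'rV[R]_n.
Local Notation ser := (H -> {set 'I_n} -> C).
Local Notation G := (@disk_monoid R n U u0 F).
Local Notation sec := (@Ohol_sec R n U u0 F).
Implicit Types (f g h : TB -> ser) (beta : H) (J L : {set 'I_n}) (p q : TB) (V W : set T).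

Definition VT V : set TB := V `*` setT.

Lemma open_VT V : open V -> open (VT V).
Proof.
move=> oV; have -> : VT V = fst @^-1` V by apply/seteqP; split=> [p []//|p Vp]; split.
by apply: open_comp => // p _; exact: cvg_fst.
Qed.

Lemma VTP V p : VT V p <-> V p.1.
Proof. by split=> [[]|]. Qed.

Definition sm V f := forall beta J, csmooth (VT V) (fun q => f q beta J).

Definition bdr beta i : C := (boundary beta 0 i)%:~R.

(** The dx_i component of dbar on the coefficient of T^beta; the subtracted term comes from
    differentiating T^beta itself. *)
Definition delb i f : TB -> ser := fun p beta J =>
  del 'i i (fun q => f q beta J) p - bdr beta i * f p beta J.

Lemma dbarE f p beta J : dbar f p beta J = \sum_i Eop i (delb i f p beta) J.
Proof. by rewrite /dbar big_mkcond. Qed.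

Lemma delb_local i V f g p : open V -> (forall q, V q.1 -> f q = g q) -> V p.1 ->
  delb i f p = delb i g p.
Proof.
move=> oV fg Vp; apply/funext => beta; apply/funext => J; rewrite /delb (fg p Vp).
have VTp : VT V p by exact/VTP.
refine (f_equal (fun z => z - _) _); apply: (eq_del (open_VT oV) 'i i _ VTp).
by move=> q; rewrite inE => /VTP Vq; rewrite fg.
Qed.

Lemma dbar_local V f g p : open V -> (forall q, V q.1 -> f q = g q) -> V p.1 ->
  dbar f p = dbar g p.
Proof.
move=> oV fg Vp; apply/funext => beta; apply/funext => J; rewrite !dbarE.
by apply: eq_bigr => i _; rewrite (delb_local i oV fg Vp).
Qed.

Section OnV.
Variable V : set T.
Hypothesis oV : open V.
Let oVT := open_VT oV.

Lemma eq_sm f g : (forall q, V q.1 -> f q = g q) -> sm V f -> sm V g.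
Proof.
move=> fg fs beta J; apply: (eq_csmooth oVT _ (fs beta J)) => q; rewrite inE => /VTP Vq.
by rewrite fg.
Qed.

Lemma sm_zext f : sm V (zext V f) <-> sm V f.
Proof. by split; apply: eq_sm => q Vq; rewrite zext_in. Qed.

Lemma smB f g : sm V f -> sm V g -> sm V (f - g).
Proof. by move=> fs gs beta J; exact: (csmoothB oVT (fs beta J) (gs beta J)). Qed.

Lemma sm_mulw (x y : TB -> {set 'I_n} -> C) L :
  (forall J, csmooth (VT V) (fun q => x q J)) -> (forall J, csmooth (VT V) (fun q => y q J)) ->
  csmooth (VT V) (fun q => mulw (x q) (y q) L).
Proof.
move=> xs ys.
have -> : (fun q => mulw (x q) (y q) L) = (fun q => \sum_(J : {set 'I_n} | J \subset L)
    wsgn R J (L :\: J)%SET * x q J * y q (L :\: J)%SET).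
  by apply/funext => q; rewrite mulwE.
apply: (csmooth_sum oVT) => J _.
exact: (csmoothM oVT (csmoothZ oVT _ (xs J)) (ys _)).
Qed.

Lemma sm_cv f g : sm V f -> sm V g -> sm V (fun q => cv (f q) (g q)).
Proof.
move=> fs gs beta L; apply: (csmooth_sum oVT) => c _; apply: sm_mulw => J.
  exact: fs.
exact: gs.
Qed.

Lemma sm_delb i f : sm V f -> sm V (delb i f).
Proof.
move=> fs beta J.
exact: (csmoothB oVT (csmooth_del oVT 'i i (fs beta J)) (csmoothZ oVT (bdr beta i) (fs beta J))).
Qed.

Lemma csmooth_Eop i (x : TB -> {set 'I_n} -> C) L :
  (forall J, csmooth (VT V) (fun q => x q J)) -> csmooth (VT V) (fun q => Eop i (x q) L).
Proof.
move=> xs; rewrite /Eop; case: (i \in L); last exact: csmooth_cst.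
exact: (csmoothZ oVT _ (xs _)).
Qed.

Lemma sm_dbar f : sm V f -> sm V (dbar f).
Proof.
move=> fs beta J; have -> : (fun q => dbar f q beta J) = (fun q => \sum_i Eop i (delb i f q beta) J).
  by apply/funext => q; rewrite dbarE.
apply: (csmooth_sum oVT) => i _; apply: csmooth_Eop => K; exact: sm_delb.
Qed.

Lemma del_mulw i (x y : TB -> {set 'I_n} -> C) L p :
  (forall J, csmooth (VT V) (fun q => x q J)) -> (forall J, csmooth (VT V) (fun q => y q J)) ->
  V p.1 ->
  del 'i i (fun q => mulw (x q) (y q) L) p =
  mulw (fun J => del 'i i (fun q => x q J) p) (y p) L + mulw (x p) (fun J => del 'i i (fun q => y q J) p) L.
Proof.
move=> xs ys Vp; have VTp : VT V p by exact/VTP.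
have -> : (fun q => mulw (x q) (y q) L) = (fun q => \sum_(J : {set 'I_n} | J \subset L)
    wsgn R J (L :\: J)%SET * x q J * y q (L :\: J)%SET).
  by apply/funext => q; rewrite mulwE.
rewrite (del_sum oVT 'i i _ (fun J _ => csmoothM oVT (csmoothZ oVT _ (xs J)) (ys _)) VTp).
rewrite !mulwE -big_split; apply: eq_bigr => J _ /=.
by rewrite (delM 'i i (csmoothZ oVT _ (xs J)) (ys _) VTp) (delZ 'i i _ (xs J) VTp).
Qed.

(** The pairing with the boundary is additive in the class, so for the exponents [c] and [beta - c]
    the term from differentiating T^beta splits, and [delb] is a derivation. *)
Lemma delb_cv i f g p : sm V f -> sm V g -> V p.1 ->
  delb i (fun q => cv (f q) (g q)) p =
  (fun beta L => cv (delb i f p) (g p) beta L + cv (f p) (delb i g p) beta L).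
Proof.
move=> fs gs Vp; have VTp : VT V p by exact/VTP.
apply/funext => beta; apply/funext => L; rewrite /delb {1}/cv.
rewrite (del_sum oVT 'i i _ (fun c _ => sm_mulw L (fs c) (gs (beta - c))) VTp).
rewrite /cv mulr_sumr -sumrB -big_split; apply: eq_bigr => c _ /=.
rewrite (del_mulw i L (fs c) (gs (beta - c)) Vp).
have E x (X : {set 'I_n} -> C) : (fun J => x J - X J) = (fun J => x J + (-1) * X J) :> ({set 'I_n} -> C).
  by apply/funext => J; rewrite mulN1r.
rewrite !E !mulwDl !mulwDr !mulwZl !mulwZr.
have -> : bdr beta i = bdr c i + bdr (beta - c) i.
  by rewrite /bdr raddfB !mxE rmorphB addrC subrK.
have alg (A B M r t : C) : A + B - (r + t) * M = A + -1 * (r * M) + (B + -1 * (t * M)) by ring.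
exact: alg.
Qed.

Lemma delbB i f g p : sm V f -> sm V g -> V p.1 -> delb i (f - g) p = delb i f p - delb i g p.
Proof.
move=> fs gs Vp; have VTp : VT V p by exact/VTP.
apply/funext => beta; apply/funext => J; rewrite !fctE /delb.
have -> : del 'i i (fun q => (f - g) q beta J) p
    = del 'i i (fun q => f q beta J) p - del 'i i (fun q => g q beta J) p.
  rewrite (delD 'i i (fs beta J) (csmoothN oVT (gs beta J)) VTp); congr (_ + _).
  rewrite -mulN1r -(delZ 'i i (-1) (gs beta J) VTp); apply: (eq_del oVT) => // q _.
  by rewrite mulN1r.
have alg (A B r x y : C) : A - B - r * (x - y) = A - r * x - (B - r * y) by ring.
exact: alg.
Qed.

Lemma dbarB f g p : sm V f -> sm V g -> V p.1 -> dbar (f - g) p = dbar f p - dbar g p.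
Proof.
move=> fs gs Vp; apply/funext => beta; apply/funext => J.
rewrite !fctE !dbarE -sumrB; apply: eq_bigr => i _; rewrite (delbB i fs gs Vp) /Eop !fctE.
by case: ifP => _; [rewrite mulrBr|rewrite subr0].
Qed.

Lemma delbC i j f p : sm V f -> V p.1 -> delb i (delb j f) p = delb j (delb i f) p.
Proof.
move=> fs Vp; have VTp : VT V p by exact/VTP.
apply/funext => beta; apply/funext => J; have fbJ := fs beta J.
have E k l : delb k (delb l f) p beta J = del 'i k (del 'i l (fun q => f q beta J)) p
    - bdr beta l * del 'i k (fun q => f q beta J) p
    - bdr beta k * (del 'i l (fun q => f q beta J) p - bdr beta l * f p beta J).
  rewrite {1}/delb; congr (_ - _).
  rewrite (delD 'i k (csmooth_del oVT 'i l fbJ) (csmoothN oVT (csmoothZ oVT (bdr beta l) fbJ)) VTp).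
  congr (_ + _); rewrite -(mulN1r (_ * _)) -(delZ 'i k (bdr beta l) fbJ VTp).
  rewrite -(delZ 'i k (-1) (csmoothZ oVT (bdr beta l) fbJ) VTp).
  by apply: (eq_del oVT) => // q _; rewrite mulN1r.
rewrite !E (delC oVT 'i 'i i j fbJ VTp).
have alg (A B D r t x : C) : A - r * B - t * (D - r * x) = A - t * D - r * (B - t * x) by ring.
exact: alg.
Qed.

Lemma delb_Eop i j (f : TB -> ser) p : sm V f -> V p.1 ->
  delb i (fun q beta => Eop j (f q beta)) p = (fun beta => Eop j (delb i f p beta)).
Proof.
move=> fs Vp; have VTp : VT V p by exact/VTP.
apply/funext => beta; apply/funext => J; rewrite /delb /Eop; case: (j \in J).
  rewrite (delZ 'i i _ (fs beta _) VTp).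
  have alg (r t A x : C) : r * A - t * (r * x) = r * (A - t * x) by ring.
  exact: alg.
by rewrite del_cst mulr0 subrr.
Qed.

Lemma delb_sum i (I : Type) (r : seq I) (X : I -> TB -> ser) p : (forall j, sm V (X j)) -> V p.1 ->
  delb i (fun q beta J => \sum_(j <- r) X j q beta J) p
  = (fun beta J => \sum_(j <- r) delb i (X j) p beta J).
Proof.
move=> Xs Vp; have VTp : VT V p by exact/VTP.
apply/funext => beta; apply/funext => J; rewrite /delb.
rewrite (del_sum oVT 'i i r (fun j _ => Xs j beta J) VTp).
by rewrite mulr_sumr -sumrB.
Qed.

(** The operators [delb i] commute and the [Eop i] anticommute, so the double sum equals its own
    negative. *)
Lemma dbar_dbar f p : sm V f -> V p.1 -> dbar (dbar f) p = 0.
Proof.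
move=> fs Vp; apply/funext => beta; apply/funext => J; rewrite dbarE.
have E i : delb i (dbar f) p = fun beta J => \sum_j Eop j (delb i (delb j f) p beta) J.
  have -> : dbar f = (fun q beta J => \sum_j Eop j (delb j f q beta) J).
    by apply/funext => q; apply/funext => b; apply/funext => K; rewrite dbarE.
  have h : forall j, sm V (fun q beta => Eop j (delb j f q beta)).
    by move=> j b K; apply: csmooth_Eop => M; exact: sm_delb.
  refine (etrans (delb_sum i (index_enum _) h Vp) _).
  apply/funext => b; apply/funext => K; apply: eq_bigr => j _.
  by rewrite (delb_Eop i j (sm_delb j fs) Vp).
set S := \sum_i _.
have S2 : S = \sum_i \sum_j Eop i (Eop j (delb i (delb j f) p beta)) J.
  by apply: eq_bigr => i _; rewrite E Eop_sum.
have SN : S = - S.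
  rewrite {1}S2 exchange_big S2 -sumrN; apply: eq_bigr => i _; rewrite -sumrN.
  by apply: eq_bigr => j _; rewrite Eop_anti (delbC j i fs Vp).
have : S + S = 0 by rewrite {1}SN addNr.
rewrite -mulr2n -mulr_natr => /eqP; rewrite mulf_eq0 pnatr_eq0 orbF => /eqP.
exact.
Qed.

Lemma dbar_cv f g p : sm V f -> sm V g -> V p.1 ->
  dbar (fun q => cv (f q) (g q)) p = (fun beta L =>
    cv (dbar f p) (g p) beta L + cv (fun b => gs (f p b)) (dbar g p) beta L).
Proof.
move=> fs gs Vp; apply/funext => beta; apply/funext => L; rewrite dbarE.
have Ed (h : TB -> ser) : dbar h p = (fun b J => \sum_i Eop i (delb i h p b) J).
  by apply/funext => b; apply/funext => J; rewrite dbarE.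
rewrite !Ed cv_suml cv_sumr -big_split; apply: eq_bigr => i _ /=.
rewrite (delb_cv i fs gs Vp) -Eop_cvl -Eop_cvr /Eop.
by case: ifP => _; [rewrite mulrDr|rewrite addr0].
Qed.

Lemma dbar_gs f p : sm V f -> V p.1 ->
  dbar (fun q beta => gs (f q beta)) p = (fun beta J => - gs (dbar f p beta) J).
Proof.
move=> fs Vp; have VTp : VT V p by exact/VTP.
apply/funext => beta; apply/funext => J; rewrite dbarE.
rewrite /gs dbarE mulr_sumr -sumrN; apply: eq_bigr => i _.
have -> : delb i (fun q b J => (-1) ^+ #|J| * f q b J) p beta = gs (delb i f p beta).
  apply/funext => K; rewrite /delb /gs (delZ 'i i _ (fs beta K) VTp).
  have alg (r t A x : C) : r * A - t * (r * x) = r * (A - t * x) by ring.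
  exact: alg.
by rewrite Eop_gs.
Qed.

End OnV.

Lemma OsecP V d f : sec V d f <-> [/\ forall p, ~ V p.1 -> f p = 0, sm V f,
  forall p beta J, f p beta J != 0 -> #|J|%:Z + maslov beta = d &
  forall p beta J, f p beta J != 0 -> G beta].
Proof.
split=> [[/zextP f0 fs fd /(novikov_suppE u0U) fG]|[f0 fs fd fG]].
  by split=> // p beta J fn; apply: fG; exists p, J.
split=> //; first exact/zextP.
by apply/(novikov_suppE u0U) => beta [p [J fn]]; exact: fG fn.
Qed.

Lemma osec0 V d : sec V d 0.
Proof.
apply/OsecP; split=> // [beta J|p beta J|p beta J]; rewrite ?eqxx//.
exact: csmooth_cst.
Qed.

Lemma osecB V d f g : open V -> sec V d f -> sec V d g -> sec V d (f - g).
Proof.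
move=> oV /OsecP[f0 fs fd fG] /OsecP[g0 gs gd gG].
have nz p beta J : (f - g) p beta J != 0 -> f p beta J != 0 \/ g p beta J != 0.
  rewrite !fctE; have [->|] := eqVneq (f p beta J) 0; last by left.
  by rewrite sub0r oppr_eq0; right.
apply/OsecP; split=> [p Vp||p beta J /nz[/fd|/gd]|p beta J /nz[/fG|/gG]] //.
  by have -> : (f - g) p = f p - g p by []; rewrite f0// g0// subrr.
exact: smB.
Qed.

Lemma osecN V d f : open V -> sec V d f -> sec V d (- f).
Proof. by move=> oV fs; rewrite -sub0r; apply: osecB => //; exact: osec0. Qed.

Lemma osecD V d f g : open V -> sec V d f -> sec V d g -> sec V d (f + g).
Proof. by move=> oV fs gs; rewrite -[g]opprK; apply: osecB => //; exact: osecN. Qed.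

Lemma csmooth_sub (W W' : set TB) (k : TB -> C) : W' `<=` W -> csmooth W k -> csmooth W' k.
Proof. by move=> WW [k1 k2]; split=> s q /WW; [exact: k1|exact: k2]. Qed.

Lemma osec_zext V W d f : open W -> W `<=` V -> sec V d f -> sec W d (zext W f).
Proof.
move=> oW WV /OsecP[f0 fs fd fG].
have nz p beta J : zext W f p beta J != 0 -> f p beta J != 0.
  have [Wp|Wp] := pselect (W p.1); first by rewrite zext_in.
  by rewrite zext_out ?eqxx.
apply/OsecP; split=> [p Wp||p beta J /nz/fd|p beta J /nz/fG] //; first by rewrite zext_out.
apply/sm_zext => // beta J; apply: csmooth_sub (fs beta J).
by move=> q /VTP Wq; apply/VTP/WV.
Qed.

Lemma osec_glue (D : set (set T)) d f : (forall W, D W -> open W) ->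
  (forall W, D W -> sec W d (zext W f)) -> zext (\bigcup_(W in D) W) f = f ->
  sec (\bigcup_(W in D) W) d f.
Proof.
move=> oD sD /zextP f0.
have loc p beta J : f p beta J != 0 -> exists W, [/\ D W, W p.1 & zext W f p = f p].
  move=> fn; have [[W DW Wp]|nW] := pselect ((\bigcup_(W in D) W) p.1); last first.
    by rewrite f0 ?eqxx// in fn.
  by exists W; rewrite zext_in.
apply/OsecP; split=> // [beta J|p beta J fn|p beta J fn].
- split=> s q /VTP[W DW Wq]; have /OsecP[_ fs _ _] := sD W DW;
    have [f1 f2] := (sm_zext (oD W DW) f).1 fs beta J.
    by apply: f1; exact/VTP.
  by apply: f2; exact/VTP.
- have [W [DW Wp E]] := loc p beta J fn; have /OsecP[_ _ fd _] := sD W DW.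
  by apply: (fd p); rewrite E.
- have [W [DW Wp E]] := loc p beta J fn; have /OsecP[_ _ _ fG] := sD W DW.
  by apply: (fG p beta J); rewrite E.
Qed.

Lemma delb_neq0 i V f p beta J : open V -> (forall q, f q beta J = 0) ->
  delb i f p beta J = 0.
Proof.
move=> oV f0; rewrite /delb f0 mulr0 subr0.
by rewrite (_ : (fun q => _) = (fun=> 0)) ?del_cst//; apply/funext.
Qed.

Lemma dbar_neq0 f p beta J : dbar f p beta J != 0 -> exists q K,
  [/\ f q beta K != 0 & #|J| = #|K|.+1].
Proof.
rewrite dbarE => /sum_neq0[i _]; rewrite /Eop; case: ifP => iJ; last by rewrite eqxx.
rewrite mulf_eq0 negb_or => /andP[_ dn].
have [q fq] : exists q, f q beta (J :\ i)%SET != 0.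
  apply: contrapT => nq; move/eqP: dn; apply.
  apply: (@delb_neq0 i setT) => [|q]; first exact: openT.
  by apply/eqP; apply: contrapT => /negP h; apply: nq; exists q.
by exists q, (J :\ i)%SET; split=> //; rewrite (cardsD1 i) iJ.
Qed.

Lemma osec_dbar V d f : open V -> sec V d f -> sec V (d + 1) (zext V (dbar f)).
Proof.
move=> oV /OsecP[f0 fs fd fG].
have nz p beta J : zext V (dbar f) p beta J != 0 -> dbar f p beta J != 0.
  have [Vp|Vp] := pselect (V p.1); first by rewrite zext_in.
  by rewrite zext_out ?eqxx.
apply/OsecP; split=> [p Vp||p beta J /nz/dbar_neq0[q [K [fn JK]]]|
    p beta J /nz/dbar_neq0[q [K [fn JK]]]]; first by rewrite zext_out.
- by apply/(sm_zext oV); exact: (sm_dbar oV fs).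
- by rewrite -(fd _ _ _ fn) JK -addn1 PoszD addrAC.
- exact: fG fn.
Qed.

Lemma osec_mul V a b f g : open V -> sec V a f -> sec V b g -> sec V (a + b) (Ohol_mul f g).
Proof.
move=> oV /OsecP[f0 fs fd fG] /OsecP[g0 gs gd gG].
have E : Ohol_mul f g = (fun p => cv (f p) (g p)) by apply/funext => p; rewrite Ohol_mulE.
rewrite E; apply/OsecP; split=> [p Vp||p beta L|p beta L].
- apply/funext => beta; apply/funext => L; rewrite f0//.
  by rewrite /cv big1// => c _; rewrite mulwE big1// => J _; rewrite ?(mulr0, mul0r).
- exact: sm_cv.
- move=> /(cv_neq0 u0U)[c [J [K [_ _ fn gn ->]]]].
  rewrite -(fd _ _ _ fn) -(gd _ _ _ gn) raddfB PoszD.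
  by move: (maslov beta) (maslov c) => m m'; ring.
- move=> /(cv_neq0 u0U)[c [J [K [Gc Gb _ _ _]]]].
  by have := disk_monoidD Gb Gc; rewrite subrK.
Qed.

Lemma osec_sheaf : is_sheaf_of_complexes U (@Ohol R n U u0 F).
Proof.
apply: (@sheaf_of_sections R n U _ sec (@dbar R n U u0 F)).
- exact: osec0.
- by move=> V d x y [oV _]; exact: osecB.
- by move=> V d x [].
- by move=> V W d x [oW _]; exact: osec_zext.
- by move=> D d x oD; apply: osec_glue => W /oD[].
- by move=> V d x [oV _]; exact: osec_dbar.
- by move=> V d x y p [oV _] /OsecP[_ xs _ _] /OsecP[_ ys _ _]; exact: dbarB.
- by move=> V x y p [oV _]; exact: dbar_local.
- move=> V d x p [oV _] /OsecP[_ xs _ _] Vp.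
  by rewrite (@dbar_local V _ (dbar x))// ?(dbar_dbar oV)// => q Vq; rewrite zext_in.
Qed.

(** Maslov indices are even, so the parity of the total degree [a] is that of the form degree, and
    the Koszul sign can be read off from [J]. *)
Lemma gs_sgz V a f p beta : sec V a f -> gs (f p beta) = sgz_act a (f p beta).
Proof.
move=> /OsecP[_ _ fd _]; apply/funext => J; rewrite /gs /sgz_act.
have [f0|fn] := eqVneq (f p beta J) 0.
  by rewrite f0 mulr0; case: odd; rewrite ?fctE f0 ?oppr0.
have := fd _ _ _ fn; have [c ->] := maslov_even beta; move=> dE.
have -> : odd `|a|%N = odd #|J|.
  by rewrite -dE; lia.
rewrite -signr_odd; case: (odd #|J|); rewrite ?fctE /= ?expr0 ?expr1 ?mulN1r ?mul1r//.
Qed.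

Lemma Ohol_dgalg : is_dgalg U (@Ohol R n U u0 F).
Proof.
split; first exact: osec_sheaf.
move=> V [oV VU]; have oneE W p : W p.1 -> @Ohol_one R n U u0 F W p = @cone R n U u0 F.
  by move=> Wp; rewrite /Ohol_one zext_in.
split=> /=.
- split.
    apply/OsecP; split=> [p Vp||p beta J|p beta J]; first by rewrite /Ohol_one zext_out.
    + by apply/sm_zext => // beta J; exact: csmooth_cst.
    + have [Vp|Vp] := pselect (V p.1); last by rewrite /Ohol_one zext_out ?eqxx.
      rewrite (oneE V)// /cone; case: (beta =P 0) => [->|_]; last by rewrite eqxx.
      by case: (J =P _) => [->|_]; rewrite ?eqxx//= cards0 raddf0.
    + have [Vp|Vp] := pselect (V p.1); last by rewrite /Ohol_one zext_out ?eqxx.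
      rewrite (oneE V)// /cone; case: (beta =P 0) => [->|_]; last by rewrite eqxx.
      by move=> _; exact: disk_monoid0.
  by move=> W [oW _] WV; rewrite /Ohol_one zext_zext.
- move=> a x /OsecP[x0 _ _ xG]; split; apply/funext => p; rewrite Ohol_mulE//.
    have [Vp|Vp] := pselect (V p.1); first by rewrite oneE// cv1l//; exact: xG.
    rewrite x0//; apply/funext => beta; apply/funext => L.
    by rewrite /cv big1// => c _; rewrite mulwE big1// => J _; rewrite mulr0.
  have [Vp|Vp] := pselect (V p.1); first by rewrite oneE// cv1r//; exact: xG.
  rewrite x0//; apply/funext => beta; apply/funext => L.
  by rewrite /cv big1// => c _; rewrite mulwE big1// => J _; rewrite ?(mulr0, mul0r).
- move=> a b x y xs ys; split; first exact: osec_mul.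
    move=> W oW WV; apply/funext => p; rewrite Ohol_mulE//.
    have [Wp|Wp] := pselect (W p.1); first by rewrite !zext_in// Ohol_mulE.
    rewrite !zext_out//; apply/funext => beta; apply/funext => L.
    by rewrite /cv big1// => c _; rewrite mulwE big1// => J _; rewrite ?(mulr0, mul0r).
  apply/funext => p; have /OsecP[x0 xs' _ _] := xs; have /OsecP[y0 ys' _ _] := ys.
  have z0 (f g : TB -> ser) : f p = 0 -> Ohol_mul f g p = 0.
    move=> f0; rewrite Ohol_mulE// f0; apply/funext => beta; apply/funext => L.
    by rewrite /cv big1// => c _; rewrite mulwE big1// => J _; rewrite ?(mulr0, mul0r).
  have sgp (f : TB -> ser) : sgz_act a f p = sgz_act a (f p) by rewrite /sgz_act; case: odd.
  have [Vp|Vp] := pselect (V p.1); last first.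
    rewrite zext_out// fctE sgp (z0 _ _ (x0 p Vp)) z0 ?zext_out//.
    by rewrite /sgz_act; case: odd; rewrite ?oppr0 addr0.
  rewrite fctE sgp zext_in// !Ohol_mulE// !zext_in//.
  have -> : Ohol_mul x y = (fun p => cv (x p) (y p)) by apply/funext => q; rewrite Ohol_mulE.
  rewrite (dbar_cv oV xs' ys' Vp); apply/funext => beta; apply/funext => L; rewrite !fctE.
  congr (_ + _); have -> : (fun b => gs (x p b)) = (fun b => sgz_act a (x p b)).
    by apply/funext => b0; exact: (gs_sgz p b0 xs).
  rewrite /sgz_act; case: odd => //; rewrite !fctE -mulN1r -cvZl; congr cv.
  by apply/funext => b0; apply/funext => J; rewrite !fctE mulN1r.
- move=> a b x x' y _ _ _; split; apply/funext => p; rewrite fctE !Ohol_mulE// fctE;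
    apply/funext => beta; apply/funext => L; rewrite !fctE.
    by rewrite !Ohol_mulE//; exact: cvDl.
  by rewrite !Ohol_mulE//; exact: cvDr.
- move=> a b c x y z _ _ _; apply/funext => p; rewrite !Ohol_mulE// cvA//.
Qed.

End HolomorphicSheaf.

(** * The dg module Phi *)

Section TwistedModule.
Variables (R : realType) (n : nat) (U : set 'rV[R]_n) (u0 : 'rV[R]_n).
Variable F : fukaya_algebra U u0.
Hypothesis u0U : U u0.
Local Notation C := R[i].
Local Notation H := (dclass F).
Local Notation TB := (TB R n).
Local Notation T := 'rV[R]_n.
Local Notation ser := (H -> {set 'I_n} -> C).
Local Notation phi := (TB -> H -> {set 'I_n} -> {set 'I_n} -> C).
Local Notation G := (@disk_monoid R n U u0 F).
Local Notation sec := (@Ohol_sec R n U u0 F).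
Local Notation psec := (@Phi_sec R n U u0 F).
Hypothesis m0 : forall beta, @mk R n U u0 F beta [::] = 0.
Variables (u : T) (alpha : 'rV[C]_n).
Local Notation th := (theta u alpha).
Implicit Types (f g : phi) (beta : H) (I J K L : {set 'I_n}) (p q : TB) (V W : set T).

(** The e_I component. As a graded module Phi is a finite sum of copies of the algebra, so supports,
    smoothness and degrees are checked on these components. *)
Definition slice f I : TB -> ser := fun p beta J => f p beta J I.

Definition qs I K : TB -> ser := fun p beta J =>
  Qcoef th p beta I K * (J == finset.set0)%:R.

Lemma sm_qs V I K : open V -> sm V (qs I K).
Proof.
move=> oV beta J; rewrite /qs; have Qs := csmooth_Qcoef u alpha (VT V) beta I K.
exact: (csmoothM (open_VT oV) Qs (csmooth_cst (VT V) _)).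
Qed.

(** Holomorphy of the matrix of Q: the derivative found in [del_Qcoef] is cancelled by the
    connection on T^beta. *)
Lemma delb_qs i I K p : delb i (qs I K) p = 0.
Proof.
apply/funext => beta; apply/funext => J; rewrite -[RHS]/(0 : C) /delb /qs.
have Qs := csmooth_Qcoef u alpha (VT setT) beta I K.
have pT : VT setT p by [].
have -> : del 'i i (fun q => Qcoef th q beta I K * (J == finset.set0)%:R) p
    = (J == finset.set0)%:R * del 'i i (fun q => Qcoef th q beta I K) p.
  rewrite -(delZ 'i i _ Qs pT); apply: (eq_del (open_VT openT)) => // q _.
  by rewrite mulrC.
by rewrite del_Qcoef /bdr; ring.
Qed.

Lemma dbar_qs I K p : dbar (qs I K) p = 0.
Proof.
apply/funext => beta; apply/funext => J; rewrite dbarE big1// => i _.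
by rewrite delb_qs /Eop; case: ifP => // _; exact: mulr0.
Qed.

Lemma cv_qs (x : ser) I K p beta L :
  cv x (qs I K p) beta L = \sum_(c <- sp beta) x c L * Qcoef th p (beta - c) I K.
Proof.
apply: eq_bigr => c _; rewrite /qs mulwZr mulw1r mulrC//.
Qed.

Lemma gs_cv_qs (x : ser) I K p : (fun b => gs (cv x (qs I K p) b)) = cv (fun b => gs (x b)) (qs I K p).
Proof.
apply/funext => beta; apply/funext => L; rewrite cv_qs /gs cv_qs mulr_sumr.
by apply: eq_bigr => c _; rewrite mulrA.
Qed.

Lemma qs_sq I L p : (fun beta J => \sum_(K : {set 'I_n}) cv (qs I K p) (qs K L p) beta J) = 0.
Proof.
apply/funext => beta; apply/funext => J; rewrite -[RHS]/(0 : C).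
under eq_bigr do rewrite cv_qs.
rewrite exchange_big /= /qs.
transitivity (\sum_(c <- sp beta) \sum_(K : {set 'I_n}) Qcoef th p c I K * Qcoef th p (beta - c) K L
   * (J == finset.set0)%:R).
  by apply: eq_bigr => c _; apply: eq_bigr => K _; rewrite mulrAC.
under eq_bigr do rewrite -mulr_suml.
by rewrite -mulr_suml Qcoef_sq ?mul0r.
Qed.

Lemma qs_neq0 I K p beta J : qs I K p beta J != 0 ->
  [/\ J = finset.set0, #|K|%:Z + maslov beta = #|I|%:Z + 1 & G beta].
Proof.
rewrite /qs mulf_eq0 negb_or => /andP[Qn J0].
split; [|exact: Qcoef_degree Qn|].
  by move: J0; case: (J =P finset.set0) => //; rewrite eqxx.
by apply: contrapT => nG; move: Qn; rewrite Qcoef_supp ?eqxx.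
Qed.

Lemma osec_qs V I K : open V -> sec V (#|I|%:Z + 1 - #|K|%:Z) (zext V (qs I K)).
Proof.
move=> oV; have nz p beta J : zext V (qs I K) p beta J != 0 -> qs I K p beta J != 0.
  have [Vp|Vp] := pselect (V p.1); first by rewrite zext_in.
  by rewrite zext_out ?eqxx.
apply/(OsecP u0U); split=> [p Vp||p beta J /nz/qs_neq0[-> E _]|p beta J /nz/qs_neq0[]//].
- by rewrite zext_out.
- by apply/(sm_zext oV); exact: sm_qs.
- by rewrite cards0 -E; ring.
Qed.

(** The differential in matrix form: dbar on each component, plus right multiplication by the
    sections [qs I K] with the sign of the form degree. *)
Lemma PhiE f p beta J K : Phi_dif th f p beta J K = dbar (slice f K) p beta J
  + \sum_(I : {set 'I_n}) cv (fun b => gs (slice f I p b)) (qs I K p) beta J.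
Proof.
rewrite /Phi_dif; congr (_ + _); rewrite /Qop spE// exchange_big /=.
apply: eq_bigr => I _; rewrite cv_qs /gs /slice.
rewrite (sp_comm u0U beta (fun c d => (-1) ^+ #|J| * f p c J I * Qcoef th p d I K)).
by [].
Qed.

Lemma PsecP V d f : psec V d f <-> forall I, sec V (d - #|I|%:Z) (slice f I).
Proof.
split=> [[/zextP f0 fs fd /(novikov_suppE u0U) fG] I|fs].
  apply/(OsecP u0U); split=> [p Vp||p beta J fn|p beta J fn].
  - by apply/funext => b; apply/funext => J; rewrite /slice f0.
  - by move=> beta J; exact: fs.
  - by rewrite -(fd _ _ _ _ fn); ring.
  - by apply: fG; exists p, J, I.
have f' I := (OsecP u0U _ _ _).1 (fs I).
split.
- apply/zextP => p Vp; apply/funext => b; apply/funext => J; apply/funext => I.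
  have [f0 _ _ _] := f' I; exact: (congr1 (fun h => h b J) (f0 p Vp)).
- by move=> beta J I; have [_ s _ _] := f' I; exact: s.
- move=> p beta J I fn; have [_ _ fd _] := f' I; have := fd _ _ _ fn.
  by move=> E; rewrite -[RHS](subrK #|I|%:Z) -E; ring.
- apply/(novikov_suppE u0U) => beta [p [J [I fn]]].
  by have [_ _ _ fG] := f' I; exact: fG fn.
Qed.

Lemma slice_zext V f I : slice (zext V f) I = zext V (slice f I).
Proof.
apply/funext => p; have [Vp|Vp] := pselect (V p.1).
  by apply/funext => b; apply/funext => J; rewrite /slice !zext_in.
by apply/funext => b; apply/funext => J; rewrite /slice !zext_out.
Qed.

Lemma osec_sum (I : Type) (r : seq I) V d (X : I -> TB -> ser) : open V ->
  (forall i, sec V d (X i)) -> sec V d (\sum_(i <- r) X i).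
Proof.
move=> oV Xs; elim: r => [|i r IHr]; first by rewrite big_nil; exact: (osec0 F u0U).
by rewrite big_cons; apply: (osecD u0U).
Qed.

Lemma osec_gs V d (x : TB -> ser) : open V -> sec V d x -> sec V d (fun p b => gs (x p b)).
Proof.
move=> oV /(OsecP u0U)[x0 xs xd xG].
have nz p b J : gs (x p b) J != 0 -> x p b J != 0.
  by rewrite /gs mulf_eq0 negb_or => /andP[].
apply/(OsecP u0U); split=> [p Vp||p b J /nz/xd|p b J /nz/xG] //.
  by apply/funext => b; apply/funext => J; rewrite x0// /gs; exact: mulr0.
by move=> b J; exact: (csmoothZ (open_VT oV) _ (xs b J)).
Qed.

Lemma ser_sumE (I : Type) (r : seq I) (X : I -> TB -> ser) p b J :
  (\sum_(i <- r) X i) p b J = \sum_(i <- r) X i p b J.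
Proof. by rewrite !fct_sumE. Qed.

Lemma slice_dif V f K : zext V (slice (Phi_dif th f) K) = zext V (dbar (slice f K))
  + \sum_(I : {set 'I_n}) Ohol_mul (fun p b => gs (zext V (slice f I) p b)) (zext V (qs I K)).
Proof.
apply/funext => p; apply/funext => b; apply/funext => J.
have addE (x y : TB -> ser) : (x + y) p b J = x p b J + y p b J by [].
rewrite addE ser_sumE.
have [Vp|Vp] := pselect (V p.1).
  rewrite !zext_in// [LHS]PhiE; congr (_ + _); apply: eq_bigr => I _.
  by rewrite Ohol_mulE// !zext_in.
rewrite !zext_out// big1 ?addr0// => I _; rewrite Ohol_mulE// !zext_out//.
by rewrite /cv big1// => c _; rewrite mulwE big1// => J' _; exact: mulr0.
Qed.

Lemma psec_dif V d f : open V -> psec V d f -> psec V (d + 1) (zext V (Phi_dif th f)).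
Proof.
move=> oV /PsecP fs; apply/PsecP => K; rewrite slice_zext slice_dif.
apply: (osecD u0U) => //.
  have -> : d + 1 - #|K|%:Z = d - #|K|%:Z + 1 by ring.
  exact: (osec_dbar u0U).
apply: osec_sum => // I.
have -> : d + 1 - #|K|%:Z = (d - #|I|%:Z) + (#|I|%:Z + 1 - #|K|%:Z) by ring.
apply: (osec_mul u0U) => //; last exact: osec_qs.
apply: osec_gs => //; have /(OsecP u0U)[f0 _ _ _] := fs I.
by have /zextP -> := f0.
Qed.

Lemma dif_local V f g p : open V -> (forall q, V q.1 -> f q = g q) -> V p.1 ->
  Phi_dif th f p = Phi_dif th g p.
Proof.
move=> oV fg Vp; apply/funext => b; apply/funext => J; apply/funext => K; rewrite !PhiE.
have sl I q : V q.1 -> slice f I q = slice g I q.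
  by move=> Vq; apply/funext => b'; apply/funext => J'; rewrite /slice fg.
rewrite (dbar_local oV (sl K) Vp); congr (_ + _); apply: eq_bigr => I _.
by rewrite sl.
Qed.

Definition psm V f := forall I, sm V (slice f I).

Lemma psec_psm V d f : psec V d f -> psm V f.
Proof. by move=> /PsecP fs I; have /(OsecP u0U)[] := fs I. Qed.

Lemma difB V f g p : open V -> psm V f -> psm V g -> V p.1 ->
  Phi_dif th (f - g) p = Phi_dif th f p - Phi_dif th g p.
Proof.
move=> oV fs gs' Vp; apply/funext => b; apply/funext => J; apply/funext => K.
rewrite !fctE !PhiE.
have -> : dbar (slice (f - g) K) p b J = dbar (slice f K) p b J - dbar (slice g K) p b J.
  by have := dbarB oV (fs K) (gs' K) Vp => /(congr1 (fun h => h b J)).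
rewrite opprD addrACA; congr (_ + _); rewrite -sumrB; apply: eq_bigr => I _.
rewrite !cv_qs -sumrB; apply: eq_bigr => c _.
rewrite /gs /slice !fctE; ring.
Qed.

Lemma dbarD V (x y : TB -> ser) p : open V -> sm V x -> sm V y -> V p.1 ->
  dbar (x + y) p = dbar x p + dbar y p.
Proof.
move=> oV xs ys Vp; have ny : sm V (- y).
  by move=> b J; exact: (csmoothN (open_VT oV) (ys b J)).
have z0 : dbar (- y) p = - dbar y p.
  have zs : sm V (0 : TB -> ser) by move=> b J; exact: csmooth_cst.
  have := dbarB oV zs ys Vp; rewrite sub0r => ->.
  have -> : dbar (0 : TB -> ser) p = 0; last by rewrite sub0r.
  apply/funext => b; apply/funext => J; rewrite dbarE big1// => i _.
  rewrite /Eop; case: ifP => // _; rewrite (delb_neq0 i p (openT : open [set: T]))//.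
  exact: mulr0.
by rewrite -[y in x + y]opprK (dbarB oV xs ny Vp) z0 opprK.
Qed.

Lemma sm_sum (I : Type) (r : seq I) V (X : I -> TB -> ser) : open V ->
  (forall i, sm V (X i)) -> sm V (\sum_(i <- r) X i).
Proof.
move=> oV Xs b J; apply: (eq_csmooth (open_VT oV) _
  (csmooth_sum (open_VT oV) r (fun i (_ : xpredT i) => Xs i b J))) => q _.
by rewrite !fct_sumE.
Qed.

Lemma dbar_sum (I : Type) (r : seq I) V (X : I -> TB -> ser) p : open V ->
  (forall i, sm V (X i)) -> V p.1 ->
  dbar (\sum_(i <- r) X i) p = \sum_(i <- r) dbar (X i) p.
Proof.
move=> oV Xs Vp; elim: r => [|i r IHr].
  rewrite !big_nil; have zs : sm V (0 : TB -> ser) by move=> b J; exact: csmooth_cst.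
  by have := dbarB oV zs zs Vp; rewrite subrr => ->; rewrite subrr.
by rewrite !big_cons (dbarD oV (Xs i) (sm_sum r oV Xs) Vp) IHr.
Qed.

(** With the differential written as dbar + Q, the mixed terms cancel because [qs] is dbar-closed
    and dbar anticommutes with the sign [gs]. In the square of Q the two signs compensate, and
    [qs_sq] applies. *)
Lemma dif_dif V f p : open V -> psm V f -> V p.1 -> Phi_dif th (Phi_dif th f) p = 0.
Proof.
move=> oV fs Vp; apply/funext => b; apply/funext => J; apply/funext => L; rewrite PhiE.
pose X I K : TB -> ser := fun q => cv (fun b => gs (slice f I q b)) (qs I K q).
have Xs I K : sm V (X I K).
  apply: sm_cv => //; last exact: sm_qs.
  by move=> b' J'; exact: (csmoothZ (open_VT oV) _ (fs I b' J')).
have sE K : slice (Phi_dif th f) K = dbar (slice f K) + \sum_(I : {set 'I_n}) X I K.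
  apply/funext => q; apply/funext => b'; apply/funext => J'; rewrite /slice PhiE !fctE.
  by rewrite !fct_sumE.
have gss I : sm V (fun q b' => gs (slice f I q b')).
  by move=> b' J'; exact: (csmoothZ (open_VT oV) _ (fs I b' J')).
have dX I K b' J' : dbar (X I K) p b' J' = - cv (fun b'' => gs (dbar (slice f I) p b'')) (qs I K p) b' J'.
  rewrite (dbar_cv oV (gss I) (@sm_qs V I K oV) Vp) dbar_qs.
  have -> : cv (fun b0 => gs (gs (slice f I p b0))) 0 b' J' = 0.
    by rewrite /cv big1// => c _; rewrite mulwE big1// => M _; exact: mulr0.
  rewrite addr0 (dbar_gs (fs I) Vp) !cv_qs -sumrN; apply: eq_bigr => c _.
  by rewrite mulNr.
rewrite sE (dbarD oV (sm_dbar oV (fs L)) (sm_sum _ oV (fun I => Xs I L)) Vp).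
rewrite (dbar_sum _ oV (fun I => Xs I L) Vp) (dbar_dbar oV (fs L) Vp) add0r !fct_sumE.
under eq_bigr do rewrite dX.
have E K : cv (fun b0 => gs (slice (Phi_dif th f) K p b0)) (qs K L p) b J =
    cv (fun b0 => gs (dbar (slice f K) p b0)) (qs K L p) b J
    + \sum_(I : {set 'I_n}) cv (slice f I p) (cv (qs I K p) (qs K L p)) b J.
  rewrite sE.
  transitivity (cv (fun b0 => gs (dbar (slice f K) p b0)) (qs K L p) b J
     + \sum_(I : {set 'I_n}) cv (fun b0 => gs (X I K p b0)) (qs K L p) b J).
    rewrite -cv_suml -cvDl !cv_qs; apply: eq_bigr => c _; congr (_ * _).
    rewrite /gs !fctE !fct_sumE; move: (dbar _ _ _ _) => A.
    by rewrite mulrDr mulr_sumr.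
  congr (_ + _); apply: eq_bigr => I _; rewrite cvA//; congr cv.
  rewrite /X gs_cv_qs; congr cv; apply/funext => b'; apply/funext => J'.
  by rewrite gsK.
under [X in _ + X]eq_bigr do rewrite E.
rewrite big_split /= addrA sumrN addNr add0r exchange_big /= big1// => I _.
rewrite -cv_sumr qs_sq.
by rewrite /cv big1// => c _; rewrite mulwE big1// => M _; exact: mulr0.
Qed.

Lemma Phi_sheaf : is_sheaf_of_complexes U (@Phi_tau R n U u0 F th).
Proof.
apply: (@sheaf_of_sections R n U _ psec (@Phi_dif R n U u0 F th)).
- by move=> V d; apply/PsecP => I; exact: (osec0 F u0U).
- move=> V d x y [oV _] /PsecP xs /PsecP ys; apply/PsecP => I; exact: (osecB u0U oV (xs I) (ys I)).
- by move=> V d x [].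
- move=> V W d x [oW _] WV /PsecP xs; apply/PsecP => I; rewrite slice_zext.
  exact: (osec_zext u0U oW WV (xs I)).
- move=> D d x oD sD /zextP x0; apply/PsecP => I; apply: (osec_glue u0U) => [W /oD[]//|W DW|].
    by rewrite -slice_zext; have /PsecP := sD W DW; apply.
  by apply/zextP => p Vp; apply/funext => b; apply/funext => J; rewrite /slice x0.
- by move=> V d x [oV _]; exact: psec_dif.
- by move=> V d x y p [oV _] /psec_psm xs /psec_psm ys; exact: difB.
- by move=> V x y p [oV _]; exact: dif_local.
- move=> V d x p [oV _] /psec_psm xs Vp.
  rewrite (@dif_local V _ (Phi_dif th x))// ?(dif_dif oV)// => q Vq.
  by rewrite zext_in.
Qed.

Lemma gs_mulw (x y : {set 'I_n} -> C) L : gs (mulw x y) L = mulw (gs x) (gs y) L.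
Proof.
rewrite /gs !mulwE mulr_sumr; apply: eq_bigr => J JL.
rewrite -(cardsID J L) (finset.setIidPr JL) exprD; ring.
Qed.

Lemma gs_cv (x y : ser) : (fun b => gs (cv x y b)) = cv (fun b => gs (x b)) (fun b => gs (y b)).
Proof.
apply/funext => b; apply/funext => L; rewrite /cv /gs mulr_sumr; apply: eq_bigr => c _.
exact: gs_mulw.
Qed.

Lemma cv0l (y : ser) b L : cv (0 : ser) y b L = 0.
Proof.
rewrite /cv big1// => c _; rewrite mulwE big1// => J _; rewrite [X in X * _]mulr0; exact: mul0r.
Qed.

(** Apart from the Leibniz rule, the axioms of the action are those of the algebra applied to a
    slice. *)
Lemma Phi_dgmod : is_dgmod U (@Phi_tau R n U u0 F th).
Proof.
split; first exact: Phi_sheaf.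
have aE (g : TB -> ser) f p b J I : Phi_act g f p b J I = cv (g p) (slice f I p) b J.
  by rewrite /Phi_act Ohol_mulE.
have aS (g : TB -> ser) f I : slice (Phi_act g f) I = Ohol_mul g (slice f I) by [].
have ext4 (f g : phi) : (forall p b J I, f p b J I = g p b J I) -> f = g.
  by move=> fg; apply/funext => p; apply/funext => b; apply/funext => J; apply/funext => I.
have [_ OA] := Ohol_dgalg F u0U.
move=> V oVU; have [oV VU] := oVU; have [OA1 OA2 OA3 OA4 OA5] := OA V oVU; split=> /=.
- move=> d f /PsecP fs; apply: ext4 => p b J I.
  have [E _] := OA2 _ _ (fs I).
  exact: (congr1 (fun h : TB -> ser => h p b J) E).
- move=> a d x f xs fs; have /PsecP fs' := fs; split.
  + apply/PsecP => I; rewrite aS -addrA; exact: (osec_mul u0U).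
  + move=> W oW WV; apply: ext4 => p b J I.
    have [_ E _] := OA3 _ _ _ _ xs (fs' I).
    have := congr1 (fun h : TB -> ser => h p b J) (E W oW WV).
    rewrite /= -slice_zext => E'; apply: etrans E'.
    by rewrite -aS -slice_zext.
  + apply: ext4 => p b J K.
    have sgE (X : phi) : (sgz_act a X) p b J K = sgz_act a (X p b J K) by rewrite /sgz_act; case: odd.
    have addE (X Y : phi) : (X + Y) p b J K = X p b J K + Y p b J K by [].
    rewrite addE sgE !aE; have /(OsecP u0U)[x0 xsm _ _] := xs.
    have [Vp|Vp] := pselect (V p.1); last first.
      rewrite zext_out// zext_out// x0// !cv0l /sgz_act; case: odd; rewrite ?oppr0 addr0//.
    rewrite zext_in// PhiE aS; have fsm := psec_psm fs.
    have -> : Ohol_mul x (slice f K) = (fun q => cv (x q) (slice f K q)).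
      by apply/funext => q; rewrite Ohol_mulE.
    rewrite (dbar_cv oV xsm (fsm K) Vp) zext_in// -addrA; congr (_ + _).
    have sE : slice (zext V (Phi_dif th f)) K p = (fun b J => dbar (slice f K) p b J
        + \sum_(I : {set 'I_n}) cv (fun b => gs (slice f I p b)) (qs I K p) b J).
      by apply/funext => b'; apply/funext => J'; rewrite slice_zext zext_in// /slice PhiE.
    have xE : cv (fun b0 => gs (x p b0)) (slice (zext V (Phi_dif th f)) K p) b J =
        sgz_act a (cv (x p) (slice (zext V (Phi_dif th f)) K p) b J).
      have -> : (fun b0 => gs (x p b0)) = (fun b0 => sgz_act a (x p b0)).
        by apply/funext => b0; exact: (gs_sgz u0U p b0 xs).
      rewrite /sgz_act; case: odd => //; rewrite -mulN1r -cvZl; congr cv.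
      by apply/funext => b0; apply/funext => J0; rewrite mulN1r.
    rewrite -xE sE cvDr cv_sumr; congr (_ + _); apply: eq_bigr => I _.
    rewrite cvA//; congr cv; rewrite -gs_cv; apply/funext => b0; congr gs.
    by rewrite /slice /Phi_act; apply/funext => J0; rewrite Ohol_mulE.
- move=> a d x x' f xs xs' /PsecP fs; apply: ext4 => p b J I.
  have [E _] := OA4 _ _ _ _ _ xs xs' (fs I).
  exact: (congr1 (fun h : TB -> ser => h p b J) E).
- move=> a d x f g xs /PsecP fs /PsecP gs'; apply: ext4 => p b J I.
  have [_ E] := OA4 _ _ _ _ _ (fs I) (gs' I) xs.
  exact: (congr1 (fun h : TB -> ser => h p b J) E).
- move=> a b' d x y f xs ys /PsecP fs; apply: ext4 => p b J I.
  have E := OA5 _ _ _ _ _ _ xs ys (fs I).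
  exact: (congr1 (fun h : TB -> ser => h p b J) E).
Qed.

End TwistedModule.

(** * The skyscraper module and the evaluation map *)

Section Skyscraper.
Variables (R : realType) (n : nat) (U : set 'rV[R]_n) (u0 : 'rV[R]_n).
Variable F : fukaya_algebra U u0.
Hypothesis u0U : U u0.
Local Notation C := R[i].
Local Notation H := (dclass F).
Local Notation TB := (TB R n).
Local Notation T := 'rV[R]_n.
Local Notation ser := (H -> {set 'I_n} -> C).
Local Notation phi := (TB -> H -> {set 'I_n} -> {set 'I_n} -> C).
Local Notation G := (@disk_monoid R n U u0 F).
Local Notation sec := (@Ohol_sec R n U u0 F).
Local Notation psec := (@Phi_sec R n U u0 F).
Variables (u : T) (alpha : 'rV[C]_n).
Local Notation th := (theta u alpha).
Local Notation ssec := (@sky_sec R n U u0 F u).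
Local Notation sky := (@skyscraper R n U u0 F u alpha).
Local Notation pt := (TBpoint u alpha).
Implicit Types (f : phi) (a m : H -> C) (beta : H) (I J K L : {set 'I_n}) (V W : set T).

Lemma ssecP V d a : ssec V d a <-> [/\ ~ V u -> a = 0,
  forall beta, a beta != 0 -> maslov beta = d - n%:Z & forall beta, a beta != 0 -> G beta].
Proof.
by split=> -[a0 ad aG]; split=> //; move: aG => /(novikov_suppE u0U).
Qed.

Lemma cv_set0 (x y : ser) beta :
  cv x y beta finset.set0 = \sum_(c <- sp beta) x c finset.set0 * y (beta - c) finset.set0.
Proof.
apply: eq_bigr => c _; rewrite mulwE (big_pred1 finset.set0) => [|J]; last first.
  by rewrite finset.subset0.
by rewrite finset.setD0 wsgn0l mul1r.
Qed.

(** An element of the stalk is read as a series constant in the form index. The empty-set component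
    of a convolution sees only empty-set components, so the algebra of [cv] carries over. *)
Lemma skyE (g : TB -> ser) a :
  mod_act (r := sky) g a = (fun beta => cv (g pt) (fun b _ => a b) beta finset.set0).
Proof. by apply/funext => beta; rewrite /= cv_set0 spE. Qed.

Lemma sky_sheaf : is_sheaf_of_complexes U sky.
Proof.
split.
  move=> V d [oV VU]; split=> /=.
  - split=> [|x y /ssecP[x0 xd xG] /ssecP[y0 yd yG]].
      by apply/ssecP; split=> // beta; rewrite eqxx.
    have nz b : (x - y) b != 0 -> x b != 0 \/ y b != 0.
      rewrite !fctE; have [->|] := eqVneq (x b) 0; last by left.
      by rewrite sub0r oppr_eq0; right.
    apply/ssecP; split=> [Vu|b /nz[/xd|/yd]|b /nz[/xG|/yG]] //.
    by rewrite x0// y0// subrr.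
  - split=> [W x oW WV /ssecP[x0 xd xG]|W x y _ _ _ _]; last first.
      by case: asboolP => // _; rewrite subrr.
    by case: asboolP => Wu; apply/ssecP; split=> // beta; rewrite eqxx.
  - split=> [x /ssecP[x0 _ _]|W W' x _ _ W'W _ _].
      by case: asboolP => // /x0 ->.
    by case: asboolP => // W'u; case: asboolP => // -[]; exact: W'W.
  - split=> [x _|x y _ _]; last by rewrite subrr.
    by apply/ssecP; split=> // beta; rewrite eqxx.
  - by split=> // W x _ _ _; case: asboolP.
move=> d D s oD sD eD; have [[W DW Wu]|nD] := pselect ((\bigcup_(W in D) W) u).
  have /ssecP[_ sd sG] := sD W DW; exists (s W); split=> [|x [xD xs]]; last first.
    by rewrite -(xs W DW) /=; case: asboolP.
  split=> [|W' DW' /=]; first by apply/ssecP; split=> // nD; case: nD; exists W.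
  case: asboolP => W'u; last by have /ssecP[->] := sD W' DW'.
  by have /= := eD W W' DW DW'; case: asboolP => // -[].
exists 0; split=> [|x [/ssecP[x0 _ _] _]]; last by rewrite x0.
split=> [|W DW /=]; first by apply/ssecP; split=> // beta; rewrite eqxx.
have nW : ~ W u by move=> Wu; apply: nD; exists W.
by have /ssecP[-> //] := sD W DW; case: asboolP.
Qed.

Lemma dbar_set0 (x : TB -> ser) p beta : dbar x p beta finset.set0 = 0.
Proof. by rewrite /dbar big_pred0// => i; rewrite inE. Qed.

Lemma cv_set0_eq0 (x y : ser) beta :
  (forall c, x c finset.set0 = 0) \/ (forall c, y c finset.set0 = 0) -> cv x y beta finset.set0 = 0.
Proof.
move=> h; rewrite cv_set0 big1// => c _; case: h => ->; rewrite ?mul0r ?mulr0//.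
Qed.

Lemma sky_dgmod : is_dgmod U sky.
Proof.
split; first exact: sky_sheaf.
have sky0 V d m beta : ssec V d m -> ~ V u -> m beta = 0 by move=> /ssecP[m0 _ _] /m0 ->.
have sgE (e : int) (x : H -> C) beta : sgz_act e x beta = sgz_act e (x beta).
  by rewrite /sgz_act; case: odd.
move=> V [oV VU]; split.
- move=> d m ms; rewrite skyE; apply/funext => beta; have [Vu|Vu] := pselect (V u).
    have -> : @alg_one _ (@Ohol R n U u0 F) V pt = cone (F := F) by rewrite /= /Ohol_one zext_in.
    have := @cv1l R n U u0 F u0U (fun b (J : {set 'I_n}) => m b).
    have /ssecP[_ _ mG] := ms; move=> /(_ (fun b _ => @mG b)).
    by move/(congr1 (fun h : ser => h beta finset.set0)).
  rewrite (sky0 _ _ _ _ ms Vu); apply: cv_set0_eq0; right => c; exact: sky0 ms Vu.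
- move=> e d x m xs ms; have /(OsecP u0U)[x0 _ xd xG] := xs; have /ssecP[m0 md mG] := ms; split.
  + rewrite skyE; apply/ssecP; split=> [Vu|b|b].
    * by apply/funext => b; apply: cv_set0_eq0; right => c; exact: sky0 ms Vu.
    * rewrite cv_set0 => /sum_neq0[c _]; rewrite mulf_eq0 negb_or => /andP[/xd xc /md mc].
      have -> : maslov b = maslov c + maslov (b - c) by rewrite -raddfD addrC subrK.
      by rewrite mc -xc cards0; ring.
    * rewrite cv_set0 => /sum_neq0[c _]; rewrite mulf_eq0 negb_or => /andP[/xG xc /mG mc].
      by rewrite -(subrK c b) addrC; exact: disk_monoidD.
  + move=> W oW WV; rewrite !skyE; apply/funext => b /=.
    case: asboolP => Wu; last by apply/esym; apply: cv_set0_eq0; right.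
    by rewrite /= zext_in.
  + apply/funext => b; rewrite !skyE !fctE sgE /=.
    rewrite !cv_set0_eq0 /sgz_act; first by case: odd; rewrite ?oppr0 addr0.
      by right.
    left => c; have [Vp|Vp] := pselect (V u); first by rewrite zext_in// dbar_set0.
    by rewrite zext_out.
- move=> e d x x' m _ _ _; rewrite !skyE; apply/funext => b; exact: cvDl.
- move=> e d x m m' _ _ _; rewrite !skyE; apply/funext => b.
  exact: (cvDr (x pt) (fun b _ => m b) (fun b _ => m' b)).
- move=> e e' d x y m _ _ _; rewrite !skyE; apply/funext => b /=; rewrite Ohol_mulE// -cvA//.
  by rewrite !cv_set0; apply: eq_bigr => c _.
Qed.

Definition evt (V : set T) f : H -> C := fun beta => f pt beta finset.set0 [set: 'I_n]%SET.

Hypothesis alphaI : purely_imaginary alpha.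

Lemma tau_theta_pt : tau pt = th pt.
Proof.
apply/matrixP => i j; rewrite !mxE /= ?mxE subrr.
case: (alpha 0 j) (alphaI j) => a b /= ->; apply/eqP.
by rewrite eq_complex /= ?mxE; apply/andP; split; apply/eqP; ring.
Qed.

(** dbar has no component of form degree zero, which leaves Q; its coefficients into the top class
    are killed by [Qcoef_top]. *)
Lemma evt_dif f V : V u -> evt V (zext V (Phi_dif th f)) = 0.
Proof.
move=> Vu; apply/funext => b; rewrite /evt zext_in// PhiE// dbar_set0 add0r big1// => I _.
rewrite cv_qs big1// => c _; rewrite Qcoef_top ?mulr0//; exact: tau_theta_pt.
Qed.

Lemma evt_hom : is_dgmod_hom U (M := @Phi_tau R n U u0 F th) (N := sky) evt.
Proof.
move=> V d [oV VU]; split.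
- move=> f fs; have [f0 _ fd /(novikov_suppE u0U) fG] := fs; apply/ssecP; split=> [Vu|b fb|b fb].
  + by apply/funext => b; rewrite /evt -f0 zext_out.
  + have := fd _ _ _ _ fb; rewrite cards0 cardsT card_ord => <-; ring.
  + by apply: fG; exists pt, finset.set0, [set: 'I_n]%SET.
- by [].
- move=> W f oW WV _; apply/funext => b /=; case: asboolP => Wu; first by rewrite /evt zext_in.
  by rewrite /evt zext_out.
- move=> f _; have [Vu|Vu] := pselect (V u); first exact: evt_dif.
  by apply/funext => b; rewrite /evt /= zext_out.
- move=> e x f _ _; rewrite skyE; apply/funext => b.
  by rewrite /evt /= /Phi_act Ohol_mulE// !cv_set0.
Qed.

End Skyscraper.

(** * The Laplacian of the Koszul differential *)

Section KoszulAlgebra.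
Variables (R : realType) (n : nat).
Local Notation C := R[i].
Implicit Types (x y : {set 'I_n} -> C) (L K J I : {set 'I_n}) (i j k : 'I_n).

Lemma eq_Eop i x y L : (forall J, #|L| = #|J|.+1 -> x J = y J) -> Eop i x L = Eop i y L.
Proof.
by move=> xy; rewrite /Eop; case: ifP => // iL; rewrite xy// (finset.cardsD1 i L) iL.
Qed.

Lemma eq_Iop i x y L : (forall J, #|J| = #|L|.+1 -> x J = y J) -> Iop i x L = Iop i y L.
Proof.
by move=> xy; rewrite /Iop; case: ifP => // iL; rewrite xy// finset.cardsU1 iL.
Qed.

Lemma EopZ a i x L : Eop i (fun J => a * x J) L = a * Eop i x L.
Proof. by rewrite /Eop; case: ifP => _; rewrite ?mulr0//; ring. Qed.

Lemma IopZ a i x L : Iop i (fun J => a * x J) L = a * Iop i x L.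
Proof. by rewrite /Iop; case: ifP => _; rewrite ?mulr0//; ring. Qed.

Lemma EopD i x y L : Eop i (fun J => x J + y J) L = Eop i x L + Eop i y L.
Proof. by rewrite /Eop; case: ifP => _; rewrite ?addr0//; ring. Qed.

Lemma IopD i x y L : Iop i (fun J => x J + y J) L = Iop i x L + Iop i y L.
Proof. by rewrite /Iop; case: ifP => _; rewrite ?addr0//; ring. Qed.

Lemma Iop_sum (T : Type) (r : seq T) i (X : T -> {set 'I_n} -> C) L :
  Iop i (fun J => \sum_(t <- r) X t J) L = \sum_(t <- r) Iop i (X t) L.
Proof.
rewrite /Iop; case: ifP => _; last by rewrite mulr_sumr.
by rewrite big1.
Qed.

Lemma Eop_sign i x L : Eop i (fun J => (-1) ^+ #|J| * x J) L = - ((-1) ^+ #|L| * Eop i x L).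
Proof.
by rewrite -mulNr -EopZ; apply: eq_Eop => J ->; rewrite exprS mulN1r opprK.
Qed.

Lemma Iop_sign i x L : Iop i (fun J => (-1) ^+ #|J| * x J) L = - ((-1) ^+ #|L| * Iop i x L).
Proof.
by rewrite -mulNr -IopZ; apply: eq_Iop => J ->; rewrite exprS mulN1r.
Qed.

Lemma Eop_Iop k i (X : {set 'I_n} -> {set 'I_n} -> C) L K :
  Eop k (fun J => Iop i (X J) K) L = Iop i (fun I => Eop k (X^~ I) L) K.
Proof. by rewrite /Eop /Iop; case: ifP => _; case: ifP => _; rewrite ?mulr0//; ring. Qed.

(** [Eop j] yields at most one summand, so compatibility of [Lam] with scalars suffices. *)
Lemma lin_Eop (TT : Type) (Lam : (TT -> C) -> C) (f : TT -> {set 'I_n} -> C) j L :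
  (forall r J, Lam (fun q => r * f q J) = r * Lam (f^~ J)) ->
  Lam (fun q => Eop j (f q) L) = Eop j (fun J => Lam (f^~ J)) L.
Proof.
move=> lam; rewrite /Eop; case: ifP => _; first exact: lam.
rewrite -[RHS](mul0r (Lam (f^~ L))) -lam; congr Lam; apply/funext => q.
by rewrite mul0r.
Qed.

Lemma lin_Iop (TT : Type) (Lam : (TT -> C) -> C) (f : TT -> {set 'I_n} -> C) j L :
  (forall r J, Lam (fun q => r * f q J) = r * Lam (f^~ J)) ->
  Lam (fun q => Iop j (f q) L) = Iop j (fun J => Lam (f^~ J)) L.
Proof.
move=> lam; rewrite /Iop; case: ifP => _; last exact: lam.
rewrite -[RHS](mul0r (Lam (f^~ L))) -lam; congr Lam; apply/funext => q.
by rewrite mul0r.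
Qed.

Lemma CliffordC i j x J : Eop j (Iop i x) J + Iop i (Eop j x) J = (i == j)%:R * x J.
Proof. by rewrite addrC Clifford. Qed.

(** The number operator: contracting by [k] and multiplying back returns [x] when [k] is in [L] and
    gives zero otherwise. The opposite order counts the complement. *)
Lemma sum_Eop_Iop x L : \sum_k Eop k (Iop k x) L = #|L|%:R * x L.
Proof.
rewrite (eq_bigr (fun k => if k \in L then x L else 0)) => [|k _].
  by rewrite -big_mkcond sumr_const mulr_natl.
rewrite /Eop /Iop; case: ifP => // kL; rewrite !inE eqxx /= finset.setD1K//.
by rewrite mulrA sg_sq ?mul1r// !inE eqxx.
Qed.

Lemma sum_Iop_Eop x K : \sum_k Iop k (Eop k x) K = (n - #|K|)%:R * x K.
Proof.
have E k : Iop k (Eop k x) K = x K - Eop k (Iop k x) K.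
  by rewrite -[x K]mul1r -[1]/((true : bool)%:R) -(eqxx k) -Clifford addrK.
under eq_bigr do rewrite E.
rewrite sumrB sum_Eop_Iop sumr_const card_ord natrB; last by rewrite -[X in (_ <= X)%N](card_ord n) max_card.
by rewrite mulrBl (mulr_natl (x K) n).
Qed.

Variables (z zb : 'I_n -> C).

(* The exponent of the weight with which the component [(L, K)] is integrated
   along rays. *)
Definition hwt L K := (#|L| + (n - #|K|))%N.

Lemma leq_card_ord K : (#|K| <= n)%N.
Proof. by rewrite -[X in (_ <= X)%N](card_ord n) max_card. Qed.

(* The Laplacian of the Koszul differential; [A m L K], ... stand for the
   radial integrals of weight [m] of a form, of its derivatives along the
   conjugate coordinates, of those along the coordinates, and of the second
   derivatives. *)
Lemma koszul_laplacian (A : nat -> {set 'I_n} -> {set 'I_n} -> C)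
    (B D : 'I_n -> nat -> {set 'I_n} -> {set 'I_n} -> C)
    (E : 'I_n -> 'I_n -> nat -> {set 'I_n} -> {set 'I_n} -> C) L K :
  let m := hwt L K in let S := (-1) ^+ #|L| in
  (\sum_k Eop k (fun J =>
     \sum_j (2 * (k == j)%:R * Iop j (fun J' => A (hwt J K) J' K) J
             + zb j * Iop j (fun J' => B k (hwt J K).+1 J' K) J)
     + (-1) ^+ #|J| * \sum_i Iop i (fun I => E i k (hwt J K).-1.+1 J I) K) L
   + S * \sum_i z i * Eop i (fun I =>
       \sum_j zb j * Iop j (fun J => A (hwt L I) J I) L
       + S * \sum_l Iop l (fun I' => D l (hwt L I).-1 L I') I) K)
  + (\sum_j zb j * Iop j (fun J => \sum_k Eop k (fun J' => B k m J' K) J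
        + (-1) ^+ #|J| * \sum_i z i * Eop i (fun I => A m.+1 J I) K) L
     + S * \sum_i Iop i (fun I => \sum_j Eop j (fun J' => E i j m.-1 J' I) L
        + S * \sum_l (2 * (i == l)%:R * Eop l (fun I' => A m.-1 L I') I
                      + z l * Eop l (fun I' => D i m.-1.+1 L I') I)) K)
  = 2 * m%:R * A m.-1 L K + \sum_j zb j * B j m L K + \sum_i z i * D i m L K.
Proof.
move=> m S; have SS : S * S = 1 by rewrite -expr2 sqrr_sign.
have Kn := leq_card_ord K.
(* In [T1] and [T6] a derivative hits a coordinate; they count the elements of [L] and of the
   complement of [K], whence the weight. In [T2] and [T5] anticommutators produce the two halves of
   the Euler field, and in [T3] and [T4] operators on different slots cancel by their signs. *)
have T1 : \sum_k Eop k (fun J => \sum_j 2 * (k == j)%:R * Iop j (fun J' => A (hwt J K) J' K) J) L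
    = 2 * (#|L|%:R * A m.-1 L K).
  rewrite -(sum_Eop_Iop (fun J => A m.-1 J K)) mulr_sumr; apply: eq_bigr => k _.
  rewrite -EopZ; apply: eq_Eop => J LJ; rewrite (bigD1 k)//= eqxx mulr1 big1 ?addr0 => [|j jk].
    by rewrite /m /hwt LJ.
  by rewrite eq_sym (negPf jk) mulr0 mul0r.
have T2 : \sum_k Eop k (fun J => \sum_j zb j * Iop j (fun J' => B k (hwt J K).+1 J' K) J) L
   + \sum_j zb j * Iop j (fun J => \sum_k Eop k (fun J' => B k m J' K) J) L = \sum_j zb j * B j m L K.
  have -> : \sum_k Eop k (fun J => \sum_j zb j * Iop j (fun J' => B k (hwt J K).+1 J' K) J) L
     = \sum_j zb j * \sum_k Eop k (Iop j (fun J' => B k m J' K)) L.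
    under [RHS]eq_bigr do rewrite mulr_sumr.
    rewrite [RHS]exchange_big; apply: eq_bigr => k _; rewrite Eop_sum; apply: eq_bigr => j _.
    rewrite EopZ; congr (_ * _); apply: eq_Eop => J LJ.
    by have -> : (hwt J K).+1 = m by rewrite /m /hwt LJ.
  rewrite -big_split; apply: eq_bigr => j _ /=; rewrite -mulrDr Iop_sum -big_split /=.
  congr (_ * _); rewrite (bigD1 j)//= CliffordC eqxx mul1r big1 ?addr0// => k kj.
  by rewrite CliffordC eq_sym (negPf kj) mul0r.
have T3 : \sum_k Eop k (fun J => (-1) ^+ #|J| * \sum_i Iop i (fun I => E i k (hwt J K).-1.+1 J I) K) L
   + S * \sum_i Iop i (fun I => \sum_j Eop j (fun J' => E i j m.-1 J' I) L) K = 0.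
  have -> : \sum_i Iop i (fun I => \sum_j Eop j (fun J' => E i j m.-1 J' I) L) K =
     \sum_j \sum_i Eop j (fun J' => Iop i (E i j m.-1 J') K) L.
    rewrite exchange_big; apply: eq_bigr => i _; rewrite Iop_sum; apply: eq_bigr => j _.
    by rewrite Eop_Iop.
  rewrite mulr_sumr -big_split big1// => k _ /=; rewrite Eop_sign addrC; apply/eqP; rewrite subr_eq0.
  apply/eqP; congr (_ * _); rewrite -Eop_sum; apply: eq_Eop => J LJ; apply: eq_bigr => i _.
  (* [I] has one element more than [K], so [K] is not full and the weight is positive: the truncated
     predecessors agree. *)
  apply: eq_Iop => I KI; have := leq_card_ord I; rewrite KI => Kn'.
  by have -> : m.-1 = (hwt J K).-1.+1 by rewrite /m /hwt LJ; move: Kn'; clear; lia.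
have T4 : S * \sum_i z i * Eop i (fun I => \sum_j zb j * Iop j (fun J => A (hwt L I) J I) L) K
   + \sum_j zb j * Iop j (fun J => (-1) ^+ #|J| * \sum_i z i * Eop i (fun I => A m.+1 J I) K) L = 0.
  have -> : \sum_i z i * Eop i (fun I => \sum_j zb j * Iop j (fun J => A (hwt L I) J I) L) K =
     \sum_j zb j * Iop j (fun J => \sum_i z i * Eop i (fun I => A m.+1 J I) K) L.
    under [RHS]eq_bigr do rewrite Iop_sum mulr_sumr.
    rewrite [RHS]exchange_big; apply: eq_bigr => i _; rewrite Eop_sum mulr_sumr.
    apply: eq_bigr => j _; rewrite EopZ IopZ [RHS]mulrCA; do 2!congr (_ * _).
    rewrite -Eop_Iop; apply: eq_Eop => I KI.
    have -> // : hwt L I = m.+1.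
    by rewrite /m /hwt; move: Kn; rewrite KI; clear; lia.
  rewrite mulr_sumr -big_split big1// => j _ /=; rewrite Iop_sign -/S.
  set X := Iop _ _ _; move: X => X; ring.
have T5 : S * \sum_i z i * Eop i (fun I => S * \sum_l Iop l (fun I' => D l (hwt L I).-1 L I') I) K
   + S * \sum_i Iop i (fun I => S * \sum_l z l * Eop l (fun I' => D i m.-1.+1 L I') I) K
   = \sum_i z i * D i m L K.
  have -> : \sum_i z i * Eop i (fun I => S * \sum_l Iop l (fun I' => D l (hwt L I).-1 L I') I) K
     = S * \sum_i z i * \sum_l Eop i (Iop l (D l m L)) K.
    rewrite mulr_sumr; apply: eq_bigr => i _; rewrite EopZ mulrCA; do 2!congr (_ * _).
    rewrite -Eop_sum; apply: eq_Eop => I KI; apply: eq_bigr => l _.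
    have -> // : (hwt L I).-1 = m.
    by rewrite /m /hwt; move: Kn; rewrite KI; clear; lia.
  have -> : \sum_i Iop i (fun I => S * \sum_l z l * Eop l (fun I' => D i m.-1.+1 L I') I) K
     = S * \sum_i z i * \sum_l Iop l (Eop i (D l m L)) K.
    under [in RHS]eq_bigr do rewrite mulr_sumr.
    rewrite [in RHS]exchange_big mulr_sumr; apply: eq_bigr => l _; rewrite IopZ; congr (_ * _).
    rewrite (eq_bigr (fun i => Iop l (fun I => z i * Eop i (D l m L) I) K)) => [|i _]; last by rewrite IopZ.
    rewrite -Iop_sum; apply: eq_Iop => I KI; apply: eq_bigr => i _.
    have -> // : m.-1.+1 = m.
    by rewrite /m /hwt; have := leq_card_ord I; rewrite KI; clear; lia.
  rewrite !mulrA SS !mul1r -big_split; apply: eq_bigr => i _ /=; rewrite -mulrDr -big_split /=.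
  congr (_ * _); rewrite (bigD1 i)//= CliffordC eqxx mul1r big1 ?addr0// => l li.
  by rewrite CliffordC (negPf li) mul0r.
have T6 : S * \sum_i Iop i (fun I => S * \sum_l 2 * (i == l)%:R * Eop l (fun I' => A m.-1 L I') I) K
   = 2 * ((n - #|K|)%:R * A m.-1 L K).
  rewrite -(sum_Iop_Eop (A m.-1 L)) !mulr_sumr; apply: eq_bigr => i _.
  rewrite IopZ mulrA SS mul1r -IopZ; apply: eq_Iop => I _.
  rewrite (bigD1 i)//= eqxx mulr1 big1 ?addr0// => l li.
  by rewrite eq_sym (negPf li) mulr0 mul0r.
have -> : 2 * m%:R * A m.-1 L K = 2 * (#|L|%:R * A m.-1 L K) + 2 * ((n - #|K|)%:R * A m.-1 L K).
  by rewrite /m /hwt natrD; ring.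
rewrite -T1 -T2 -T5 -T6.
have S1 : \sum_k Eop k (fun J =>
     \sum_j (2 * (k == j)%:R * Iop j (fun J' => A (hwt J K) J' K) J
             + zb j * Iop j (fun J' => B k (hwt J K).+1 J' K) J)
     + (-1) ^+ #|J| * \sum_i Iop i (fun I => E i k (hwt J K).-1.+1 J I) K) L
  = \sum_k Eop k (fun J => \sum_j 2 * (k == j)%:R * Iop j (fun J' => A (hwt J K) J' K) J) L
  + \sum_k Eop k (fun J => \sum_j zb j * Iop j (fun J' => B k (hwt J K).+1 J' K) J) L
  + \sum_k Eop k (fun J => (-1) ^+ #|J| * \sum_i Iop i (fun I => E i k (hwt J K).-1.+1 J I) K) L.
  rewrite -!big_split; apply: eq_bigr => k _ /=; rewrite EopD; congr (_ + _).
  by rewrite -EopD; apply: eq_Eop => J _; rewrite big_split.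
have S2 : \sum_i z i * Eop i (fun I =>
       \sum_j zb j * Iop j (fun J => A (hwt L I) J I) L
       + S * \sum_l Iop l (fun I' => D l (hwt L I).-1 L I') I) K
  = \sum_i z i * Eop i (fun I => \sum_j zb j * Iop j (fun J => A (hwt L I) J I) L) K
  + \sum_i z i * Eop i (fun I => S * \sum_l Iop l (fun I' => D l (hwt L I).-1 L I') I) K.
  by rewrite -big_split; apply: eq_bigr => i _ /=; rewrite EopD mulrDr.
have S3 : \sum_j zb j * Iop j (fun J => \sum_k Eop k (fun J' => B k m J' K) J
        + (-1) ^+ #|J| * \sum_i z i * Eop i (fun I => A m.+1 J I) K) L
  = \sum_j zb j * Iop j (fun J => \sum_k Eop k (fun J' => B k m J' K) J) L
  + \sum_j zb j * Iop j (fun J => (-1) ^+ #|J| * \sum_i z i * Eop i (fun I => A m.+1 J I) K) L.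
  by rewrite -big_split; apply: eq_bigr => i _ /=; rewrite IopD mulrDr.
have S4 : \sum_i Iop i (fun I => \sum_j Eop j (fun J' => E i j m.-1 J' I) L
        + S * \sum_l (2 * (i == l)%:R * Eop l (fun I' => A m.-1 L I') I
                      + z l * Eop l (fun I' => D i m.-1.+1 L I') I)) K
  = \sum_i Iop i (fun I => \sum_j Eop j (fun J' => E i j m.-1 J' I) L) K
  + (\sum_i Iop i (fun I => S * \sum_l 2 * (i == l)%:R * Eop l (fun I' => A m.-1 L I') I) K
  + \sum_i Iop i (fun I => S * \sum_l z l * Eop l (fun I' => D i m.-1.+1 L I') I) K).
  rewrite -!big_split; apply: eq_bigr => k _ /=; rewrite IopD; congr (_ + _).
  by rewrite -IopD; apply: eq_Iop => J _; rewrite big_split mulrDr.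
rewrite S1 S2 S3 S4 {S1 S2 S3 S4}.
have alg (s a1 a2 a3 a4 a5 a6 a7 a8 a9 a10 : C) : a1 + s * a2 = 0 -> s * a3 + a4 = 0 ->
    a5 + a6 + a1 + s * (a3 + a7) + (a8 + a4 + s * (a2 + (a9 + a10)))
    = a5 + s * a9 + (a6 + a8) + (s * a7 + s * a10).
  move=> h1 h2; rewrite -[RHS]addr0 -h1 -[RHS]addr0 -h2; ring.
exact: alg T3 T4.
Qed.
End KoszulAlgebra.

(** * Homotopy by integration along rays *)

Section RadialHomotopy.
Variables (R : realType) (n : nat).
Local Notation TB := (TB R n).
Local Notation C := R[i].
Local Notation frm := (TB -> {set 'I_n} -> {set 'I_n} -> C).
Variables (c : TB) (W : set TB).
Hypothesis oW : open W.
Implicit Types (f g : frm) (L K J I : {set 'I_n}) (i j k : 'I_n) (q : TB).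

Definition fsm f := forall L K, csmooth W (fun q => f q L K).

(* The part of the differential of [Phi] that preserves the exponent of [T],
   where [b] is the boundary of that exponent. *)
Definition koszul (b : 'I_n -> C) f : frm := fun q L K =>
  \sum_j Eop j (fun J => del 'i j (fun p => f p J K) q - b j * f q J K) L
  + (-1) ^+ #|L| * \sum_i zc c i q * Eop i (f q L) K.

Lemma fsm_Eop1 j f L K : fsm f -> csmooth W (fun p => Eop j (fun J => f p J K) L).
Proof. by move=> fs; rewrite /Eop; case: (j \in L); [exact: (csmoothZ oW _ (fs _ K))|exact: csmooth_cst]. Qed.

Lemma fsm_Eop2 j f L K : fsm f -> csmooth W (fun p => Eop j (f p L) K).
Proof. by move=> fs; rewrite /Eop; case: (j \in K); [exact: (csmoothZ oW _ (fs L _))|exact: csmooth_cst]. Qed.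

Lemma fsm_Iop1 j f L K : fsm f -> csmooth W (fun p => Iop j (fun J => f p J K) L).
Proof. by move=> fs; rewrite /Iop; case: (j \in L); [exact: csmooth_cst|exact: (csmoothZ oW _ (fs _ K))]. Qed.

Lemma fsm_Iop2 j f L K : fsm f -> csmooth W (fun p => Iop j (f p L) K).
Proof. by move=> fs; rewrite /Iop; case: (j \in K); [exact: csmooth_cst|exact: (csmoothZ oW _ (fs L _))]. Qed.

Lemma fsm_del s i f : fsm f -> fsm (fun q L K => del s i (fun p => f p L K) q).
Proof. by move=> fs L K; exact: csmooth_del. Qed.

Lemma del_koszul0 s i f q L K : fsm f -> W q -> del s i (fun p => koszul (fun=> 0) f p L K) q =
  \sum_j Eop j (fun J => del s i (del 'i j (fun p => f p J K)) q) L
  + (-1) ^+ #|L| * \sum_l (del s i (zc c l) q * Eop l (f q L) K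
      + zc c l q * Eop l (fun I => del s i (fun p => f p L I) q) K).
Proof.
move=> fs Wq; pose e j p := Eop j (fun J => del 'i j (fun p' => f p' J K) p) L.
have es j : csmooth W (e j) by apply: (fsm_Eop1 j L K (fsm_del 'i j fs)).
pose y l p := zc c l p * Eop l (f p L) K.
have ys l : csmooth W (y l) by apply: (csmoothM oW (csmooth_zc oW c l)); exact: fsm_Eop2.
have ss := csmooth_sum oW (index_enum 'I_n) (fun j (_ : true) => es j).
have sy := csmooth_sum oW (index_enum 'I_n) (fun j (_ : true) => ys j).
have -> : (fun p => koszul (fun=> 0) f p L K) =
    (fun p => \sum_j e j p + (-1) ^+ #|L| * \sum_l y l p).
  apply/funext => p; rewrite /koszul; congr (_ + _); apply: eq_bigr => j _.
  by apply: eq_Eop => J _; rewrite mul0r subr0.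
rewrite (delD s i ss (csmoothZ oW ((-1) ^+ #|L|) sy) Wq) (delZ s i ((-1) ^+ #|L|) sy Wq).
rewrite (del_sum oW s i _ (fun j _ => es j) Wq) (del_sum oW s i _ (fun j _ => ys j) Wq).
congr (_ + _ * _); apply: eq_bigr => j _.
  rewrite /e (@lin_Eop R n _ (fun t => del s i t q)) // => r J.
  by rewrite (delZ s i r (csmooth_del oW 'i j (fs J K)) Wq).
rewrite (delM s i (csmooth_zc oW c j) (fsm_Eop2 j L K fs) Wq); congr (_ + _ * _).
rewrite (@lin_Eop R n _ (fun t => del s i t q)) // => r J.
by rewrite (delZ s i r (fs L J) Wq).
Qed.

Hypothesis starW : forall q (t : R), W q -> 0 <= t <= 1 -> W (c + t *: (q - c)).

(** Half of the radial integral, of weight [hwt L K] minus one, of the contracted form. In the first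
    sum the factor [zcb] has been taken out of the integral, which raises the weight by one as in
    [crad_zc]; the factor 1/2 compensates the doubled Wirtinger operators. *)
Definition radial_homotopy f : frm := fun q L K =>
  2^-1 * (\sum_j zcb c j q * Iop j (fun J => crad c (hwt L K) (fun p => f p J K) q) L
   + (-1) ^+ #|L| * \sum_i Iop i (fun I =>
        crad c (hwt L K).-1 (del (- 'i) i (fun p => f p L I)) q) K).

Lemma fsm_crad m f : fsm f -> fsm (fun q L K => crad c m (fun p => f p L K) q).
Proof. by move=> fs L K; exact: (csmooth_crad oW starW). Qed.

Lemma fsm_radial_homotopy f : fsm f -> fsm (radial_homotopy f).
Proof.
move=> fs L K; apply: (csmoothZ oW); apply: (csmoothD oW); last apply: (csmoothZ oW).
  apply: (csmooth_sum oW) => j _; apply: (csmoothM oW (csmooth_zcb oW c j)).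
  exact: (fsm_Iop1 j L K (fsm_crad _ fs)).
apply: (csmooth_sum oW) => i _.
exact: (fsm_Iop2 i L K (fsm_crad _ (fsm_del _ i fs))).
Qed.

Lemma del_radial_homotopy k f q L K : fsm f -> W q ->
  del 'i k (fun p => radial_homotopy f p L K) q = 2^-1 *
   (\sum_j (2 * (k == j)%:R * Iop j (fun J => crad c (hwt L K) (fun p => f p J K) q) L
       + zcb c j q * Iop j (fun J => crad c (hwt L K).+1 (del 'i k (fun p => f p J K)) q) L)
    + (-1) ^+ #|L| * \sum_i Iop i (fun I =>
        crad c (hwt L K).-1.+1 (del (- 'i) i (del 'i k (fun p => f p L I))) q) K).
Proof.
move=> fs Wq; set m := hwt L K.
pose e j p := zcb c j p * Iop j (fun J => crad c m (fun p => f p J K) p) L.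
have e1 j : csmooth W (fun p => Iop j (fun J => crad c m (fun p => f p J K) p) L).
  exact: (fsm_Iop1 j L K (fsm_crad _ fs)).
have es j : csmooth W (e j) by exact: (csmoothM oW (csmooth_zcb oW c j)).
pose y i p := Iop i (fun I => crad c m.-1 (del (- 'i) i (fun p => f p L I)) p) K.
have ys i : csmooth W (y i) by exact: (fsm_Iop2 i L K (fsm_crad _ (fsm_del _ i fs))).
have ss := csmooth_sum oW (index_enum 'I_n) (fun j (_ : true) => es j).
have sy := csmooth_sum oW (index_enum 'I_n) (fun j (_ : true) => ys j).
rewrite (delZ 'i k _ (csmoothD oW ss (csmoothZ oW ((-1) ^+ #|L|) sy)) Wq).
rewrite (delD 'i k ss (csmoothZ oW ((-1) ^+ #|L|) sy) Wq) (delZ 'i k ((-1) ^+ #|L|) sy Wq).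
rewrite (del_sum oW 'i k _ (fun j _ => es j) Wq) (del_sum oW 'i k _ (fun j _ => ys j) Wq).
congr (_ * (_ + _ * _)); apply: eq_bigr => j _.
  rewrite (delM 'i k (csmooth_zcb oW c j) (e1 j) Wq) (delbar_zcb oW c k j Wq); congr (_ + _ * _).
  rewrite (@lin_Iop R n _ (fun t => del 'i k t q) (fun q J => crad c m (fun p => f p J K) q)) => [|r J].
    by apply: eq_Iop => J _; rewrite (del_crad oW starW _ _ _ (fs J K) Wq).
  have cs : csmooth W (crad c m (fun p => f p J K)) by exact: (csmooth_crad oW starW m (fs J K)).
  exact: (delZ 'i k r cs Wq).
have ds I := csmooth_del oW (- 'i) j (fs L I).
rewrite /y (@lin_Iop R n _ (fun t => del 'i k t q)
  (fun q I => crad c m.-1 (del (- 'i) j (fun p => f p L I)) q)) => [|r J].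
  apply: eq_Iop => J _; rewrite (del_crad oW starW _ _ _ (ds J) Wq).
  apply: (eq_crad starW _ _ Wq) => p; rewrite inE => Wp.
  exact: (delC oW 'i (- 'i) k j (fs L J) Wp).
have cs : csmooth W (crad c m.-1 (del (- 'i) j (fun p => f p L J))).
  exact: (csmooth_crad oW starW m.-1 (ds J)).
exact: (delZ 'i k r cs Wq).
Qed.

Lemma crad_Eop1 m j f q L K : fsm f -> W q ->
  crad c m (fun p => Eop j (fun J => f p J K) L) q = Eop j (fun J => crad c m (fun p => f p J K) q) L.
Proof.
move=> fs Wq; rewrite (@lin_Eop R n _ (fun t => crad c m t q)) // => r J.
exact: (cradZ oW starW m r (fs J K) Wq).
Qed.

Lemma crad_Eop2 m j f q L K : fsm f -> W q ->
  crad c m (fun p => Eop j (f p L) K) q = Eop j (fun I => crad c m (fun p => f p L I) q) K.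
Proof.
move=> fs Wq; rewrite (@lin_Eop R n _ (fun t => crad c m t q)) // => r J.
exact: (cradZ oW starW m r (fs L J) Wq).
Qed.

Lemma crad_koszul0 m f q L K : fsm f -> W q -> crad c m (fun p => koszul (fun=> 0) f p L K) q =
  \sum_j Eop j (fun J => crad c m (del 'i j (fun p => f p J K)) q) L
  + (-1) ^+ #|L| * \sum_i zc c i q * Eop i (fun I => crad c m.+1 (fun p => f p L I) q) K.
Proof.
move=> fs Wq; pose e j p := Eop j (fun J => del 'i j (fun p' => f p' J K) p) L.
have es j : csmooth W (e j) by apply: (fsm_Eop1 j L K (fsm_del 'i j fs)).
pose y l p := zc c l p * Eop l (f p L) K.
have ys l : csmooth W (y l) by apply: (csmoothM oW (csmooth_zc oW c l)); exact: fsm_Eop2.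
have ss := csmooth_sum oW (index_enum 'I_n) (fun j (_ : true) => es j).
have sy := csmooth_sum oW (index_enum 'I_n) (fun j (_ : true) => ys j).
have -> : (fun p => koszul (fun=> 0) f p L K) =
    (fun p => \sum_j e j p + (-1) ^+ #|L| * \sum_l y l p).
  apply/funext => p; rewrite /koszul; congr (_ + _); apply: eq_bigr => j _.
  by apply: eq_Eop => J _; rewrite mul0r subr0.
rewrite (cradD starW m ss (csmoothZ oW ((-1) ^+ #|L|) sy) Wq) (cradZ oW starW m ((-1) ^+ #|L|) sy Wq).
rewrite (crad_sum oW starW m _ (fun j _ => es j) Wq) (crad_sum oW starW m _ (fun j _ => ys j) Wq).
congr (_ + _ * _); apply: eq_bigr => j _.
  exact: (crad_Eop1 m j L K (fsm_del 'i j fs) Wq).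
rewrite (crad_mul_zc oW starW m j (fsm_Eop2 j L K fs) Wq); congr (_ * _).
exact: crad_Eop2.
Qed.

Lemma crad_del_koszul0 m i f q L K : fsm f -> W q ->
  crad c m (del (- 'i) i (fun p => koszul (fun=> 0) f p L K)) q =
  \sum_j Eop j (fun J => crad c m (del (- 'i) i (del 'i j (fun p => f p J K))) q) L
  + (-1) ^+ #|L| * \sum_l (2 * (i == l)%:R * Eop l (fun I => crad c m (fun p => f p L I) q) K
      + zc c l q * Eop l (fun I => crad c m.+1 (del (- 'i) i (fun p => f p L I)) q) K).
Proof.
move=> fs Wq; pose d j : frm := fun p J K' => del (- 'i) i (del 'i j (fun p' => f p' J K')) p.
have ds j : fsm (d j) by exact: (fsm_del (- 'i) i (fsm_del 'i j fs)).
pose e j p := Eop j (fun J => d j p J K) L.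
have es j : csmooth W (e j) by exact: (fsm_Eop1 j L K (ds j)).
pose y1 l p := 2 * (i == l)%:R * Eop l (f p L) K.
have y1s l : csmooth W (y1 l) by apply: (csmoothZ oW); exact: fsm_Eop2.
pose y2 l p := zc c l p * Eop l (fun I => del (- 'i) i (fun p' => f p' L I) p) K.
have y2s l : csmooth W (y2 l).
  by apply: (csmoothM oW (csmooth_zc oW c l)); exact: (fsm_Eop2 l L K (fsm_del (- 'i) i fs)).
have ys l := csmoothD oW (y1s l) (y2s l).
have ss := csmooth_sum oW (index_enum 'I_n) (fun j (_ : true) => es j).
have sy := csmooth_sum oW (index_enum 'I_n) (fun j (_ : true) => ys j).
transitivity (crad c m (fun p => \sum_j e j p + (-1) ^+ #|L| * \sum_l (y1 l p + y2 l p)) q).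
  apply: (eq_crad starW _ _ Wq) => p; rewrite inE => Wp; rewrite (del_koszul0 _ _ _ _ fs Wp).
  by congr (_ + _ * _); apply: eq_bigr => l _; rewrite (delz_zc oW c i l Wp).
rewrite (cradD starW m ss (csmoothZ oW ((-1) ^+ #|L|) sy) Wq) (cradZ oW starW m ((-1) ^+ #|L|) sy Wq).
rewrite (crad_sum oW starW m _ (fun j _ => es j) Wq) (crad_sum oW starW m _ (fun j _ => ys j) Wq).
congr (_ + _ * _); apply: eq_bigr => j _.
  exact: (crad_Eop1 m j L K (ds j) Wq).
rewrite (cradD starW m (y1s j) (y2s j) Wq); congr (_ + _).
  rewrite (cradZ oW starW m _ (fsm_Eop2 j L K fs) Wq); congr (_ * _); exact: crad_Eop2.
rewrite (crad_mul_zc oW starW m j (fsm_Eop2 j L K (fsm_del (- 'i) i fs)) Wq); congr (_ * _).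
exact: (crad_Eop2 m.+1 j L K (fsm_del (- 'i) i fs) Wq).
Qed.

(** [koszul_laplacian] gives the Euler field plus [2 * m] times the integral of weight [m - 1], and
    [crad_euler] produces the same integral with the opposite sign. What remains is the value at [q]
    and, in weight 0 only, the value at the centre. *)
Lemma koszul_radial_homotopy f q L K : fsm f -> W q ->
  koszul (fun=> 0) (radial_homotopy f) q L K + radial_homotopy (koszul (fun=> 0) f) q L K
  = f q L K - 0 ^+ hwt L K * f c L K.
Proof.
move=> fs Wq.
pose A m J I := crad c m (fun p => f p J I) q.
pose B j m J I := crad c m (del 'i j (fun p => f p J I)) q.
pose D i m J I := crad c m (del (- 'i) i (fun p => f p J I)) q.
pose E i j m J I := crad c m (del (- 'i) i (del 'i j (fun p => f p J I))) q.
have main := koszul_laplacian (zc c ^~ q) (zcb c ^~ q) A B D E L K.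
have eul := crad_euler oW starW (hwt L K) (fs L K) Wq.
have two0 : (2 : C) != 0 by rewrite pnatr_eq0.
apply: (mulfI two0); rewrite mulrDr.
have {}main := etrans (etrans main (esym (addrA _ _ _))) (f_equal (fun t => 2 * (hwt L K)%:R * A (hwt L K).-1 L K + t) eul).
rewrite (_ : _ * (_ - _) = 2 * (hwt L K)%:R * A (hwt L K).-1 L K +
  2 * (f q L K - 0 ^+ hwt L K * f c L K - (hwt L K)%:R * crad c (hwt L K).-1 (fun p => f p L K) q)).
  rewrite -main; congr (_ + _); last first.
    rewrite /radial_homotopy mulrA mulfV// mul1r; congr (_ + _ * _); apply: eq_bigr => j _.
      by congr (_ * _); apply: eq_Iop => J _; rewrite (crad_koszul0 _ _ _ fs Wq).
    by apply: eq_Iop => J _; rewrite (crad_del_koszul0 _ _ _ _ fs Wq).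
  rewrite /koszul mulrDr; congr (_ + _).
    rewrite mulr_sumr; apply: eq_bigr => k _; rewrite -EopZ; apply: eq_Eop => J _.
    by rewrite mul0r subr0 (del_radial_homotopy _ _ _ fs Wq) mulrA mulfV// mul1r.
  rewrite mulrCA; congr (_ * _); rewrite mulr_sumr; apply: eq_bigr => i _.
  rewrite mulrCA; congr (_ * _); rewrite -EopZ; apply: eq_Eop => I _.
  by rewrite /radial_homotopy mulrA mulfV// mul1r.
rewrite /A; move: (crad _ _ _ _) => a; ring.
Qed.

End RadialHomotopy.

(** * Contractions away from the point and around it *)

Section Contractions.
Variables (R : realType) (n : nat).
Local Notation TB := (TB R n).
Local Notation C := R[i].
Local Notation frm := (TB -> {set 'I_n} -> {set 'I_n} -> C).
Variables (c : TB) (W : set TB).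
Hypothesis oW : open W.
Implicit Types (f g : frm) (L K J I : {set 'I_n}) (i j k : 'I_n) (q : TB) (b : 'I_n -> R).

(* [h b] contracts the Koszul complex on [W] onto the value at [c] of the
   component of weight [0]; [e b] spans its cohomology. *)
Definition contraction (h : ('I_n -> R) -> frm -> frm) (e : ('I_n -> R) -> TB -> C) :=
  forall b f,
  [/\ fsm W f -> fsm W (h b f),
      fsm W f -> forall q L K, W q ->
        koszul c (fun i => (b i)%:C) (h b f) q L K + h b (koszul c (fun i => (b i)%:C) f) q L K
        = f q L K - 0 ^+ hwt L K * e b q * f c L K,
      forall q L K, (forall p L' K', (#|L'| + #|K'| = (#|L| + #|K|).+1)%N -> f p L' K' = 0) ->
        h b f q L K = 0,
      (forall q L K, W q -> f q L K = 0) -> forall q L K, W q -> h b f q L K = 0 &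
      h b f c finset.set0 [set: 'I_n]%SET = 0].

Definition koszul_inv i b f : frm := fun q L K => (-1) ^+ #|L| * ((zc c i q)^-1 * Iop i (f q L) K).

(** The inverse of z_i is holomorphic on [W], so with the sign of the form degree the contraction
    anticommutes with the dbar part, and the Clifford relation with the coordinates gives the
    identity. No cohomology is left, hence the zero function for [e]. *)
Lemma koszul_inv_contraction i : (forall q, W q -> zc c i q != 0) ->
  contraction (koszul_inv i) (fun _ _ => 0).
Proof.
move=> z0 b f.
have zs : csmooth W (fun q => (zc c i q)^-1) := csmooth_inv oW z0 (csmooth_zc oW c i).
pose g : frm := fun q L K => (zc c i q)^-1 * Iop i (f q L) K.
have gsm : fsm W f -> fsm W g.
  by move=> fs L K; exact: (csmoothM oW zs (fsm_Iop2 oW i L K fs)).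
split=> [/gsm gs' L K|fs q L K Wq|q L K f0|f0 q L K Wq|]; first exact: (csmoothZ oW _ (gs' L K)).
- have {}gsm := gsm fs; have dg j J I : del 'i j (fun p => g p J I) q
      = (zc c i q)^-1 * Iop i (fun I' => del 'i j (fun p => f p J I') q) I.
    have s1 := csmooth_zc oW c i; have s2 := gsm J I.
    have := delM 'i j s1 s2 Wq; rewrite (delbar_zc oW c j i Wq) mul0r add0r => E.
    (* Multiplying by [zc c i], which dbar annihilates, removes the inverse from the derivative. *)
    apply: (mulfI (z0 q Wq)); rewrite -E mulrA mulfV ?z0// mul1r.
    transitivity (del 'i j (fun p => Iop i (f p J) I) q).
      apply: (eq_del oW 'i j _ Wq) => p; rewrite inE => Wp.
      by rewrite /g mulrA mulfV ?z0// mul1r.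
    apply: (@lin_Iop R n _ (fun t => del 'i j t q) (fun q I' => f q J I')) => r J'.
    exact: (delZ 'i j r (fs J J') Wq).
  have T1 : \sum_j Eop j (fun J => del 'i j (fun p => koszul_inv i b f p J K) q
       - (b j)%:C * koszul_inv i b f q J K) L
     = - ((-1) ^+ #|L| * ((zc c i q)^-1 * \sum_j Iop i (fun I => Eop j (fun J =>
           del 'i j (fun p => f p J I) q - (b j)%:C * f q J I) L) K)).
    rewrite !mulr_sumr -sumrN; apply: eq_bigr => j _.
    rewrite -Eop_Iop -EopZ -Eop_sign; apply: eq_Eop => J _.
    rewrite (delZ 'i j ((-1) ^+ #|J|) (gsm J K) Wq) dg /koszul_inv.
    have -> : Iop i (fun I => del 'i j (fun p => f p J I) q - (b j)%:C * f q J I) K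
       = Iop i (fun I => del 'i j (fun p => f p J I) q) K - (b j)%:C * Iop i (f q J) K.
      by rewrite -mulNr -IopZ -IopD; apply: eq_Iop => I _; rewrite mulNr.
    move: (Iop _ _ _) (Iop _ _ _) => A B; ring.
  have T2 : \sum_k zc c k q * Eop k (koszul_inv i b f q L) K = (-1) ^+ #|L| * ((zc c i q)^-1 *
      \sum_k zc c k q * Eop k (Iop i (f q L)) K).
    rewrite !mulr_sumr; apply: eq_bigr => k _.
    have -> : Eop k (koszul_inv i b f q L) K = (-1) ^+ #|L| * ((zc c i q)^-1 * Eop k (Iop i (f q L)) K).
      by rewrite -!EopZ.
    move: (Eop _ _ _) => A; ring.
  have T3 : koszul_inv i b (koszul c (fun i => (b i)%:C) f) q L K = (-1) ^+ #|L| * ((zc c i q)^-1 *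
      (\sum_j Iop i (fun I => Eop j (fun J =>
           del 'i j (fun p => f p J I) q - (b j)%:C * f q J I) L) K
       + (-1) ^+ #|L| * \sum_k zc c k q * Iop i (Eop k (f q L)) K)).
    rewrite /koszul_inv; do 2!congr (_ * _).
    rewrite -Iop_sum; under [X in _ = _ + _ * X]eq_bigr do rewrite -IopZ.
    by rewrite -Iop_sum -IopZ -IopD.
  have T4 : \sum_k zc c k q * Eop k (Iop i (f q L)) K + \sum_k zc c k q * Iop i (Eop k (f q L)) K
      = zc c i q * f q L K.
    rewrite -big_split (bigD1 i)//= -mulrDr CliffordC eqxx mul1r big1 ?addr0// => k ki.
    by rewrite -mulrDr CliffordC eq_sym (negPf ki) mul0r mulr0.
  rewrite {1}/koszul T1 T2 T3 mulr0 mul0r subr0.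
  have alg (s a x y z' w v : C) : s * s = 1 -> a * z' = 1 -> x + y = z' * v ->
      - (s * (a * w)) + s * (s * (a * x)) + s * (a * (w + s * y)) = v.
    move=> ss az xy; rewrite -[RHS]mul1r -az -mulrA -xy.
    by rewrite -[X in _ = a * X]mul1r -ss; ring.
  by apply: (alg _ _ _ _ (zc c i q)) T4; [rewrite -expr2 sqrr_sign|rewrite mulVf ?z0].
- rewrite /koszul_inv /Iop; case: ifP => iK; first by rewrite !mulr0.
  by rewrite f0 ?mulr0// finset.cardsU1 iK addnS.
- rewrite /koszul_inv /Iop; case: ifP => _; first by rewrite !mulr0.
  by rewrite f0// !mulr0.
- by rewrite /koszul_inv /Iop inE !mulr0.
Qed.

Hypothesis starW : forall q (t : R), W q -> 0 <= t <= 1 -> W (c + t *: (q - c)).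

Definition exp_homotopy b f : frm := fun q L K => expl c b q *
  radial_homotopy c (fun p L' K' => expl c (fun i => - b i) p * f p L' K') q L K.

Lemma koszul_expl b f q L K : fsm W f -> W q ->
  koszul c (fun i => (b i)%:C) (fun p L K => expl c b p * f p L K) q L K
  = expl c b q * koszul c (fun=> 0) f q L K.
Proof.
move=> fs Wq; rewrite /koszul mulrDr; congr (_ + _).
  rewrite mulr_sumr; apply: eq_bigr => j _; rewrite -EopZ; apply: eq_Eop => J _.
  rewrite (delM 'i j (csmooth_expl oW c b) (fs J K) Wq) (del_expl oW c).
  move: (del _ _ _ _) => A; ring.
rewrite mulrCA; congr (_ * _); rewrite mulr_sumr; apply: eq_bigr => i _.
by rewrite EopZ mulrCA.
Qed.

Lemma eq_radial_homotopy f g q L K : (forall p, W p -> f p = g p) -> W q ->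
  radial_homotopy c f q L K = radial_homotopy c g q L K.
Proof.
move=> fg Wq; refine (f_equal (fun t => 2^-1 * t)
  (f_equal2 (fun s t => s + (-1) ^+ #|L| * t) _ _)); apply: eq_bigr => j _.
  refine (f_equal (fun t => zcb c j q * t) _); apply: eq_Iop => J _; apply: (eq_crad starW _ _ Wq) => p; rewrite inE => Wp.
  by rewrite fg.
apply: eq_Iop => I _; apply: (eq_crad starW _ _ Wq) => p; rewrite inE => Wp.
by apply: (eq_del oW _ _ _ Wp) => p'; rewrite inE => Wp'; rewrite fg.
Qed.

Lemma crad_cst0 m q : crad c m (fun=> 0) q = 0.
Proof.
have cs : csmooth [set: TB] (fun=> 0 : C) by exact: csmooth_cst.
have st : forall p (t : R), [set: TB] p -> 0 <= t <= 1 -> [set: TB] (c + t *: (p - c)) by [].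
have E := cradZ openT st m 0 cs (Logic.I : [set: TB] q).
apply: etrans (etrans E (mul0r _)); apply: (f_equal (fun t => crad c m t q)).
by apply/funext => p; rewrite mul0r.
Qed.

Lemma radial_homotopy_eq0 f q L K :
  (forall p L' K', (#|L'| + #|K'| = (#|L| + #|K|).+1)%N -> f p L' K' = 0) ->
  radial_homotopy c f q L K = 0.
Proof.
move=> f0; rewrite /radial_homotopy !big1 ?mulr0 ?addr0 ?mulr0// => j _.
  rewrite (@eq_Iop _ _ j _ (fun=> 0)) => [|I KI]; first by rewrite /Iop mulr0; case: ifP.
  have -> : (fun p => f p L I) = (fun=> 0) by apply/funext => p; rewrite f0// KI addnS.
  have -> : del (- 'i) j (fun=> 0 : C) = (fun=> 0) by apply/funext => p; rewrite del_cst.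
  exact: crad_cst0.
rewrite (@eq_Iop _ _ j _ (fun=> 0)) => [|J LJ]; first by rewrite /Iop mulr0; case: ifP; rewrite mulr0.
have -> : (fun p => f p J K) = (fun=> 0) by apply/funext => p; rewrite f0// LJ addSn.
exact: crad_cst0.
Qed.

(** Multiplication by [expl c b] intertwines the differential of the zero linear form with that of
    [b], so the radial homotopy is conjugated by it; [expl] equals 1 at the centre, which normalises
    the residual term. *)
Lemma exp_homotopy_contraction : contraction exp_homotopy (fun b => expl c b).
Proof.
move=> b f; pose nb i := - b i.
pose y : frm := fun p L' K' => expl c nb p * f p L' K'.
have ys : fsm W f -> fsm W y.
  by move=> fs L K; exact: (csmoothM oW (csmooth_expl oW c nb) (fs L K)).
split=> [/ys{}ys L K|fs q L K Wq|q L K f0|f0 q L K Wq|].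
- have hs := fsm_radial_homotopy oW starW ys; exact: (csmoothM oW (csmooth_expl oW c b) (hs L K)).
- have {}ys := ys fs; have hs := fsm_radial_homotopy oW starW ys.
  rewrite (koszul_expl b L K hs Wq).
  have -> : exp_homotopy b (koszul c (fun i => (b i)%:C) f) q L K
      = expl c b q * radial_homotopy c (koszul c (fun=> 0) y) q L K.
    refine (f_equal (fun t => expl c b q * t) (eq_radial_homotopy L K _ Wq)) => p Wp.
    apply/funext => L'; apply/funext => K'.
    have -> : f = (fun p L K => expl c b p * y p L K).
      by apply/funext => p'; apply/funext => L0; apply/funext => K0; rewrite /y mulrA explN mul1r.
    by rewrite (koszul_expl b L' K' ys Wp) mulrA [X in X * _]mulrC explN mul1r.
  rewrite -mulrDr (koszul_radial_homotopy oW starW L K ys Wq) /y expl_center.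
  rewrite mul1r mulrBr mulrA explN mul1r; ring.
- by rewrite /exp_homotopy radial_homotopy_eq0 ?mulr0// => p L' K' E; rewrite f0 ?mulr0.
- rewrite /exp_homotopy (@eq_radial_homotopy _ (fun _ _ _ => 0) q L K _ Wq) => [|p Wp].
    by rewrite radial_homotopy_eq0 ?mulr0.
  by apply/funext => L'; apply/funext => K'; rewrite f0 ?mulr0.
(* At the centre the coordinates vanish, and no index lies outside the full set, so both sums are
   zero. *)
- rewrite /exp_homotopy /radial_homotopy !big1 ?mulr0 ?addr0 ?mulr0// => j _.
    by rewrite /Iop inE.
  by rewrite /zcb !subrr mulr0 subr0 mul0r.
Qed.

End Contractions.

(** * Successive approximation in the exponent *)

Section Perturbation.
Variables (R : realType) (n : nat) (U : set 'rV[R]_n) (u0 : 'rV[R]_n).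
Variable F : fukaya_algebra U u0.
Hypothesis u0U : U u0.
Local Notation C := R[i].
Local Notation H := (dclass F).
Local Notation TB := (TB R n).
Local Notation T := 'rV[R]_n.
Local Notation frm := (TB -> {set 'I_n} -> {set 'I_n} -> C).
Local Notation phi := (TB -> H -> {set 'I_n} -> {set 'I_n} -> C).
Local Notation G := (@disk_monoid R n U u0 F).
Local Notation psec := (@Phi_sec R n U u0 F).
Hypothesis m0 : forall beta, @mk R n U u0 F beta [::] = 0.
Variables (u : T) (alpha : 'rV[C]_n).
Hypothesis alphaI : purely_imaginary alpha.
Local Notation th := (theta u alpha).
Local Notation pt := (TBpoint u alpha).
Local Notation ev := (@evt R n U u0 F u alpha).
Implicit Types (x y f : phi) (beta : H) (I J K L : {set 'I_n}) (p q : TB).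

Definition bdrR beta i : R := (boundary beta 0 i)%:~R.

Lemma bdrRE beta i : (bdrR beta i)%:C = bdr beta i.
Proof. by rewrite /bdrR /bdr rmorph_int. Qed.

Lemma theta_tau i p : th p 0 i - tau p 0 i = zc pt i p.
Proof.
rewrite !mxE /zc /= !mxE; case: (alpha 0 i) (alphaI i) => a b /= ->; apply/eqP.
by rewrite eq_complex /=; apply/andP; split; apply/eqP; ring.
Qed.

(** The coefficient of T^beta in the differential involves only exponents that split off from
    [beta]; this is what allows a finite stage of the approximation to stand in for its limit. *)
Lemma dif_sp x y p beta : G beta ->
  (forall c, c \in sp beta -> forall q L I, x q c L I = y q c L I) ->
  Phi_dif th x p beta = Phi_dif th y p beta.
Proof.
move=> Gb xy; apply/funext => L; apply/funext => K; rewrite !PhiE//.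
have bs : beta \in sp beta.
  by rewrite mem_sp//; apply/asboolP; rewrite subrr; split=> //; exact: disk_monoid0.
have -> : dbar (slice x K) p beta L = dbar (slice y K) p beta L.
  rewrite !dbarE; apply: eq_bigr => i _; apply: eq_Eop => J _; rewrite /delb /slice xy//.
  by have -> : (fun q => x q beta J K) = (fun q => y q beta J K) by apply/funext => q; rewrite xy.
congr (_ + _); apply: eq_bigr => I _; rewrite !cv_qs; apply: eq_big_seq => c cs.
by rewrite /gs /slice xy.
Qed.

(** When the smaller exponents are absent, only the beta = 0 part of Q acts, and [Qcoef0] identifies
    it with multiplication by [theta - tau], that is by the coordinates z. *)
Lemma dif_diagonal x p beta L K : G beta ->
  (forall c, c \in sp beta -> c != beta -> forall q L I, x q c L I = 0) ->
  Phi_dif th x p beta L K = koszul pt (fun i => (bdrR beta i)%:C) (fun q => x q beta) p L K.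
Proof.
move=> Gb x0; rewrite PhiE// /koszul dbarE; congr (_ + _).
  by apply: eq_bigr => i _; apply: eq_Eop => J _; rewrite bdrRE.
have bs : beta \in sp beta.
  by rewrite mem_sp//; apply/asboolP; rewrite subrr; split=> //; exact: disk_monoid0.
transitivity (\sum_(I : {set 'I_n}) (-1) ^+ #|L| * (x p beta L I * Qcoef th p (0 : H) I K)).
  apply: eq_bigr => I _; rewrite cv_qs (big_rem _ bs)/= subrr big1_seq ?addr0 => [|c /andP[_]].
    by rewrite /gs /slice mulrA.
  rewrite mem_rem_uniq ?sp_uniq// !inE => /andP[cb cs].
  by rewrite /gs /slice x0// mulr0 mul0r.
rewrite -mulr_sumr; congr (_ * _).
under eq_bigr do rewrite Qcoef0 mulr_sumr.
rewrite exchange_big; apply: eq_bigr => i _ /=.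
under eq_bigr do rewrite theta_tau mulrCA -EopZ.
rewrite -mulr_sumr -Eop_sum; congr (_ * _); apply: eq_Eop => J _.
by rewrite (bigD1 J)//= eqxx mulr1 big1 ?addr0// => I /negPf IJ; rewrite eq_sym IJ mulr0.
Qed.

Variable V : set T.
Hypothesis oV : open V.
Variables (h : ('I_n -> R) -> frm -> frm) (e : ('I_n -> R) -> TB -> C).
Hypothesis hC : contraction pt (VT V) h e.

(** The contraction acts on each exponent separately, with the linear form given by the boundary of
    that exponent. *)
Definition hh x : phi := zext V (fun p beta L K => h (bdrR beta) (fun q => x q beta) p L K).

Lemma psec_fsm d x beta : psec V d x -> fsm (VT V) (fun q => x q beta).
Proof. by move=> /(psec_psm u0U) xs L K; exact: (xs K beta L). Qed.

Lemma hh_neq0 d x p beta L K : psec V d x -> hh x p beta L K != 0 ->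
  exists q L' K', x q beta L' K' != 0 /\ (#|L'| + #|K'| = (#|L| + #|K|).+1)%N.
Proof.
move=> xs; have [Vp|Vp] := pselect (V p.1); last by rewrite /hh zext_out ?eqxx.
rewrite /hh zext_in// => hn; apply: contrapT => nex; move/eqP: hn; apply.
have [_ _ h0 _ _] := hC (bdrR beta) (fun q => x q beta); apply: h0 => q L' K' E.
by apply/eqP; apply: contrapT => /negP xn; apply: nex; exists q, L', K'.
Qed.

Lemma psec_hh d x : psec V d x -> psec V (d - 1) (hh x).
Proof.
move=> xs; have [x0 _ xd /(novikov_suppE u0U) xG] := xs; split.
- by apply/zextP => p Vp; rewrite /hh zext_out.
- move=> beta L K; have [hs _ _ _ _] := hC (bdrR beta) (fun q => x q beta).
  apply: (eq_csmooth (open_VT oV) _ (hs (psec_fsm beta xs) L K)) => q; rewrite inE => /VTP Vq.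
  by rewrite /hh zext_in.
- move=> p beta L K /(hh_neq0 xs)[q [L' [K' [/xd <- E]]]].
  have -> : #|L'|%:Z + #|K'|%:Z = #|L|%:Z + #|K|%:Z + 1.
    by rewrite -!PoszD E -addn1 PoszD.
  ring.
- apply/(novikov_suppE u0U) => beta [p [L [K /(hh_neq0 xs)[q [L' [K' [xn _]]]]]]].
  by apply: xG; exists q, L', K'.
Qed.

Lemma psec_G d x beta : psec V d x -> ~ G beta -> forall p L K, x p beta L K = 0.
Proof.
move=> [_ _ _ /(novikov_suppE u0U) xG] nG p L K; apply/eqP; apply: contrapT => /negP xn.
by apply: nG; apply: xG; exists p, L, K.
Qed.

Lemma hh_eq0 d x beta : psec V d x -> (forall q L K, x q beta L K = 0) ->
  forall p L K, hh x p beta L K = 0.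
Proof.
move=> xs x0 p L K; apply/eqP; apply: contrapT => /negP /(hh_neq0 xs)[q [L' [K' []]]].
by rewrite x0 eqxx.
Qed.

Local Notation DD := (fun y : phi => zext V (Phi_dif th y)).

(* A closed section vanishing at the point is exact up to terms with larger
   exponents of [T]. *)
Lemma contraction_step d x beta : psec V d x -> DD x = 0 -> (V u -> ev V x = 0) ->
  (forall c, (rk c < rk beta)%N -> forall q L K, x q c L K = 0) ->
  forall p L K, (x - DD (hh x)) p beta L K = 0.
Proof.
move=> xs Dx evx x0 p L K; have [x00 _ _ _] := xs.
have hs := psec_hh xs.
have [Gb|nG] := pselect (G beta); last first.
  rewrite !fctE (psec_G xs nG) (psec_G (psec_dif u0U u alpha oV hs) nG); exact: subrr.
have [Vp|Vp] := pselect (V p.1); last by rewrite !fctE -x00 !zext_out// subrr.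
have c0 c : c \in sp beta -> c != beta -> (rk c < rk beta)%N.
  by rewrite mem_sp// => /asboolP[Gc Gbc] cb; exact: (rk_lt u0U).
have xc c : c \in sp beta -> c != beta -> forall q L I, x q c L I = 0.
  by move=> cs cb; apply: x0; exact: c0.
have hc c : c \in sp beta -> c != beta -> forall q L I, hh x q c L I = 0.
  by move=> cs cb; apply: (hh_eq0 xs); exact: xc.
have [_ hE _ _ _] := hC (bdrR beta) (fun q => x q beta).
have addE (a b : phi) : (a - b) p beta L K = a p beta L K - b p beta L K by [].
rewrite addE zext_in// (dif_diagonal p L K Gb hc).
have VTp : VT V p by exact/VTP.
have kE : koszul pt (fun i => (bdrR beta i)%:C) (fun q => hh x q beta) p L K =
    koszul pt (fun i => (bdrR beta i)%:C) (h (bdrR beta) (fun q => x q beta)) p L K.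
  have hx q : VT V q -> hh x q beta = h (bdrR beta) (fun q => x q beta) q.
    by move=> /VTP Vq; apply/funext => L'; apply/funext => K'; rewrite /hh zext_in.
  refine (f_equal2 (fun s t => s + (-1) ^+ #|L| * t) _ _); apply: eq_bigr => i _.
    apply: eq_Eop => J _; refine (f_equal2 (fun s t => s - (bdrR beta i)%:C * t) _ _).
      by apply: (eq_del (open_VT oV) _ _ _ VTp) => q; rewrite inE => Vq; rewrite hx.
    exact: (congr1 (fun t => t J K) (hx p VTp)).
  refine (f_equal (fun t => zc pt i p * t) _); apply: eq_Eop => I _.
  exact: (congr1 (fun t => t L I) (hx p VTp)).
have kx : h (bdrR beta) (koszul pt (fun i => (bdrR beta i)%:C) (fun q => x q beta)) p L K = 0.
  have [_ _ _ h0 _] := hC (bdrR beta) (koszul pt (fun i => (bdrR beta i)%:C) (fun q => x q beta)).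
  apply: (h0 _ p L K VTp) => q L' K' /VTP Vq; rewrite -(dif_diagonal q L' K' Gb xc).
  have := congr1 (fun t : phi => t q) Dx; rewrite /= zext_in// => ->.
  by [].
have := hE (psec_fsm beta xs) p L K VTp; rewrite kE kx addr0 => ->.
(* Weight zero forces [L] empty and [K] full, the component seen by evaluation; in positive weight
   the power of 0 removes the residual term. *)
rewrite opprB addrC subrK; case w0 : (hwt L K) => [|m]; last by rewrite expr0n /= !mul0r.
have L0 : L = finset.set0.
  by apply/eqP; rewrite -cards_eq0; move: w0; rewrite /hwt; case: #|L|.
have KT : K = [set: 'I_n]%SET.
  apply/eqP; rewrite eqEcard finset.subsetT cardsT card_ord.
  by move: w0; rewrite /hwt => /eqP; rewrite addn_eq0 => /andP[_]; rewrite subn_eq0.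
have [Vu|Vu] := pselect (V u).
  by have := congr1 (fun a => a beta) (evx Vu); rewrite /evt L0 KT => ->; exact: mulr0.
by rewrite -x00 zext_out// mulr0.
Qed.

Lemma evt_hh x : V u -> ev V (hh x) = 0.
Proof.
move=> Vu; apply/funext => beta; rewrite /evt /hh zext_in//.
by have [_ _ _ _ ->] := hC (bdrR beta) (fun q => x q beta).
Qed.

(** Each step subtracts the differential of the homotopy. For closed [x] vanishing at the point, [k]
    steps clear all coefficients of rank below [k], and [primitive] collects the homotopies used. *)
Fixpoint residue x k : phi := if k is k'.+1 then residue x k' - DD (hh (residue x k')) else x.

Definition primitive x k : phi := \sum_(j < k) hh (residue x j).

(** Each coefficient is read off at a stage from which it no longer changes, as [primitive_stable]
    shows, so no topological limit is taken. *)
Definition limit_primitive x : phi := fun p beta L K => primitive x (rk beta).+1 p beta L K.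

Lemma psecN d x : psec V d x -> psec V d (- x).
Proof.
by move=> /(PsecP u0U) xs; apply/(PsecP u0U) => I; exact: (osecN u0U oV (xs I)).
Qed.

Lemma psecB d x y : psec V d x -> psec V d y -> psec V d (x - y).
Proof.
move=> /(PsecP u0U) xs /(PsecP u0U) ys; apply/(PsecP u0U) => I.
exact: (osecB u0U oV (xs I) (ys I)).
Qed.

Lemma psecD d x y : psec V d x -> psec V d y -> psec V d (x + y).
Proof. by move=> xs ys; rewrite -[y]opprK; apply: psecB => //; exact: psecN. Qed.

Lemma psec0 d : psec V d 0.
Proof. by apply/(PsecP u0U) => I; exact: (osec0 F u0U). Qed.

Lemma DDB d x y : psec V d x -> psec V d y -> DD (x - y) = DD x - DD y.
Proof.
move=> /(psec_psm u0U) xs /(psec_psm u0U) ys; apply/funext => p.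
have addE (a b : phi) : (a - b) p = a p - b p by [].
rewrite addE; have [Vp|Vp] := pselect (V p.1); last by rewrite !zext_out// subrr.
by rewrite !zext_in//; exact: (difB u0U u alpha oV xs ys Vp).
Qed.

Lemma DD0 : DD 0 = 0.
Proof. by have := DDB (psec0 0) (psec0 0); rewrite !subrr. Qed.

Lemma DDDD d x : psec V d x -> DD (DD x) = 0.
Proof.
move=> xs; apply/funext => p; have [Vp|Vp] := pselect (V p.1); last by rewrite zext_out.
rewrite zext_in//; have xp := psec_psm u0U xs.
have -> : Phi_dif th (DD x) p = Phi_dif th (Phi_dif th x) p.
  by apply: (dif_local u0U u alpha oV _ Vp) => q Vq; rewrite zext_in.
exact: (dif_dif u0U m0 u alpha oV xp Vp).
Qed.

Section Closed.
Variables (d : int) (x : phi).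
Hypotheses (xs : psec V d x) (Dx : DD x = 0) (evx : V u -> ev V x = 0).

Lemma residueP k : [/\ psec V d (residue x k), DD (residue x k) = 0, V u -> ev V (residue x k) = 0 &
  forall beta, (rk beta < k)%N -> forall p L K, residue x k p beta L K = 0].
Proof.
elim: k => [|k [rs Dr er r0]]; first by split.
have hs := psec_hh rs; have ds := psec_dif u0U u alpha oV hs; rewrite subrK in ds.
split.
- exact: psecB.
- by rewrite (DDB rs ds) Dr (DDDD hs) subrr.
- move=> Vu; have evB (a b : phi) : ev V (a - b) = ev V a - ev V b by [].
  by rewrite /= evB er// (evt_dif u0U alphaI)// subrr.
- move=> beta bk p L K; apply: (contraction_step rs Dr er) => c cb q L' K'.
  by apply: r0; exact: leq_trans cb _.
Qed.

Lemma psec_primitive k : psec V (d - 1) (primitive x k).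
Proof.
rewrite /primitive; elim/big_ind: _ => [||j _]; [exact: psec0|exact: psecD|].
by have [rs _ _ _] := residueP j; exact: psec_hh.
Qed.

Lemma DD_primitive k : DD (primitive x k) = x - residue x k.
Proof.
elim: k => [|k IHk].
  by rewrite /primitive big_ord0 DD0 subrr.
have [rs _ _ _] := residueP k; have hs := psec_hh rs.
have -> : primitive x k.+1 = primitive x k - - hh (residue x k).
  by rewrite opprK /primitive big_ord_recr.
rewrite (DDB (psec_primitive k) (psecN hs)) IHk -[X in DD X]sub0r (DDB (psec0 _) hs).
rewrite DD0 sub0r opprK /= opprB addrA.
by rewrite [LHS]addrAC.
Qed.

Lemma primitive_stable k beta : (rk beta < k)%N -> forall p L K,
  primitive x k p beta L K = limit_primitive x p beta L K.
Proof.
move=> + p L K; elim: k => // k IHk; rewrite ltnS leq_eqVlt => /orP[/eqP <- //|bk].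
have addE (a b : phi) : (a + b) p beta L K = a p beta L K + b p beta L K by [].
have -> : primitive x k.+1 = primitive x k + hh (residue x k) by rewrite /primitive big_ord_recr.
rewrite addE IHk//.
have [rs _ _ r0] := residueP k; rewrite (hh_eq0 rs) ?addr0// => q L' K'.
exact: r0.
Qed.

(** At exponent [b] the differential of the limit sees only exponents of rank at most [rk b], all of
    which are stable at stage [(rk b).+1]; at that stage the residue at [b] is already zero. *)
Lemma exact_primitive : [/\ psec V (d - 1) (limit_primitive x), DD (limit_primitive x) = x &
  V u -> ev V (limit_primitive x) = 0].
Proof.
have ps k := psec_primitive k; have ls : psec V (d - 1) (limit_primitive x).
  split.
  - apply/zextP => p Vp; apply/funext => b; apply/funext => L; apply/funext => K.
    by have [/zextP p0 _ _ _] := ps (rk b).+1; rewrite /limit_primitive p0.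
  - by move=> b L K; have [_ s _ _] := ps (rk b).+1; exact: s.
  - by move=> p b L K; have [_ _ pd _] := ps (rk b).+1; exact: pd.
  - apply/(novikov_suppE u0U) => b [p [L [K pn]]].
    have [_ _ _ /(novikov_suppE u0U) pG] := ps (rk b).+1.
    by apply: pG; exists p, L, K.
split=> [//||Vu].
  have ds := psec_dif u0U u alpha oV ls.
  apply/funext => p; apply/funext => b; apply/funext => L; apply/funext => K.
  have [Gb|nG] := pselect (G b); last by rewrite (psec_G ds nG) (psec_G xs nG).
  have [rs _ _ r0] := residueP (rk b).+1.
  have E : DD (primitive x (rk b).+1) p b L K = x p b L K.
    have addE (a c : phi) : (a - c) p b L K = a p b L K - c p b L K by [].
    by rewrite DD_primitive addE r0// subr0.
  rewrite -E; have [Vp|Vp] := pselect (V p.1); last by rewrite !zext_out.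
  rewrite !zext_in//.
  have -> // : Phi_dif th (limit_primitive x) p b = Phi_dif th (primitive x (rk b).+1) p b.
  apply: dif_sp => // c cs q L' I; apply/esym; apply: primitive_stable.
  rewrite ltnS; have [->//|cb] := eqVneq c b.
  by move: cs; rewrite mem_sp// => /asboolP[Gc Gbc]; apply: ltnW; exact: (rk_lt u0U).
apply/funext => b; rewrite /evt /limit_primitive /primitive fct_sumE.
have sE (r : seq 'I_(rk b).+1) : (\sum_(j <- r) hh (residue x j) pt) b finset.set0 [set: 'I_n]%SET
   = \sum_(j <- r) ev V (hh (residue x j)) b by rewrite !fct_sumE.
by rewrite sE big1// => j _; rewrite evt_hh.
Qed.

End Closed.
End Perturbation.

(** * Evaluation is a quasi-isomorphism *)

Section QuasiIsomorphism.
Variables (R : realType) (n : nat) (U : set 'rV[R]_n) (u0 : 'rV[R]_n).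
Variable F : fukaya_algebra U u0.
Hypothesis u0U : U u0.
Local Notation C := R[i].
Local Notation H := (dclass F).
Local Notation TB := (TB R n).
Local Notation T := 'rV[R]_n.
Local Notation frm := (TB -> {set 'I_n} -> {set 'I_n} -> C).
Local Notation phi := (TB -> H -> {set 'I_n} -> {set 'I_n} -> C).
Local Notation psec := (@Phi_sec R n U u0 F).
Hypothesis m0 : forall beta, @mk R n U u0 F beta [::] = 0.
Variables (u : T) (alpha : 'rV[C]_n).
Hypothesis alphaI : purely_imaginary alpha.
Local Notation th := (theta u alpha).
Local Notation pt := (TBpoint u alpha).
Local Notation ev := (@evt R n U u0 F u alpha).
Implicit Types (p : T) (V : set T).

(** Around [u], a ball times the whole fibre is star-shaped about the point. Elsewhere some x_i
    differs from that of [u]; this difference is the real part of z_i, so z_i has no zero over the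
    neighbourhood, whatever y is. *)
Lemma local_contraction V p : open V -> V p -> exists V', [/\ open V', V' p & V' `<=` V] /\
  exists h e, contraction pt (VT V') h e.
Proof.
move=> oV Vp; have [pu|pu] := eqVneq p u.
  have [r /= r0 rV] : nbhs_ball u V by apply/nbhs_ballP; rewrite -pu; exact: open_nbhs_nbhs.
  exists (ball u r); split; first by split; [exact: ball_open|rewrite pu; exact: ballxx|].
  exists (exp_homotopy pt), (fun b => expl pt b); apply: exp_homotopy_contraction.
    by apply: open_VT; exact: ball_open.
  move=> q t /VTP[_ uq] /andP[t0 t1]; apply/VTP; split=> // i j.
  have := uq i j; rewrite -!ball_normE /= !mxE opprD addrA subrr add0r normrN normrM ger0_norm//.
  by rewrite distrC; apply: le_lt_trans; rewrite ler_piMl.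
have [i pui] : exists i, p 0 i != u 0 i.
  apply: contrapT => nex; move/eqP: pu; apply; apply/rowP => i; apply/eqP.
  by apply: contrapT => /negP pui; apply: nex; exists i.
exists (V `&` [set q : T | q 0 i != u 0 i]).
have oV' : open (V `&` [set q : T | q 0 i != u 0 i]).
  have -> : [set q : T | q 0 i != u 0 i] = (fun q : T => q 0 i) @^-1` (~` [set u 0 i]).
    by apply/seteqP; split=> q /= /eqP.
  apply: openI => //; apply: open_comp => [q _|]; first exact: coord_continuous.
  by apply: closed_openC; exact: closed_eq.
split; first by split=> // q [].
exists (koszul_inv pt i), (fun _ _ => 0); apply: (koszul_inv_contraction (open_VT oV')).
move=> q /VTP[_ /= qi]; apply: contraNneq qi => /(congr1 (@complex.Re R)).
by rewrite /zc /= => E; rewrite -subr_eq0; apply/eqP; rewrite -[RHS]E; ring.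
Qed.

(** Injectivity is [exact_primitive]. For surjectivity a value [y] is extended to a section [iy],
    whose differential is closed and vanishes at the point; subtracting a primitive of it that also
    vanishes there gives a closed section with value [y]. *)
Lemma evt_quasi_iso : is_quasi_iso U (M := @Phi_tau R n U u0 F th)
  (N := @skyscraper R n U u0 F u alpha) ev.
Proof.
move=> p d V [oV VU] Vp; have [V' [[oV' V'p V'V] [h [e hC]]]] := local_contraction oV Vp.
have opnV' : opn U V' by split=> //; exact: subset_trans V'V VU.
have addE (a b : phi) q : (a - b) q = a q - b q by [].
split=> [x y xs Dx ys xy|y ys _].
  have xs' : psec V' d (zext V' x).
    apply/(PsecP u0U) => I; rewrite slice_zext.
    by apply: (osec_zext u0U oV' V'V); move: xs => /(PsecP u0U).
  have Dx' : zext V' (Phi_dif th (zext V' x)) = 0.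
    apply/funext => q; have [Vq|Vq] := pselect (V' q.1); last by rewrite zext_out.
    rewrite zext_in// (@dif_local R n U u0 F u0U u alpha V' _ x) => // [|q' Vq']; last by rewrite zext_in.
    by have := congr1 (fun f : phi => f q) Dx; rewrite /= zext_in//; exact: V'V.
  have evx : V' u -> ev V' (zext V' x) = 0.
    move=> Vu; apply/funext => b; rewrite /evt zext_in//.
    exact: (congr1 (fun a : H -> C => a b) xy).
  have [zs Dz _] := exact_primitive u0U m0 alphaI oV' hC xs' Dx' evx.
  by exists V', (limit_primitive u alpha V' h (zext V' x)); split.
(* Over a set without [u] the skyscraper has only the zero section, so [y] restricts to zero. *)
have [Vu|nVu] := pselect (V' u); last first.
  exists V', 0, 0; split=> //; split.
  - exact: (psec0 F u0U).
  - exact: (@DD0 R n U u0 F u0U u alpha V' oV').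
  - by apply/(ssecP u0U); split=> // b; rewrite eqxx.
  - by rewrite /= addr0; case: asboolP.
(* In each exponent [expl] solves the twisted dbar equation and equals 1 at the point, and
   multiplication by z kills the top class: [iy] is closed up to larger exponents. *)
pose iy : phi := zext V' (fun q b L K => y b * expl pt (bdrR b) q
   * ((L == finset.set0) && (K == [set: 'I_n]%SET))%:R).
have iyn q b L K : iy q b L K != 0 -> [/\ y b != 0, L = finset.set0 & K = [set: 'I_n]%SET].
  have [Vq|Vq] := pselect (V' q.1); last by rewrite /iy zext_out ?eqxx.
  rewrite /iy zext_in// !mulf_eq0 !negb_or => /andP[/andP[yb _]].
  by case: andP => [[/eqP -> /eqP ->] //|_]; rewrite eqxx.
have /(ssecP u0U)[_ yd yG] := ys.
have iys : psec V' d iy.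
  split.
  - by apply/zextP => q Vq; rewrite /iy zext_out.
  - move=> b L K; have s1 := csmooth_expl (open_VT oV') pt (bdrR b).
    have s2 := csmoothM (open_VT oV') (csmoothZ (open_VT oV') (y b) s1)
      (csmooth_cst (VT V') ((L == finset.set0) && (K == [set: 'I_n]%SET))%:R).
    by apply: (eq_csmooth (open_VT oV') _ s2) => q; rewrite inE => /VTP Vq; rewrite /iy zext_in.
  - move=> q b L K /iyn[/yd -> -> ->]; rewrite cards0 cardsT card_ord; ring.
  - by apply/(novikov_suppE u0U) => b [q [L [K /iyn[/yG]]]].
have ws := psec_dif u0U u alpha oV' iys.
have Dw := DDDD u0U m0 u alpha oV' iys.
have evw : V' u -> ev V' (zext V' (Phi_dif th iy)) = 0 by move=> ?; exact: (evt_dif u0U alphaI).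
have [zs Dz evz] := exact_primitive u0U m0 alphaI oV' hC ws Dw evw; rewrite addrK in zs.
set z := limit_primitive u alpha V' h _ in zs Dz evz.
exists V', (iy - z), 0; split=> //; split.
- exact: (psecB u0U oV').
- by rewrite /= (DDB u0U u alpha oV' iys zs) Dz subrr.
- by apply/(ssecP u0U); split=> // b; rewrite eqxx.
- rewrite addr0 /=; case: asboolP => // _; apply/funext => b.
  have -> : ev V' (iy - z) b = ev V' iy b - ev V' z b by [].
  by rewrite evz// subr0 /evt /iy zext_in// expl_center !eqxx !mulr1.
Qed.

End QuasiIsomorphism.

Theorem theorem1p5 (R : realType) (n : nat) (U : set 'rV[R]_n) (u0 : 'rV[R]_n)
    (open_U : open U) (contractible_U : contractible U) (u0_in_U : U u0)
    (F : fukaya_algebra U u0)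
    (weak_unobstructedness : weakly_unobstructed F)
    (no_negative_maslov :
       forall (beta : dclass F) (s : seq (ext R n)), maslov beta < 0 -> mk beta s = 0)
    (potential_zero : forall p : TB R n, U p.1 -> potential F p = 0) :
  forall (u : 'rV[R]_n) (alpha : 'rV[R[i]]_n), U u -> purely_imaginary alpha ->
    quasi_isomorphic U (Phi_tau_L F u alpha) (skyscraper F u alpha).
Proof.
have m0 := m0_eq0 u0_in_U weak_unobstructedness potential_zero.
move=> u alpha Uu alphaI.
have PM := Phi_dgmod u0_in_U m0 u alpha.
have SM := sky_dgmod F u0_in_U u alpha.
split=> //; first exact: Ohol_dgalg.
apply: Relation_Operators.rst_step; split=> //; exists (evt u alpha); split.
  exact: evt_hom.
exact: evt_quasi_iso.
Qed.
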